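(* Let $n \ge 4$ be an integer and let $\mathbf{p}=(p_1,\ldots,p_n)$ be a signature (a sequence of positive integers with $\sum_{i=1}^n 1/p_i<1$), with canonical ring $R$. Then the generalized triangle singularity $\operatorname{Spec} R$ is an isolated hypersurface singularity (that is, $R$ is a hypersurface and $\operatorname{Spec} R$ has an isolated singularity at the origin) if and only if $$\sum_{i=1}^n \frac{1}{p_i} + \frac{1}{\prod_{i=1}^n p_i} = 1.$$
   Context: Let $n\ge 4$. A signature is a sequence $\mathbf{p}=(p_1,\ldots,p_n)$ of positive integers with $\sum_{i=1}^n \frac1{p_i}<1$. Let $L$ be the rank-one abelian group $L=(\mathbb{Z}\vec{X}_1\oplus\cdots\oplus\mathbb{Z}\vec{X}_n\oplus\mathbb{Z}\vec{c})/(p_i\vec{X}_i-\vec{c} : 1\le i\le n)$, and let $T=\mathbb{C}[X_1,\ldots,X_n]/(\sum_{i=1}^n X_i^{p_i})$, graded by $L$ with $X_i$ in degree $\vec{X}_i$; write $T_{\vec v}$ for the degree $\vec v$ part. The dualizing element is $\vec\omega=\vec c-\sum_{i=1}^n\vec X_i\in L$, and the canonical ring is the $\mathbb{Z}$-graded subring $R=\bigoplus_{k=0}^\infty R_k$ of $T$, with $R_k=T_{k\vec\omega}$. Let $\mathfrak m=\bigoplus_{k\ge1}R_k$. The embedding dimension of $R$ is $\dim_{\mathbb C}\mathfrak m/\mathfrak m^2$, and $R$ is called a hypersurface if its embedding dimension equals its Krull dimension plus one (as $R$ has Krull dimension $n-1$, this means $\dim_{\mathbb C}\mathfrak m/\mathfrak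 m^2=n$). The generalized triangle singularity with signature $\mathbf p$ is the singularity of $\operatorname{Spec}R$ at the origin, i.e. at the point $\mathfrak m$; it is isolated if $\operatorname{Spec}R$ is singular at $\mathfrak m$ and regular away from $\mathfrak m$. *)

(* Defs.v *)
From HB Require Import structures.
From mathcomp Require Import all_boot all_order all_algebra.
From mathcomp Require Import generic_quotient ring_quotient.
From mathcomp Require Import boolp reals complex mpoly ring.

Set Implicit Arguments.
Unset Strict Implicit.
Unset Printing Implicit Defensive.

Import Order.TTheory GRing.Theory Num.Theory.

Local Open Scope ring_scope.
Local Open Scope quotient_scope.

(* Proper ideals of A are elements of [idealr A], points of Spec A are elements *)
(* of [prime_idealr A]. These are boolean predicates, up to extensional         *)
(* equality [=i]; with classical logic this is no restriction.                  *)

Section Localization.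

Variables (A : comNzRingType) (P : prime_idealr A).

Definition denom := {s : A | s \notin P}.

Lemma denom1_subproof : 1 \notin P.
Proof. by rewrite idealr1. Qed.

Lemma denomM_subproof (s t : denom) : val s * val t \notin P.
Proof. by rewrite prime_idealrM negb_or (valP s) (valP t). Qed.

Definition denom1 : denom := Sub 1 denom1_subproof.
Definition denomM (s t : denom) : denom := Sub (val s * val t) (denomM_subproof s t).

Definition prefrac := (A * denom)%type.

Definition frac_equiv (x y : prefrac) : bool :=
  `[< exists u : denom, val u * (x.1 * val y.2 - y.1 * val x.2) = 0 >].

Lemma frac_equiv_refl : reflexive frac_equiv.
Proof. by move=> x; apply/asboolP; exists denom1; rewrite subrr mulr0. Qed.

Lemma frac_equiv_sym : ssrbool.symmetric frac_equiv.
Proof.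
have H x y : frac_equiv x y -> frac_equiv y x.
  move=> /asboolP[u Hu]; apply/asboolP; exists u.
  by rewrite -opprB mulrN Hu oppr0.
by move=> x y; apply/idP/idP; apply: H.
Qed.

Lemma frac_equiv_trans : transitive frac_equiv.
Proof.
move=> [b t] [a s] [c r] /asboolP[u /= Hu] /asboolP[v /= Hv].
apply/asboolP; exists (denomM (denomM u v) t) => /=.
transitivity (sval v * sval r * (sval u * (a * sval t - b * sval s))
  + sval u * sval s * (sval v * (b * sval r - c * sval t))); first by ring.
by rewrite Hu Hv !mulr0 addr0.
Qed.

Canonical frac_equiv_equiv :=
  EquivRel frac_equiv frac_equiv_refl frac_equiv_sym frac_equiv_trans.
Canonical frac_equiv_encModRel := defaultEncModRel frac_equiv.

Definition localization := {eq_quot frac_equiv}.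

HB.instance Definition _ : EqQuotient _ frac_equiv localization :=
  EqQuotient.on localization.
HB.instance Definition _ := Choice.on localization.

Lemma frac_equiv_repr x : frac_equiv x (repr (\pi_localization x)).
Proof. by have /eqmodP := esym (reprK (\pi_localization x)). Qed.

Definition loc_zero : localization := \pi_localization (0, denom1).
Definition loc_one : localization := \pi_localization (1, denom1).

Definition frac_add (x y : prefrac) : prefrac :=
  (x.1 * val y.2 + y.1 * val x.2, denomM x.2 y.2).
Definition frac_opp (x : prefrac) : prefrac := (- x.1, x.2).
Definition frac_mul (x y : prefrac) : prefrac := (x.1 * y.1, denomM x.2 y.2).

Definition loc_add := lift_op2 localization frac_add.
Definition loc_opp := lift_op1 localization frac_opp.
Definition loc_mul := lift_op2 localization frac_mul.

Lemma pi_loc_add : {morph \pi : x y / frac_add x y >-> loc_add x y}.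
Proof.
move=> x y; unlock loc_add; apply/eqmodP => /=.
have /asboolP[u] := frac_equiv_repr x; have /asboolP[v] := frac_equiv_repr y.
case: (repr _) => b t; case: (repr _) => a s; case: x y => [c r] [d q] /= Hv Hu.
apply/asboolP; exists (denomM u v) => /=.
transitivity (sval v * sval q * sval t * (sval u * (c * sval s - a * sval r))
  + sval u * sval r * sval s * (sval v * (d * sval t - b * sval q))); first by ring.
by rewrite Hu Hv !mulr0 addr0.
Qed.

Lemma pi_loc_mul : {morph \pi : x y / frac_mul x y >-> loc_mul x y}.
Proof.
move=> x y; unlock loc_mul; apply/eqmodP => /=.
have /asboolP[u] := frac_equiv_repr x; have /asboolP[v] := frac_equiv_repr y.
case: (repr _) => b t; case: (repr _) => a s; case: x y => [c r] [d q] /= Hv Hu.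
apply/asboolP; exists (denomM u v) => /=.
transitivity (sval v * d * sval t * (sval u * (c * sval s - a * sval r))
  + sval u * a * sval r * (sval v * (d * sval t - b * sval q))); first by ring.
by rewrite Hu Hv !mulr0 addr0.
Qed.

Lemma pi_loc_opp : {morph \pi : x / frac_opp x >-> loc_opp x}.
Proof.
move=> x; unlock loc_opp; apply/eqmodP => /=.
have /asboolP[u] := frac_equiv_repr x.
case: (repr _) => a s; case: x => [c r] /= Hu.
apply/asboolP; exists u => /=.
transitivity (- (sval u * (c * sval s - a * sval r))); first by ring.
by rewrite Hu oppr0.
Qed.

Lemma frac_eq (x y : prefrac) :
  x.1 * val y.2 - y.1 * val x.2 = 0 -> \pi x = \pi y :> localization.
Proof.
by move=> H; apply/eqmodP/asboolP; exists denom1; rewrite H mulr0.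
Qed.

Lemma loc_addA : associative loc_add.
Proof.
elim/quotW=> x; elim/quotW=> y; elim/quotW=> z.
by rewrite -!pi_loc_add; apply: frac_eq => /=; ring.
Qed.

Lemma loc_addC : commutative loc_add.
Proof.
elim/quotW=> x; elim/quotW=> y.
by rewrite -!pi_loc_add; apply: frac_eq => /=; ring.
Qed.

Lemma loc_add0 : left_id loc_zero loc_add.
Proof.
by elim/quotW=> x; rewrite -!pi_loc_add; apply: frac_eq => /=; ring.
Qed.

Lemma loc_addN : left_inverse loc_zero loc_opp loc_add.
Proof.
elim/quotW=> x; rewrite -pi_loc_opp -pi_loc_add.
by apply: frac_eq => /=; ring.
Qed.

HB.instance Definition _ :=
  GRing.isZmodule.Build localization loc_addA loc_addC loc_add0 loc_addN.

Lemma loc_mulA : associative loc_mul.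
Proof.
elim/quotW=> x; elim/quotW=> y; elim/quotW=> z.
by rewrite -!pi_loc_mul; apply: frac_eq => /=; ring.
Qed.

Lemma loc_mulC : commutative loc_mul.
Proof.
elim/quotW=> x; elim/quotW=> y.
by rewrite -!pi_loc_mul; apply: frac_eq => /=; ring.
Qed.

Lemma loc_mul1 : left_id loc_one loc_mul.
Proof.
by elim/quotW=> x; rewrite -!pi_loc_mul; apply: frac_eq => /=; ring.
Qed.

Lemma loc_mulDl : left_distributive loc_mul loc_add.
Proof.
elim/quotW=> x; elim/quotW=> y; elim/quotW=> z.
rewrite -!pi_loc_mul -!pi_loc_add -!pi_loc_mul.
by apply: frac_eq => /=; ring.
Qed.

Lemma loc_one_neq0 : loc_one != loc_zero.
Proof.
apply/negP => /eqP/eqmodP/asboolP[u] /=.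
rewrite mulr1 mul0r subr0 mulr1 => u0.
by have := valP u; rewrite /= u0 idealr0.
Qed.

HB.instance Definition _ := GRing.Zmodule_isComNzRing.Build localization
  loc_mulA loc_mulC loc_mul1 loc_mulDl loc_one_neq0.

End Localization.

(* For submodules N <= M of V and a maximal ideal J of K such that J M <= N,    *)
(* the (K / J)-vector space M / N has dimension d: b is a basis of M / N.       *)
(* With J = m this is dim m/m^2 over the residue field of a local ring, with    *)
(* J = 0 it is the dimension over the field K.                                  *)
Definition quot_dim (K : nzRingType) (V : lmodType K)
    (J : {pred K}) (M N : {pred V}) (d : nat) :=
  exists b : 'I_d -> V,
    [/\ forall i, b i \in M,
        forall x, x \in M -> exists a : 'I_d -> K, x - \sum_i a i *: b i \in N &
        forall a : 'I_d -> K, \sum_i a i *: b i \in N -> forall i, a i \in J].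

Section CommutativeAlgebra.

Variable A : comNzRingType.

(* The unit ideal, which is not an [idealr], is generated by 1.                 *)
Definition noetherian :=
  forall I : idealr A, exists k (g : 'I_k -> A),
    forall x, x \in I <-> exists a : 'I_k -> A, x = \sum_i a i * g i.

Definition prime_chain (d : nat) :=
  exists P : 'I_d.+1 -> prime_idealr A, forall i j : 'I_d.+1, (i < j)%N ->
    {subset P i <= P j} /\ ~ {subset P j <= P i}.

Definition krull_dim (d : nat) :=
  prime_chain d /\ forall e, prime_chain e -> (e <= d)%N.

Definition sq_ideal (I : {pred A}) : {pred A} := fun x =>
  `[< exists k (u v : 'I_k -> A),
        (forall i, u i \in I /\ v i \in I) /\ x = \sum_i u i * v i >].

(* [m] contains every proper ideal, i.e. A is local with maximal ideal m.       *)
Definition regular_local_ring :=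
  noetherian /\
  exists (m : idealr A) (d : nat),
    [/\ forall I : idealr A, {subset I <= m},
        krull_dim d &
        quot_dim (V := A^o) m m (sq_ideal m) d].

End CommutativeAlgebra.

Definition regular_at (A : comNzRingType) (P : prime_idealr A) :=
  regular_local_ring (localization P).

Definition isolated_singularity (A : comNzRingType) (m : {pred A}) :=
  exists2 o : prime_idealr A, o =i m &
    ~ regular_at o /\ forall P : prime_idealr A, ~ (P =i m) -> regular_at P.

Record signature (n : nat) := Signature {
  sig_val :> 'I_n -> nat;
  sig_gt0 : forall i, (0 < sig_val i)%N;
  sig_lt1 : \sum_i ((sig_val i)%:R)^-1 < 1 :> rat
}.

Section DegreeGroup.

Variables (n : nat) (p : signature n).

Definition pre_group := ({ffun 'I_n -> int} * int)%type.

Definition preX (i : 'I_n) : pre_group := ([ffun j => (j == i)%:R], 0).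
Definition prec : pre_group := (0, 1).

Definition degree_rel : {pred pre_group} := fun z =>
  `[< exists a : 'I_n -> int, z = \sum_i (preX i *+ p i - prec) *~ a i >].

Lemma degree_rel_zmod_closed : zmod_closed degree_rel.
Proof.
split=> [|x y /asboolP[a ->] /asboolP[b ->]]; apply/asboolP.
  by exists (fun=> 0); rewrite big1 // => i _; rewrite mulr0z.
by exists (fun i => a i - b i); rewrite -sumrB; apply: eq_bigr => i _; rewrite mulrzBr.
Qed.

HB.instance Definition _ := GRing.isZmodClosed.Build pre_group degree_rel
  degree_rel_zmod_closed.

Definition degree_group := Quotient.quot degree_rel.
HB.instance Definition _ := GRing.Zmodule.on degree_group.

Definition degX (i : 'I_n) : degree_group := \pi_degree_group (preX i).
Definition degc : degree_group := \pi_degree_group prec.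

Definition omega : degree_group := degc - \sum_i degX i.

Definition mondeg (m : 'X_{1..n}) : degree_group := \sum_i degX i *+ m i.

End DegreeGroup.

Section CanonicalRing.

Variables (F : fieldType) (n : nat) (p : signature n).

Definition fermat_poly : {mpoly F[n]} := \sum_i 'X_i ^+ p i.

Definition fermat_ideal : {pred {mpoly F[n]}} := fun g =>
  `[< exists h, g = h * fermat_poly >].

Lemma fermat_ideal_closed : idealr_closed fermat_ideal.
Proof.
split=> [||a u v /asboolP[g ->] /asboolP[h ->]].
- by apply/asboolP; exists 0; rewrite mul0r.
- apply/asboolP => -[h /(congr1 (meval (fun=> 0)))].
  rewrite rmorph1 rmorphM /= [X in _ * X](_ : _ = 0) ?mulr0.
    by move/eqP; rewrite oner_eq0.
  rewrite rmorph_sum big1 //= => i _.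
  by rewrite rmorphXn /= mevalXU expr0n gtn_eqF ?sig_gt0.
- by apply/asboolP; exists (a * g + h); rewrite mulrDl mulrA.
Qed.

HB.instance Definition _ := isIdealr.Build {mpoly F[n]} fermat_ideal fermat_ideal_closed.

Definition fermat_ring := {ideal_quot fermat_ideal}.
HB.instance Definition _ := GRing.ComNzRing.on fermat_ring.

Definition to_fermat (f : {mpoly F[n]}) : fermat_ring := \pi f.

Lemma to_fermat_zmod_morphism : zmod_morphism to_fermat.
Proof. by move=> x y; rewrite /to_fermat rmorphB. Qed.
Lemma to_fermat_monoid_morphism : monoid_morphism to_fermat.
Proof. by split; [rewrite /to_fermat rmorph1|move=> x y; rewrite /to_fermat rmorphM]. Qed.
HB.instance Definition _ := GRing.isZmodMorphism.Build _ _ to_fermat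
  to_fermat_zmod_morphism.
HB.instance Definition _ := GRing.isMonoidMorphism.Build _ _ to_fermat
  to_fermat_monoid_morphism.

Definition fermat_scale (a : F) (t : fermat_ring) : fermat_ring := to_fermat a%:MP * t.

Lemma fermat_scaleA a b t : fermat_scale a (fermat_scale b t) = fermat_scale (a * b) t.
Proof. by rewrite /fermat_scale mpolyCM rmorphM mulrA. Qed.
Lemma fermat_scale1 : left_id 1 fermat_scale.
Proof. by move=> t; rewrite /fermat_scale mpolyC1 rmorph1 mul1r. Qed.
Lemma fermat_scaleDr : right_distributive fermat_scale +%R.
Proof. by move=> a t u; rewrite /fermat_scale mulrDr. Qed.
Lemma fermat_scaleDl t : {morph fermat_scale^~ t : a b / a + b}.
Proof. by move=> a b; rewrite /fermat_scale mpolyCD rmorphD mulrDl. Qed.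
HB.instance Definition _ := GRing.Zmodule_isLmodule.Build F fermat_ring
  fermat_scaleA fermat_scale1 fermat_scaleDr fermat_scaleDl.
Lemma fermat_scaleAl (a : F) (t u : fermat_ring) : a *: (t * u) = a *: t * u.
Proof. exact: mulrA. Qed.
HB.instance Definition _ := GRing.Lmodule_isLalgebra.Build F fermat_ring fermat_scaleAl.

Definition fermat_part (v : degree_group p) : {pred fermat_ring} := fun t =>
  `[< exists f : {mpoly F[n]},
        (forall m, m \in msupp f -> mondeg p m = v) /\ t = to_fermat f >].

Lemma fermat_part_submod v : submod_closed (fermat_part v).
Proof.
split=> [|a x y /asboolP[f [Hf ->]] /asboolP[g [Hg ->]]]; apply/asboolP.
  by exists 0; split; rewrite ?rmorph0 // => m; rewrite msupp0.
exists (a *: f + g); split.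
  move=> m /msuppD_le; rewrite mem_cat => /orP[/msuppZ_le|]; first exact: Hf.
  exact: Hg.
by rewrite rmorphD /= -mul_mpolyC rmorphM.
Qed.
HB.instance Definition _ v := GRing.isSubmodClosed.Build F fermat_ring (fermat_part v)
  (fermat_part_submod v).

Lemma mondegD (m m' : 'X_{1..n}) : mondeg p (m + m')%MM = mondeg p m + mondeg p m'.
Proof.
rewrite /mondeg -big_split; apply: eq_bigr => i _ /=.
by rewrite mnmDE mulrnDr.
Qed.

Lemma fermat_part1 : 1 \in fermat_part 0.
Proof.
apply/asboolP; exists 1; rewrite rmorph1; split=> // m.
rewrite msupp1 inE => /eqP ->; rewrite /mondeg big1 // => i _.
by rewrite mnm0E mulr0n.
Qed.

Lemma fermat_partM v w t u :
  t \in fermat_part v -> u \in fermat_part w -> t * u \in fermat_part (v + w).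
Proof.
move=> /asboolP[f [Hf ->]] /asboolP[g [Hg ->]]; apply/asboolP.
exists (f * g); split; last by rewrite rmorphM.
move=> m /msuppM_le /allpairsP[[a b] /= [/Hf af /Hg bg ->]].
by rewrite mondegD af bg.
Qed.

Definition can_part (k : nat) : {pred fermat_ring} := fermat_part (omega p *+ k).

Definition can_pred : {pred fermat_ring} := fun t =>
  `[< exists N (r : nat -> fermat_ring),
        (forall k, r k \in can_part k) /\ t = \sum_(0 <= k < N) r k >].

Lemma can_predD : {in can_pred &, forall x y, x + y \in can_pred}.
Proof.
move=> x y /asboolP[N [r [Hr ->]]] /asboolP[M [s [Hs ->]]]; apply/asboolP.
have ext N' M' (t : nat -> fermat_ring) : \sum_(0 <= k < N') t k =
    \sum_(0 <= k < N' + M') (if (k < N')%N then t k else 0).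
  rewrite [RHS](@big_cat_nat _ _ _ N') ?leq_addr //= [X in _ + X]big1_seq.
    rewrite addr0; apply: eq_big_nat => k /andP[_ ->] //.
  by move=> k; rewrite mem_index_iota => /andP[_ /andP[Nk _]]; rewrite ltnNge Nk.
exists (N + M)%N, (fun k => (if (k < N)%N then r k else 0)
                          + (if (k < M)%N then s k else 0)); split.
  by move=> k; rewrite rpredD //; case: ifP => _; rewrite ?rpred0.
by rewrite big_split /= -ext addnC -ext.
Qed.

Lemma can_part_sub k : {subset can_part k <= can_pred}.
Proof.
move=> t tk; apply/asboolP.
exists k.+1, (fun i => if i == k then t else 0); split.
  by move=> i; case: eqP => [->|_] //; rewrite rpred0.
rewrite big_nat_recr //= eqxx big1_seq ?add0r // => i /andP[_].
by rewrite mem_index_iota => /andP[_ ik]; rewrite ltn_eqF.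
Qed.

Lemma can_pred0 : 0 \in can_pred.
Proof. by apply: (@can_part_sub 0%N); rewrite rpred0. Qed.

Lemma can_pred_sum N (r : nat -> fermat_ring) :
  (forall k, r k \in can_pred) -> \sum_(0 <= k < N) r k \in can_pred.
Proof.
by move=> Hr; elim/big_ind: _ => //; [exact: can_pred0|exact: can_predD].
Qed.

Lemma can_pred_subalg : subalg_closed can_pred.
Proof.
split.
- by apply: (@can_part_sub 0%N); rewrite /can_part mulr0n fermat_part1.
- move=> a x y /asboolP[N [r [Hr ->]]] Hy; apply: can_predD => //.
  rewrite scaler_sumr; apply: can_pred_sum => k.
  by apply: (@can_part_sub k); rewrite rpredZ.
- move=> x y /asboolP[N [r [Hr ->]]] /asboolP[M [s [Hs ->]]].
  rewrite mulr_suml; apply: can_pred_sum => k.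
  rewrite mulr_sumr; apply: can_pred_sum => l.
  by apply: (@can_part_sub (k + l)); rewrite /can_part mulrnDr fermat_partM.
Qed.
HB.instance Definition _ := GRing.isSubalgClosed.Build F fermat_ring can_pred
  can_pred_subalg.

Definition canonical_ring := {t : fermat_ring | t \in can_pred}.
HB.instance Definition _ := [isSub of canonical_ring for sval].
HB.instance Definition _ := [Choice of canonical_ring by <:].
HB.instance Definition _ := [SubChoice_isSubComNzRing of canonical_ring by <:].
HB.instance Definition _ := [SubZmodule_isSubLmodule of canonical_ring by <:].

Definition canonical_max : {pred canonical_ring} := fun x =>
  `[< exists N (r : nat -> fermat_ring),
        (forall k, r k \in can_part k) /\ val x = \sum_(1 <= k < N) r k >].

Definition embedding_dim (d : nat) :=
  quot_dim (V := canonical_ring) (pred1 (0 : F))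
    canonical_max (sq_ideal canonical_max) d.

Definition hypersurface :=
  exists2 d, krull_dim canonical_ring d & embedding_dim d.+1.

End CanonicalRing.

Arguments fermat_poly F {n} p.
Arguments fermat_ideal F {n} p.
Arguments fermat_ring F {n} p.
Arguments fermat_part F {n} p v.
Arguments can_part F {n} p k.
Arguments can_pred F {n} p.
Arguments canonical_ring F {n} p.
Arguments canonical_max F {n} p.
Arguments embedding_dim F {n} p d.
Arguments hypersurface F {n} p.

(* Main.v *)
Require Import Defs.
From HB Require Import structures.
From mathcomp Require Import all_boot all_order all_algebra.
From mathcomp Require Import generic_quotient ring_quotient boolp reals complex mpoly ring zify.

Set Implicit Arguments.
Unset Strict Implicit.
Unset Printing Implicit Defensive.

Import Order.TTheory GRing.Theory Num.Theory.

Local Open Scope ring_scope.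

(** The canonical ring R is the image in T = C[X]/(f) of the span of the
    monomials whose degree is a multiple of omega.  Put P = prod p_i, q_i = P / p_i and
    w = P - sum q_i; the equation says w = 1.

    If w = 1, the p_i are pairwise coprime and every monomial degree is a
    multiple of omega, so R = T.  Away from the origin some derivative f_j of f
    is a unit.  At a prime P there, a maximal set of variables independent
    modulo P yields the transcendence degree r; minimal relations c_k of the
    other variables form a basis of P/P^2, and the derivations f_j d_k - f_k d_j
    kill f, so iterating P |-> {g : D^i g in P for all i} (prime in
    characteristic 0) gives a chain of n - 1 - r primes below P.

    Conversely, if g = gcd(p_i, p_j) > 1, then R has a singularity of type
    A_(g-1) along X_i = X_j = 0, which is visible in the dimension of the
    cotangent space and, as n >= 4, not concentrated at the origin.  If the p_i
    are pairwise coprime and w > 1, then T is etale over R away from the origin.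
    Were m/m^2 of dimension at most n, the differentials of n homogeneous
    generators of R and df would form an n x (n + 1) matrix J over T, zero at
    the origin, whose cokernel is killed by powers of the variables.  But T has
    a regular sequence of three such powers (again n >= 4), and this forces J to
    be split surjective, as for the ideal of maximal minors, of height at most
    2 by Eagon and Northcott. *)

(** * Finitely generated ideals *)

(** The numerology is a single homomorphism from L to the integers: X_i goes to q_i, c to P, and
    omega to w = P (1 - sum 1/p_i). For pairwise coprime p_i a monomial lies in R exactly when w
    divides its weight, so R is the ring of invariants of the w-th roots of unity acting on T with
    weights q_i. Every q_i is prime to w: the action is therefore free off the origin, which is the
    reason for the etaleness, and for w > 1 no variable is invariant, which is why J vanishes at the
    origin. The bound n >= 4 enters twice. The locus X_i = X_j = 0 has dimension n - 3 in Spec T, so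
    it is larger than the origin; and three powers of variables form a regular sequence in T because
    [f] remains monic in a fourth variable. For the converse the Krull dimension d of R is not
    computed: d < n suffices, as it bounds the embedding dimension d + 1 by n. Chains of primes are
    bounded through transcendence: each step down a chain adds one independent element, while n + 1
    polynomials in n variables are always dependent. *)

Section Ideals.

Variable A : comNzRingType.

Lemma prime_idealr_of (P : A -> Prop) :
  P 0 -> (forall x y, P x -> P y -> P (x + y)) -> (forall a x, P x -> P (a * x)) ->
  ~ P 1 -> (forall x y, P (x * y) -> P x \/ P y) ->
  exists Q : prime_idealr A, forall x, (x \in Q) <-> P x.
Proof.
move=> P0 PD PM P1 Ppr.
pose S : A -> bool := fun x => `[< P x >].
have Sc : idealr_closed S.
  split; rewrite ?unfold_in; first by apply/asboolP.
    by apply/asboolP.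
  move=> a u v; rewrite !unfold_in => /asboolP Hu /asboolP Hv.
  by apply/asboolP/PD => //; apply: PM.
have Sp : prime_idealr_closed S.
  by move=> u v; rewrite !unfold_in => /asboolP /Ppr [] H; apply/orP; [left|right]; apply/asboolP.
pose Z := GRing.isZmodClosed.Build A S (idealr_closedB Sc).
pose I1 := isProperIdeal.Build A S (idealr_closed_nontrivial Sc).
pose Pr := isPrimeIdealrClosed.Build A S Sp.
pose Q : prime_idealr A := HB.pack S Z I1 Pr.
by exists Q => x; split=> [/asboolP|/asboolP].
Qed.

Lemma idealr_of (P : A -> Prop) :
  P 0 -> (forall x y, P x -> P y -> P (x + y)) -> (forall a x, P x -> P (a * x)) ->
  ~ P 1 -> exists Q : idealr A, forall x, (x \in Q) <-> P x.
Proof.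
move=> P0 PD PM P1.
pose S : A -> bool := fun x => `[< P x >].
have Sc : idealr_closed S.
  split; rewrite ?unfold_in; first by apply/asboolP.
    by apply/asboolP.
  move=> a u v; rewrite !unfold_in => /asboolP Hu /asboolP Hv.
  by apply/asboolP/PD => //; apply: PM.
pose Z := GRing.isZmodClosed.Build A S (idealr_closedB Sc).
pose I1 := isProperIdeal.Build A S (idealr_closed_nontrivial Sc).
pose Q : idealr A := HB.pack S Z I1.
by exists Q => x; split=> [/asboolP|/asboolP].
Qed.

Lemma idealr_sum (I : idealr A) k (a u : 'I_k -> A) :
  (forall i, u i \in I) -> \sum_i a i * u i \in I.
Proof. by move=> uI; apply: rpred_sum => i _; apply: idealMr. Qed.

Lemma prime_prod (P : prime_idealr A) (I : Type) (r : seq I) (s : I -> A) :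
  (forall i, s i \notin P) -> \prod_(i <- r) s i \notin P.
Proof.
move=> sP; elim/big_rec: _ => [|i x _ xP]; first by rewrite idealr1.
by rewrite prime_idealrM negb_or sP xP.
Qed.

Lemma prime_exp (P : prime_idealr A) x k : x \notin P -> x ^+ k \notin P.
Proof.
move=> xP; elim: k => [|k IH]; first by rewrite expr0 idealr1.
by rewrite exprS prime_idealrM negb_or xP.
Qed.

(* Unlike [idealr], this covers the unit ideal. *)
Definition is_ideal (I : A -> Prop) :=
  [/\ I 0, forall x y, I x -> I y -> I (x + y) & forall a x, I x -> I (a * x)].

Definition genby (k : nat) (g : nat -> A) (x : A) :=
  exists a : nat -> A, x = \sum_(i < k) a i * g i.

Definition fg_ideals := forall I, is_ideal I ->
  exists k (g : nat -> A), (forall i, (i < k)%N -> I (g i)) /\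
    forall x, I x -> genby k g x.

Lemma is_ideal_sum I k (a g : nat -> A) : is_ideal I ->
  (forall i, (i < k)%N -> I (g i)) -> I (\sum_(i < k) a i * g i).
Proof.
move=> [I0 ID IM] gI; elim/big_ind: _ => //= i _; exact/IM/gI.
Qed.

Lemma genby_ideal k g : is_ideal (genby k g).
Proof.
split.
- by exists (fun=> 0); rewrite big1 // => i _; rewrite mul0r.
- move=> _ _ [a ->] [b ->]; exists (fun i => a i + b i).
  by rewrite -big_split; apply: eq_bigr => i _; rewrite mulrDl.
- move=> c _ [a ->]; exists (fun i => c * a i).
  by rewrite mulr_sumr; apply: eq_bigr => i _; rewrite mulrA.
Qed.

Lemma genby_mem k g i : (i < k)%N -> genby k g (g i).
Proof.
move=> ik; exists (fun j => (j == i)%:R); rewrite (bigD1 (Ordinal ik)) //= eqxx mul1r.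
by rewrite big1 ?addr0 // => j /negPf; rewrite -val_eqE /= => ->; rewrite mul0r.
Qed.

Lemma genby_le k l g x : (k <= l)%N -> genby k g x -> genby l g x.
Proof.
move=> kl [a ->]; apply: is_ideal_sum; first exact: genby_ideal.
by move=> i ik; apply: genby_mem; apply: leq_trans kl.
Qed.

Lemma noetherian_of_fg : fg_ideals -> noetherian A.
Proof.
move=> fgA I; have [|k [g [gI gen]]] := fgA (fun x => x \in I).
  by split=> [|x y xI yI|a x xI]; rewrite ?idealr0 ?rpredD ?idealMr.
exists k, (fun i => g i) => x; split=> [/gen [a ->]|[a ->]].
  by exists (fun i => a i).
by apply: idealr_sum => i; apply: gI.
Qed.

End Ideals.

(** Hilbert's basis theorem by contradiction: each [F k] has least degree in [I] outside the ideal
    of its predecessors. The leading coefficients generate a finitely generated ideal, so some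
    [lc N] is a combination of earlier ones; cancelling it gives an element of lower degree that is
    still outside. *)
Lemma fg_ideals_poly (A : comNzRingType) : fg_ideals A -> fg_ideals {poly A}.
Proof.
move=> fgA I idI; apply: contrapT => nfg.
have [I0 ID IM] := idI.
(* The condition on [s] stands below the existential so that [choice] yields a total function
   [pick]; any value will do elsewhere. *)
have step (s : seq {poly A}) : exists f, (forall i, (i < size s)%N -> I s`_i) ->
    [/\ I f, ~ genby (size s) (nth 0 s) f &
       forall h, I h -> ~ genby (size s) (nth 0 s) h -> (size f <= size h)%N].
  have [sI|sI] := pselect (forall i, (i < size s)%N -> I s`_i); last by exists 0 => /sI.
  have [f0 [f0I f0n]] : exists f, I f /\ ~ genby (size s) (nth 0 s) f.
    apply: contrapT => H; apply: nfg; exists (size s), (nth 0 s); split=> // x xI.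
    by apply: contrapT => xn; apply: H; exists x.
  have ex : exists m, `[< exists2 f, I f /\ ~ genby (size s) (nth 0 s) f & size f = m >].
    by exists (size f0); apply/asboolP; exists f0.
  case: (ex_minnP ex) => m /asboolP[f [fI fn] <-] minf.
  exists f => _; split=> // h hI hn; apply: minf; apply/asboolP; by exists h.
have [pick pickP] := choice step.
pose L := fix L k := if k is k'.+1 then rcons (L k') (pick (L k')) else [::].
pose F k := pick (L k).
have LE k : L k = mkseq F k.
  elim: k => // k IH; have -> : L k.+1 = rcons (L k) (F k) by [].
  by rewrite IH /mkseq -[in RHS]addn1 iotaD map_cat cats1.
have nthL k i : (i < k)%N -> (L k)`_i = F i by move=> ik; rewrite LE nth_mkseq.
have szL k : size (L k) = k by rewrite LE size_mkseq.
have FP k : [/\ I (F k), ~ genby k F (F k) &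
    forall h, I h -> ~ genby k F h -> (size (F k) <= size h)%N].
  have gE h : genby (size (L k)) (nth 0 (L k)) h <-> genby k F h.
    by rewrite szL; split=> -[a ->]; exists a; apply: eq_bigr => i _; rewrite nthL.
  move: k gE; elim/ltn_ind => k IH gE.
  have /pickP : forall i, (i < size (L k))%N -> I (L k)`_i.
    rewrite szL => i ik; rewrite nthL //; have [] // := IH i ik.
    by move=> h; rewrite szL; split=> -[a ->]; exists a; apply: eq_bigr => j _; rewrite nthL.
  rewrite -/(F k) => -[H1 H2 H3]; split=> //; first by move/gE.
  by move=> h hI hn; apply: H3 => // /gE.
pose lc i := lead_coef (F i).
have [|k [g [gJ gen]]] := fgA (fun x => exists N, genby N lc x).
  split; first by exists 0, (fun=> 0); rewrite big_ord0.
    move=> x y [N xN] [M yM]; exists (maxn N M).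
    have [_ D _] := genby_ideal (maxn N M) lc.
    by apply: D; [apply: genby_le xN|apply: genby_le yM]; rewrite ?leq_maxl ?leq_maxr.
  move=> a x [N xN]; exists N; have [_ _ M] := genby_ideal N lc; exact: M.
have {}gJ i : exists N, (i < k)%N -> genby N lc (g i).
  by have [/gJ [N HN]|_] := boolP (i < k)%N; [exists N|exists 0].
have [Nf HN] := choice gJ.
pose N := \max_(i < k) Nf i.
have [a aE] : genby N lc (lc N).
  have [b ->] : genby k g (lc N).
    by apply: gen; exists N.+1; apply: genby_mem.
  apply: is_ideal_sum; first exact: genby_ideal.
  move=> i ik; apply: genby_le (HN i ik).
  exact: (@leq_bigmax _ (fun i : 'I_k => Nf i) (Ordinal ik)).
have [FNI FNn FNmin] := FP N.
pose h := F N - \sum_(i < N) (a i)%:P * 'X^(size (F N) - size (F i)) * F i.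
have sumg : genby N F (\sum_(i < N) (a i)%:P * 'X^(size (F N) - size (F i)) * F i).
  by exists (fun i => (a i)%:P * 'X^(size (F N) - size (F i))).
have hn : ~ genby N F h.
  move=> hg; apply: FNn; have [_ D _] := genby_ideal N F.
  by rewrite -[F N](subrK (\sum_(i < N) (a i)%:P * 'X^(size (F N) - size (F i)) * F i)); apply: D hg sumg.
have hI : I h.
  apply: ID => //; rewrite -mulN1r; apply: IM; case: sumg => b ->.
  by apply: (@is_ideal_sum _ I) => // i _; have [] := FP i.
have FN0 : F N != 0.
  by apply/eqP => E; apply: FNn; rewrite E; have [] := genby_ideal N F.
have := FNmin h hI hn; rewrite leqNgt => /negP; apply.
have szF i : (i < N)%N -> (size (F i) <= size (F N))%N.
  move=> iN; have [_ _] := FP i; apply=> // H; apply: FNn.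
  by apply: genby_le H; apply: ltnW.
have szN : (0 < size (F N))%N by rewrite size_poly_gt0.
rewrite -(prednK szN) ltnS; apply/leq_sizeP => j Hj.
rewrite /h coefB coef_sum.
have [->|ne] := eqVneq j (size (F N)).-1.
  rewrite -/(lead_coef (F N)) -/(lc N) aE; apply/eqP; rewrite subr_eq0; apply/eqP.
  apply: eq_bigr => i _; rewrite -mulrA coefCM coefXnM /lc /lead_coef.
  have := szF i (ltn_ord i); case: (posnP (size (F i))) => [|Hi Hle].
    move/eqP; rewrite size_poly_eq0 => /eqP ->; rewrite size_poly0 !coef0.
    by case: ifP.
  rewrite ifN; last by rewrite -leqNgt; lia.
  by congr (_ * _`_ _); lia.
have {ne}Hj : (size (F N) <= j)%N by rewrite -(prednK szN) ltn_neqAle eq_sym ne.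
rewrite nth_default // big1 ?subr0 // => i _.
rewrite -mulrA coefCM coefXnM; case: ifP => _; first by rewrite mulr0.
by rewrite nth_default ?mulr0 //; have := szF i (ltn_ord i); move: Hj; move: (size _) (size _) => u v; lia.
Qed.

Lemma fg_ideals_surj (A B : comNzRingType) (h : {rmorphism A -> B}) :
  (forall b, exists a, b = h a) -> fg_ideals A -> fg_ideals B.
Proof.
move=> surj fgA I [I0 ID IM].
have [|k [g [gI gen]]] := fgA (fun a => I (h a)).
  split=> [|x y Hx Hy|a x Hx]; rewrite ?rmorph0 ?rmorphD ?rmorphM //; [exact: ID|exact: IM].
exists k, (h \o g); split=> // b; have [a ->] := surj b => /gen [c ->].
exists (h \o c); rewrite rmorph_sum; apply: eq_bigr => i _; exact: rmorphM.
Qed.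

Lemma fg_ideals_field (F : fieldType) : fg_ideals F.
Proof.
move=> I [I0 ID IM]; have [[x [xI x0]]|H] := pselect (exists x, I x /\ x != 0).
  exists 1, (fun=> x); split=> // y _; exists (fun=> y / x).
  by rewrite big_ord1 divfK.
exists 0, (fun=> 0); split=> // x xI; exists (fun=> 0); rewrite big_ord0.
by apply/eqP; apply/negPn/negP => x0; apply: H; exists x.
Qed.

(** The ring in [n.+1] variables is the image of the univariate polynomials over the ring in [n]
    variables, evaluated at the last variable; surjectivity of this map suffices. *)
Lemma fg_ideals_mpoly (F : fieldType) n : fg_ideals {mpoly F[n]}.
Proof.
elim: n => [|n IH].
  apply: (@fg_ideals_surj _ _ (@mpolyC 0 F)); last exact: fg_ideals_field.
  move=> p; exists p@_0; apply/mpolyP => m; rewrite mcoeffC.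
  have -> : m = 0%MM by apply/mnmP => -[].
  by rewrite eqxx mulr1.
pose h := horner_eval ('X_ord_max : {mpoly F[n.+1]}) \o map_poly (@mwiden n F).
apply: (@fg_ideals_surj _ _ h); last exact: fg_ideals_poly.
have hE q : h q = (map_poly (@mwiden n F) q).['X_ord_max] by [].
move=> p; elim/mpolyind: p => [|c m p _ _ [q ->]].
  by exists 0; rewrite rmorph0.
suff [r Hr] : exists r, 'X_[m] = h r.
  by exists ((c%:MP)%:P * r + q); rewrite [RHS]hE rmorphD rmorphM hornerD hornerM -!hE -Hr hE map_polyC hornerC /= mwidenC mul_mpolyC.
rewrite mpolyXE_id; elim/big_rec: _ => [|i x _ [r ->]].
  by exists 1; rewrite hE rmorph1 hornerC.
suff [s Hs] : exists s, 'X_i = h s by exists (s ^+ m i * r); rewrite [RHS]hE rmorphM rmorphXn hornerM horner_exp -!hE -Hs.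
have [j ->|->] := unliftP ord_max i.
  exists ('X_j)%:P; rewrite hE map_polyC hornerC /= mwidenX mnmwiden1.
  congr 'X_[U_(_)]; apply: val_inj; rewrite /= /bump leqNgt.
  by have := ltn_ord j; case: ltnP => //; rewrite add0n.
by exists 'X; rewrite hE map_polyX hornerX.
Qed.

(** * Localization at a prime *)

Section SquareOfIdeal.

Variables (A : comNzRingType) (I : idealr A).

Lemma sq_idealP x : (x \in sq_ideal I) <-> exists k (u v : 'I_k -> A),
  (forall i, u i \in I /\ v i \in I) /\ x = \sum_i u i * v i.
Proof. by split=> [/asboolP|H]; last exact/asboolP. Qed.

Lemma sq_ideal_mul u v : u \in I -> v \in I -> u * v \in sq_ideal I.
Proof.
by move=> uI vI; apply/sq_idealP; exists 1, (fun=> u), (fun=> v); rewrite big_ord1.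
Qed.

Lemma sq_ideal_is_ideal : is_ideal (fun x => x \in sq_ideal I).
Proof.
split.
- by apply/sq_idealP; exists 0, (fun=> 0), (fun=> 0); rewrite big_ord0; split=> // -[].
- move=> x y /sq_idealP [k [u [v [uvI ->]]]] /sq_idealP [l [u' [v' [uvI' ->]]]].
  apply/sq_idealP; exists (k + l)%N,
    (fun i => match split i with inl j => u j | inr j => u' j end),
    (fun i => match split i with inl j => v j | inr j => v' j end); split.
    by move=> i; case: split.
  rewrite big_split_ord /=; congr (_ + _); apply: eq_bigr => i _.
    by rewrite (unsplitK (inl i)).
  by rewrite (unsplitK (inr i)).
- move=> a x /sq_idealP [k [u [v [uvI ->]]]]; apply/sq_idealP.
  exists k, (fun i => a * u i), v; split=> [i|].
    by have [uI vI] := uvI i; rewrite idealMr.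
  by rewrite mulr_sumr; apply: eq_bigr => i _; rewrite mulrA.
Qed.

Lemma sq_idealMl a x : x \in sq_ideal I -> a * x \in sq_ideal I.
Proof. by have [_ _ M] := sq_ideal_is_ideal; apply: M. Qed.

End SquareOfIdeal.

Definition strict_chain (A : comNzRingType) d (Q : 'I_d.+1 -> prime_idealr A) :=
  forall i j : 'I_d.+1, (i < j)%N -> {subset Q i <= Q j} /\ ~ {subset Q j <= Q i}.

Definition chain_below (A : comNzRingType) (P : prime_idealr A) (d : nat) :=
  exists Q : 'I_d.+1 -> prime_idealr A,
    (forall i, {subset Q i <= P}) /\ strict_chain Q.

Section Localization.

Variables (A : comNzRingType) (P : prime_idealr A).

Local Notation L := (localization P).

Definition frac (a : A) (s : denom P) : L := \pi_(localization P)%qT (a, s).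

Lemma fracP (z : L) : exists a s, z = frac a s.
Proof. by elim/quotW: z => -[a s]; exists a, s. Qed.

Lemma frac_eqP a s b t : frac a s = frac b t <->
  exists u : denom P, val u * (a * val t - b * val s) = 0.
Proof. by split=> [/eqmodP/asboolP //|H]; apply/eqmodP/asboolP. Qed.

Lemma frac_cross a s b t : a * val t = b * val s -> frac a s = frac b t.
Proof. by move=> E; apply: frac_eq; rewrite /= E subrr. Qed.

Lemma fracD a s b t : frac a s + frac b t = frac (a * val t + b * val s) (denomM s t).
Proof. by rewrite /frac [RHS](pi_loc_add (a, s) (b, t)). Qed.

Lemma fracM a s b t : frac a s * frac b t = frac (a * b) (denomM s t).
Proof. by rewrite /frac [RHS](pi_loc_mul (a, s) (b, t)). Qed.

Lemma frac1 : 1 = frac 1 (denom1 P). Proof. by []. Qed.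
Lemma frac0 s : frac 0 s = 0.
Proof. by rewrite [RHS](_ : _ = frac 0 (denom1 P)) //; apply: frac_cross; rewrite !mul0r. Qed.

Lemma fracDs a b s : frac (a + b) s = frac a s + frac b s.
Proof. by rewrite fracD; apply: frac_cross => /=; ring. Qed.

Lemma frac_sum k (a : 'I_k -> A) s : frac (\sum_i a i) s = \sum_i frac (a i) s.
Proof. by apply: (big_morph (frac^~ s) (fun a b => fracDs a b s) (frac0 s)). Qed.

Lemma frac_sub a b s : frac (a - b) s = frac a s - frac b s.
Proof. by apply/eqP; rewrite eq_sym subr_eq -fracDs subrK. Qed.

Definition loc_map (a : A) : L := frac a (denom1 P).

Lemma loc_map_zmod_morphism : zmod_morphism loc_map.
Proof. by move=> x y; rewrite /loc_map frac_sub. Qed.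
Lemma loc_map_monoid_morphism : monoid_morphism loc_map.
Proof. by split=> // x y; rewrite /loc_map fracM; apply: frac_cross => /=; ring. Qed.
HB.instance Definition _ := GRing.isZmodMorphism.Build A L loc_map loc_map_zmod_morphism.
HB.instance Definition _ := GRing.isMonoidMorphism.Build A L loc_map loc_map_monoid_morphism.

Lemma frac_mulK a s : frac a s * loc_map (val s) = loc_map a.
Proof. by rewrite /loc_map fracM; apply: frac_cross => /=; ring. Qed.

Lemma frac_inv s : frac 1 s * loc_map (val s) = 1.
Proof. by rewrite frac_mulK /loc_map frac1. Qed.

Lemma common_denom k (z : 'I_k -> L) :
  exists s (a : 'I_k -> A), forall i, z i = frac (a i) s.
Proof.
have H i : exists y : A * denom P, z i = frac y.1 y.2.
  by have [a [s E]] := fracP (z i); exists (a, s).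
have [y yE] := choice H.
have sP : \prod_i val (y i).2 \notin P.
  by apply: prime_prod => i; apply: (valP (y i).2).
exists (Sub (\prod_i val (y i).2) sP : denom P).
exists (fun i => (y i).1 * \prod_(j | j != i) val (y j).2) => i.
rewrite yE; apply: frac_cross; rewrite /= (bigD1 i) //=; ring.
Qed.

Lemma loc_max_ex : exists m : idealr L, forall a s, (frac a s \in m) <-> (a \in P).
Proof.
pose I z := exists2 a, a \in P & exists s, z = frac a s.
have fracI a s : I (frac a s) -> a \in P.
  move=> [b bP [t /frac_eqP [u]]]; rewrite mulrBr => /eqP; rewrite subr_eq0 => /eqP E.
  have : val u * (a * val t) \in P by rewrite E mulrA mulrAC idealMr.
  rewrite !prime_idealrM (negPf (valP u)) (negPf (valP t)) /= orbF //.
have [||||m mE] := @idealr_of L I.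
- by exists 0; rewrite ?idealr0 //; exists (denom1 P).
- move=> _ _ [a aP [s ->]] [b bP [t ->]]; exists (a * val t + b * val s).
    by rewrite rpredD // mulrC idealMr.
  by exists (denomM s t); rewrite fracD.
- move=> z _ [a aP [s ->]]; have [b [t ->]] := fracP z.
  by exists (b * a); [rewrite idealMr|exists (denomM t s); rewrite fracM].
- by rewrite frac1 => /fracI; rewrite idealr1.
exists m => a s; split=> [/mE/fracI //|aP]; apply/mE; by exists a => //; exists s.
Qed.

Lemma prime_up (Q : prime_idealr A) : {subset Q <= P} ->
  exists Q' : prime_idealr L, forall a s, (frac a s \in Q') <-> (a \in Q).
Proof.
move=> QP; pose I z := exists2 a, a \in Q & exists s, z = frac a s.
have NQ (s : denom P) : (val s \in Q) = false by apply/negP => /QP; apply/negP/(valP s).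
have fracI a s : I (frac a s) -> a \in Q.
  move=> [b bQ [t /frac_eqP [u]]]; rewrite mulrBr => /eqP; rewrite subr_eq0 => /eqP E.
  have : val u * (a * val t) \in Q by rewrite E mulrA mulrAC idealMr.
  by rewrite !prime_idealrM !NQ /= orbF.
have [|||||Q' QE] := @prime_idealr_of L I.
- by exists 0; rewrite ?idealr0 //; exists (denom1 P); rewrite frac0.
- move=> _ _ [a aP [s ->]] [b bP [t ->]]; exists (a * val t + b * val s).
    by rewrite rpredD // mulrC idealMr.
  by exists (denomM s t); rewrite fracD.
- move=> z _ [a aP [s ->]]; have [b [t ->]] := fracP z.
  by exists (b * a); [rewrite idealMr|exists (denomM t s); rewrite fracM].
- by rewrite frac1 => /fracI; rewrite idealr1.
- move=> x y; have [a [s ->]] := fracP x; have [b [t ->]] := fracP y.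
  rewrite fracM => /fracI; rewrite prime_idealrM => /orP [H|H]; [left|right].
    by exists a => //; exists s.
  by exists b => //; exists t.
exists Q' => a s; split=> [/QE/fracI //|aP]; apply/QE; by exists a => //; exists s.
Qed.

Lemma prime_down (Q' : prime_idealr L) : exists Q : prime_idealr A,
  {subset Q <= P} /\ forall a s, (frac a s \in Q') <-> (a \in Q).
Proof.
have NQ (s : denom P) : (loc_map (val s) \in Q') = false.
  apply/negP => H; have := idealMr (frac 1 s) H; rewrite frac_inv; by rewrite idealr1.
have [|||||Q QE] := @prime_idealr_of A (fun a => loc_map a \in Q').
- by rewrite rmorph0 idealr0.
- by move=> x y Hx Hy; rewrite rmorphD rpredD.
- by move=> a x Hx; rewrite rmorphM idealMr.
- by rewrite rmorph1 idealr1.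
- by move=> x y; rewrite rmorphM prime_idealrM => /orP.
exists Q; split=> [a /QE aQ|a s].
  apply: contraT => aP; pose s : denom P := Sub a aP.
  by have := NQ s; rewrite aQ.
split=> [H|/QE H].
  by apply/QE; rewrite -(frac_mulK a s) mulrC idealMr.
by move: H; rewrite -(frac_mulK a s) prime_idealrM NQ orbF.
Qed.

Lemma chain_down d : prime_chain L d <-> chain_below P d.
Proof.
split=> [[Q Qlt]|[Q [QP Qlt]]].
  have [R HR] := choice (fun i => prime_down (Q i)).
  exists R; split=> [i|i j ij]; first by have [] := HR i.
  have [_ Ri] := HR i; have [_ Rj] := HR j; have [H1 H2] := Qlt i j ij; split.
    by move=> a /(Ri a (denom1 P))/H1/(Rj _ _).
  by move=> H; apply: H2 => z; have [a [s ->]] := fracP z => /Rj/H/Ri.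
have [R HR] := choice (fun i => prime_up (QP i)).
exists R => i j ij; have [H1 H2] := Qlt i j ij; split.
  by move=> z; have [a [s ->]] := fracP z => /HR/H1/HR.
by move=> H; apply: H2 => a; move/(HR j a (denom1 P)) => /H/HR.
Qed.

(** Clearing denominators leaves a factor [u] outside [P]: the numerators form the symbolic square
    of [P], not its ordinary square. *)
Lemma frac_sq (m : idealr L) : (forall a s, (frac a s \in m) <-> (a \in P)) ->
  forall a s, (frac a s \in sq_ideal m) <->
    exists2 u, u \notin P & u * a \in sq_ideal P.
Proof.
move=> mE a s; split=> [/sq_idealP [k [u [v [uvm]]]]|].
  have [t [x xE]] := common_denom u; have [t' [y yE]] := common_denom v.
  under eq_bigr => i _ do rewrite xE yE fracM.
  rewrite -frac_sum => /frac_eqP [w] /=; rewrite mulrBr => /eqP.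
  rewrite subr_eq0 => /eqP E.
  exists (val w * (val t * val t')); first exact: (valP (denomM w (denomM t t'))).
  rewrite -mulrA [_ * a]mulrC E mulrA mulrAC; apply: sq_idealMl.
  apply/sq_idealP; exists k, x, y; split=> // i.
  by have [] := uvm i; rewrite xE yE => /mE ? /mE.
move=> [u uP /sq_idealP [k [x [y [xyP E]]]]]; apply/sq_idealP.
pose u' : denom P := Sub u uP.
exists k, (fun i => frac (x i) (denomM u' s)), (fun i => loc_map (y i)); split.
  by move=> i; have [xP yP] := xyP i; split; apply/mE.
rewrite -[LHS](_ : frac (u * a) (denomM u' s) = _); last by apply: frac_cross => /=; ring.
rewrite E frac_sum; apply: eq_bigr => i _.
by rewrite /loc_map fracM; apply: frac_cross => /=; ring.
Qed.

(** Multipliers [s] occur only in the spanning condition: in the independence condition the factor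
    [u] coming from [frac_sq] is absorbed into the coefficients and removed again by primality. *)
Lemma regular_at_intro d (b : 'I_d -> A) :
  fg_ideals A -> chain_below P d -> (forall e, chain_below P e -> (e <= d)%N) ->
  (forall i, b i \in P) ->
  (forall g, g \in P -> exists2 s, s \notin P &
     exists a : 'I_d -> A, s * g - \sum_i a i * b i \in sq_ideal P) ->
  (forall a : 'I_d -> A, \sum_i a i * b i \in sq_ideal P -> forall i, a i \in P) ->
  regular_at P.
Proof.
move=> fgA ch bound bP span indep; split.
  apply: noetherian_of_fg => I [I0 ID IM].
  have [|k [g [gI gen]]] := fgA (fun a => I (loc_map a)).
    split=> [|x y Hx Hy|a x Hx]; rewrite ?rmorph0 ?rmorphD ?rmorphM //; [exact: ID|exact: IM].
  exists k, (fun i => loc_map (g i)); split=> // z; have [a [s ->]] := fracP z => aI.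
  have [|c cE] := gen a; first by rewrite -(frac_mulK a s) mulrC; apply: IM.
  exists (fun i => frac (c i) s); rewrite cE frac_sum; apply: eq_bigr => i _.
  by rewrite /loc_map fracM; apply: frac_cross => /=; ring.
have [m mE] := loc_max_ex; exists m, d; split.
- move=> I z zI; have [a [s E]] := fracP z; rewrite E in zI *; apply/mE.
  apply: contraT => aP; pose t : denom P := Sub a aP.
  have := idealMr (frac (val s) t) zI; rewrite fracM.
  rewrite (_ : frac _ _ = 1) ?idealr1 // frac1; apply: frac_cross => /=; ring.
- by split=> [|e]; [apply/chain_down|move=> /chain_down/bound].
- exists (fun i => loc_map (b i)); split=> [i||c].
  + by apply/mE.
  + move=> z; have [g [s ->]] := fracP z => /mE/span [t tP [a aE]].
    pose t' : denom P := Sub t tP.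
    exists (fun i => frac (a i) (denomM t' s)).
    rewrite (_ : \sum_i _ = frac (\sum_i a i * b i) (denomM t' s)); last first.
      rewrite frac_sum; apply: eq_bigr => i _; rewrite [LHS]fracM.
      by apply: frac_cross => /=; ring.
    rewrite (_ : frac g s = frac (t * g) (denomM t' s)); last by apply: frac_cross => /=; ring.
    rewrite -frac_sub; apply/(frac_sq mE); exists 1; rewrite ?idealr1 //.
    by rewrite mul1r.
  + have [s [a aE]] := common_denom c.
    rewrite (_ : \sum_i _ = frac (\sum_i a i * b i) s); last first.
      rewrite frac_sum; apply: eq_bigr => i _; rewrite [LHS]mulrC aE /loc_map fracM.
      by apply: frac_cross => /=; ring.
    move=> /(frac_sq mE) [u uP]; rewrite mulr_sumr => H i.
    rewrite aE; apply/mE.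
    have /(_ i) : forall i, u * a i \in P.
      apply: (indep (fun i => u * a i)); by under eq_bigr => j _ do rewrite -mulrA.
    by rewrite prime_idealrM (negPf uP).
Qed.

(** Only the spanning half of the basis is kept: with a chain of the same length [d] it bounds the
    cotangent space from above, which is all that a proof of non-regularity needs. *)
Lemma regular_at_elim : regular_at P -> exists d (b : 'I_d -> A),
  [/\ chain_below P d, forall i, b i \in P &
     forall g, g \in P -> exists2 s, s \notin P &
       exists a : 'I_d -> A, s * g - \sum_i a i * b i \in sq_ideal P].
Proof.
move=> [_ [m [d [mmax [ch _] [b [bm span _]]]]]].
have [m' mE'] := loc_max_ex.
have mE a s : (frac a s \in m) <-> (a \in P).
  split=> [aM|/(mE' a s) aM]; last exact: (mmax m' _ aM).
  apply: contraT => aP; pose t : denom P := Sub a aP.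
  have := idealMr (frac (val s) t) aM; rewrite fracM.
  rewrite (_ : frac _ _ = 1) ?idealr1 // frac1; apply: frac_cross => /=; ring.
have [s [b' bE]] := common_denom b.
exists d, b'; split=> [|i|g gP]; first exact/chain_down.
  by have := bm i; rewrite bE => /mE.
have [|c] := span (loc_map g); first exact/mE.
have [t [a aE]] := common_denom c.
rewrite (_ : \sum_i _ = frac (\sum_i a i * b' i) (denomM t s)); last first.
  by rewrite frac_sum; apply: eq_bigr => i _; rewrite bE aE [LHS]fracM.
rewrite (_ : loc_map g = frac (val t * val s * g) (denomM t s)); last first.
  by apply: frac_cross => /=; ring.
rewrite -frac_sub => /(frac_sq mE) [u uP H].
exists (u * (val t * val s)); first exact: (valP (denomM (Sub u uP) (denomM t s))).
exists (fun i => u * a i); move: H; rewrite mulrBr mulrA mulr_sumr.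
by under [in X in X -> _]eq_bigr => i _ do rewrite mulrA.
Qed.

End Localization.

(** * Algebraic dependence and lengths of chains of primes *)

(** Unknowns and equations are indexed by arbitrary finite types because they are later numbered by
    exponent functions and by an option type. *)
Lemma wide_matrix_kernel (F : fieldType) (I J : finType) (M : I -> J -> F) :
  (#|J| < #|I|)%N ->
  exists v : I -> F, (exists i, v i != 0) /\ forall j, \sum_i v i * M i j = 0.
Proof.
move=> JI; pose B : 'M[F]_(#|I|, #|J|) := \matrix_(a, b) M (enum_val a) (enum_val b).
have : kermx B != 0.
  rewrite kermx_eq0 -row_leq_rank -ltnNge; apply: leq_ltn_trans JI.
  exact: rank_leq_col.
set r := nz_row (kermx B) => k0.
have r0 : r != 0 by rewrite nz_row_eq0.
have rB : r *m B = 0 by apply/sub_kermxP/nz_row_sub.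
exists (fun i => r 0 (enum_rank i)); split.
  have /rV0Pn [i ri] := r0; exists (enum_val i); by rewrite enum_valK.
move=> j; have /rowP /(_ (enum_rank j)) := rB; rewrite !mxE; apply: etrans.
rewrite [LHS](reindex (@enum_val I predT)); last by apply: onW_bij; apply: enum_val_bij.
by apply: eq_bigr => a _; rewrite enum_valK mxE enum_rankK.
Qed.

Section AlgebraicDependence.

Variable F : fieldType.

Lemma mpoly_split_last m (q : {mpoly F[m.+1]}) :
  exists (q0 : {mpoly F[m]}) r, q = mwiden q0 + 'X_ord_max * r.
Proof.
elim/mpolyind: q => [|c k q _ _ [q0 [r ->]]].
  by exists 0, 0; rewrite mwiden0 mulr0 addr0.
suff [q1 [r1 ->]] : exists (q1 : {mpoly F[m]}) r1, 'X_[k] = mwiden q1 + 'X_ord_max * r1.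
  exists (c *: q1 + q0), (c *: r1 + r).
  by rewrite mwidenD mwidenZ scalerDr mulrDr scalerAr addrACA.
case: (posnP (k ord_max)) => [k0|k0].
  exists 'X_[[multinom k (widen_ord (leqnSn m) i) | i < m]], 0.
  rewrite mulr0 addr0 mwidenX; congr 'X_[_]; apply/mnmP => i.
  have [j ->|->] := unliftP ord_max i; last by rewrite mnmwiden_ordmax.
  have -> : lift ord_max j = widen_ord (leqnSn m) j.
    by apply: val_inj; rewrite /= /bump leqNgt ltn_ord.
  by rewrite mnmwiden_widen mnmE.
exists 0, 'X_[k - U_(ord_max)]; rewrite mwiden0 add0r -mpolyXD addmC submK //.
apply/mnm_lepP => i; rewrite mnm1E; case: eqP => [<-|] //.
Qed.

Lemma mpoly_lowest_last m (q : {mpoly F[m.+1]}) : q != 0 ->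
  exists a (q0 : {mpoly F[m]}) r, q0 != 0 /\
    q = 'X_ord_max ^+ a * (mwiden q0 + 'X_ord_max * r).
Proof.
have [k] := ubnP (msize q); elim: k q => // k IH q szq qn0.
have [q0 [r qE]] := mpoly_split_last q.
have [q00|q00] := eqVneq q0 0; last by exists 0%N, q0, r; rewrite expr0 mul1r.
rewrite q00 mwiden0 add0r in qE; have rn0 : r != 0.
  by apply: contraNneq qn0 => r0; rewrite qE r0 mulr0.
have [] := IH r _ rn0.
  move: szq; rewrite qE msizeM //; first by rewrite msizeX mdeg1.
  by rewrite -msize_poly_eq0 msizeX.
move=> a [q1 [r1 [q1n0 rE]]]; exists a.+1, q1, r1; split=> //.
by rewrite qE {1}rE exprS mulrA.
Qed.

Lemma rmorph_mmap m (A B : comNzRingType) (f : {rmorphism F -> A}) (h : {rmorphism A -> B})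
    (x : 'I_m -> A) (q : {mpoly F[m]}) :
  h (mmap f x q) = mmap (h \o f) (h \o x) q.
Proof.
rewrite /mmap rmorph_sum; apply: eq_bigr => k _; rewrite rmorphM; congr (_ * _).
by rewrite /mmap1 rmorph_prod; apply: eq_bigr => i _; rewrite rmorphXn.
Qed.

Definition snoc (A : Type) m (x : 'I_m -> A) (y : A) (i : 'I_m.+1) : A :=
  if unlift ord_max i is Some j then x j else y.

Lemma snoc_max (A : Type) m (x : 'I_m -> A) y : snoc x y ord_max = y.
Proof. by rewrite /snoc unlift_none. Qed.

Lemma snoc_widen (A : Type) m (x : 'I_m -> A) y i :
  snoc x y (widen_ord (leqnSn m) i) = x i.
Proof.
have -> : widen_ord (leqnSn m) i = lift ord_max i.
  by apply: val_inj; rewrite /= /bump leqNgt ltn_ord.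
by rewrite /snoc liftK.
Qed.

Lemma mmap_mwiden m (A : comNzRingType) (f : {rmorphism F -> A}) (x : 'I_m -> A) y q :
  mmap f (snoc x y) (mwiden q) = mmap f x q.
Proof.
elim/mpolyind: q => [|c k q _ _ IH]; first by rewrite mwiden0 !rmorph0.
rewrite mwidenD mwidenZ !mmapD !mmapZ IH mwidenX !mmapX; congr (_ * _ + _).
rewrite /mmap1 big_ord_recr /= mnmwiden_ordmax expr0 mulr1.
by apply: eq_bigr => i _; rewrite mnmwiden_widen snoc_widen.
Qed.

Definition alg_indep (A : comNzRingType) (f : {rmorphism F -> A}) (I : {pred A}) m
    (x : 'I_m -> A) :=
  forall q : {mpoly F[m]}, mmap f x q \in I -> q = 0.

(* Dividing a relation by the highest power of the last variable and then      *)
(* setting that variable to zero yields a relation between the others.          *)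
Lemma alg_indep_snoc (A : comNzRingType) (f : {rmorphism F -> A})
    (P : prime_idealr A) (Q : idealr A) m (x : 'I_m -> A) y :
  {subset P <= Q} -> y \in Q -> y \notin P ->
  alg_indep f Q x -> alg_indep f P (snoc x y).
Proof.
move=> PQ yQ yP indx q qP; apply/eqP; apply: contraT => /mpoly_lowest_last.
move=> [a [q0 [r [q0n0 qE]]]]; move: qP.
have X_max : mmap f (snoc x y) 'X_ord_max = y by rewrite mmapX mmap1U snoc_max.
rewrite qE rmorphM rmorphXn /= X_max prime_idealrM.
rewrite (negPf (prime_exp a yP)) /= => /PQ.
rewrite rmorphD rmorphM /= mmap_mwiden X_max => H.
have /indx : mmap f x q0 \in Q.
  by rewrite -[mmap f x q0](addrK (y * mmap f (snoc x y) r)) rpredB // mulrC idealMr.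
by move=> q00; rewrite q00 eqxx in q0n0.
Qed.

Lemma mcoeff_prod_exp n m (g : 'I_m -> {mpoly F[n]}) (a : 'I_m -> nat) D N k :
  (forall i, msize (g i) <= D)%N -> (forall i, a i <= N)%N ->
  (m * N * D < mdeg k)%N -> (\prod_i g i ^+ a i)@_k = 0.
Proof.
move=> gD aN; apply: contraTeq; rewrite -mcoeff_msupp -leqNgt => /msize_mdeg_lt.
have H u v (p q : {mpoly F[n]}) : (msize p <= u.+1)%N -> (msize q <= v.+1)%N ->
    (msize (p * q) <= (u + v).+1)%N.
  have [->|p0] := eqVneq p 0; first by rewrite mul0r msize0.
  have [->|q0] := eqVneq q 0; first by rewrite mulr0 msize0.
  by rewrite msizeM //; move: (msize p) (msize q) => s t; lia.
have He i : (msize (g i ^+ a i) <= (N * D).+1)%N.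
  suff : (msize (g i ^+ a i) <= (a i * D).+1)%N.
    by move/leq_trans; apply; rewrite ltnS leq_mul2r aN orbT.
  elim: (a i) => [|j IH]; first by rewrite expr0 msize1.
  by rewrite exprS mulSn; apply: H => //; apply: leqW.
have HP (r : seq 'I_m) : (msize (\prod_(i <- r) g i ^+ a i) <= (size r * (N * D)).+1)%N.
  elim: r => [|i r IH]; first by rewrite big_nil msize1.
  by rewrite big_cons mulSn; apply: H.
have := HP (enum 'I_m); rewrite big_enum /= size_enum_ord mulnA => Hs Hk.
by rewrite -ltnS; apply: leq_trans Hk Hs.
Qed.

(** Linear algebra by counting. The (N+1)^(n+1) monomials in the [g i] with exponents at most N have
    degree at most K = (n+1) N D, hence at most (K+1)^n coefficients. As K + 1 <= C (N+1), the
    choice N = C^n makes the unknowns outnumber the equations. *)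
Lemma mpoly_alg_dep n (g : 'I_n.+1 -> {mpoly F[n]}) :
  exists2 q : {mpoly F[n.+1]}, q != 0 & mmap (@mpolyC n F) g q = 0.
Proof.
pose D := \max_i msize (g i).
have gD i : (msize (g i) <= D)%N by apply: (@leq_bigmax _ (fun i => msize (g i))).
pose C := (n.+1 * D).+1; pose N := (C ^ n)%N; pose K := (n.+1 * N * D)%N.
pose ex (a : {ffun 'I_n.+1 -> 'I_N.+1}) : 'X_{1..n.+1} := [multinom (a i : nat) | i < n.+1].
pose ey (b : {ffun 'I_n -> 'I_K.+1}) : 'X_{1..n} := [multinom (b i : nat) | i < n].
have [|v [[a0 va0] vM]] := @wide_matrix_kernel F {ffun 'I_n.+1 -> 'I_N.+1} {ffun 'I_n -> 'I_K.+1}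
    (fun a b => (\prod_i g i ^+ a i)@_(ey b)).
  rewrite !card_ffun !card_ord.
  have KC : (K.+1 <= C * N.+1)%N by rewrite /K /C; nia.
  apply: (@leq_ltn_trans ((C * N.+1) ^ n)%N).
    by case: (n) => // n'; rewrite leq_exp2r.
  by rewrite expnMn -/N expnS ltn_pmul2r ?expn_gt0.
exists (\sum_a v a *: 'X_[ex a]).
  apply/eqP => /mpolyP /(_ (ex a0)); rewrite mcoeff0 raddf_sum /= (bigD1 a0) //=.
  rewrite mcoeffZ mcoeffX eqxx mulr1 big1 ?addr0 => [/eqP|a ne]; first by rewrite (negPf va0).
  rewrite mcoeffZ mcoeffX; case: eqP => [/mnmP E|]; last by rewrite mulr0.
  case/eqP: ne; apply/ffunP => i; apply: val_inj.
  by have := E i; rewrite !mnmE.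
apply/mpolyP => k; rewrite mcoeff0 rmorph_sum raddf_sum /=.
have E a : mmap (@mpolyC n F) g (v a *: 'X_[ex a]) = v a *: \prod_i g i ^+ a i.
  rewrite mmapZ mmapX mul_mpolyC; congr (_ *: _); apply: eq_bigr => i _.
  by rewrite mnmE.
under eq_bigr => a _ do rewrite E mcoeffZ.
have [Hk|Hk] := leqP (mdeg k) K; last first.
  rewrite big1 // => a _; rewrite (@mcoeff_prod_exp _ _ _ _ D N) ?mulr0 // => i.
  by rewrite -ltnS.
have kK i : (k i < K.+1)%N.
  by rewrite ltnS; apply: leq_trans Hk; rewrite mdegE (bigD1 i) //= leq_addr.
rewrite -[RHS](vM [ffun i => Ordinal (kK i)]); apply: eq_bigr => a _.
by congr (_ * _@__); apply/mnmP => i; rewrite !mnmE ffunE.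
Qed.

(** At each step down, an element of the larger prime outside the smaller one extends the
    independent family. *)
Lemma chain_alg_indep (A : comNzRingType) (f : {rmorphism F -> A}) d
    (Q : 'I_d.+1 -> prime_idealr A) m (x : 'I_m -> A) :
  strict_chain Q -> alg_indep f (Q ord_max) x ->
  exists y : 'I_(d + m) -> A, alg_indep f (Q ord0) y.
Proof.
elim: d Q m x => [|d IH] Q m x Qlt indx.
  by exists x; rewrite (_ : ord0 = ord_max) //; apply: val_inj.
pose w := widen_ord (leqnSn d.+1).
have [H1 H2] : {subset Q (w ord_max) <= Q ord_max} /\ ~ {subset Q ord_max <= Q (w ord_max)}.
  exact: Qlt.
have [y [yQ yQ']] : exists y, y \in Q ord_max /\ y \notin Q (w ord_max).
  apply: contrapT => H; apply: H2 => y yQ; apply: contraT => yn; case: H; by exists y.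
have [|z indz] := IH (Q \o w) _ _ _ (alg_indep_snoc H1 yQ yQ' indx).
  by move=> i j ij; apply: Qlt.
rewrite addSnnS; exists z; move: indz; rewrite /= (_ : w ord0 = ord0) //.
exact: val_inj.
Qed.

Lemma alg_indep_le (A : comNzRingType) (f : {rmorphism F -> A}) (I : {pred A}) k m
    (x : 'I_m -> A) : (k <= m)%N -> alg_indep f I x ->
  exists y : 'I_k -> A, alg_indep f I y.
Proof.
move=> /subnK mE; move: x; rewrite -mE; elim: (m - k)%N => [|l IH] /= x indx; first by exists x.
apply: (IH (x \o widen_ord (leqnSn _))) => q qI; apply: inj_mwiden; rewrite mwiden0.
apply: indx; rewrite (_ : x = snoc (x \o widen_ord (leqnSn _)) (x ord_max)) ?mmap_mwiden //.
apply: funext => j; have [j' ->|->] := unliftP ord_max j; last by rewrite snoc_max.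
by rewrite /snoc liftK /=; congr x; apply: val_inj; rewrite /= /bump leqNgt ltn_ord.
Qed.

(* [A] is a subalgebra (via [i]) of the hypersurface ring [B] = F[X]/(f).       *)
Lemma chain_bound n (A B : comNzRingType) (c : {rmorphism F -> A}) (i : {rmorphism A -> B})
    (h : {rmorphism {mpoly F[n]} -> B}) (f : {mpoly F[n]}) d
    (Q : 'I_d.+1 -> prime_idealr A) m (x : 'I_m -> A) :
  injective i -> (forall b, exists g, b = h g) -> (forall a, i (c a) = h a%:MP) ->
  f != 0 -> (forall g, h g = 0 <-> exists u, g = u * f) ->
  strict_chain Q -> alg_indep c (Q ord_max) x -> (d + m < n)%N.
Proof.
move=> inji surj ic f0 kerh Qlt /(chain_alg_indep Qlt) [y0 indy0].
rewrite ltnNge; apply/negP => nd; have [y indy] := alg_indep_le nd indy0.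
have [g gE] := choice (fun j => surj (i (y j))).
(* The lifts of [n] independent elements, with [f] placed last, are n + 1 polynomials in n
   variables. The lowest power of [f] cancels from their relation, and modulo [f] a relation between
   the lifts alone remains. *)
have [q /mpoly_lowest_last [a [q0 [r [q0n0 ->]]]]] := mpoly_alg_dep (snoc g f).
rewrite rmorphM rmorphXn rmorphD rmorphM /= mmapX mmap1U snoc_max mmap_mwiden.
move/eqP; rewrite mulf_eq0 expf_eq0 (negPf f0) andbF /= addr_eq0 => /eqP E.
have h0 : h (mmap (@mpolyC n F) g q0) = 0.
  by apply/kerh; exists (- mmap (@mpolyC n F) (snoc g f) r); rewrite E mulNr mulrC.
have /eqP := q0n0; apply; apply: indy; rewrite (_ : mmap _ _ _ = 0) ?idealr0 //.
apply: inji; rewrite rmorph0 -h0 !rmorph_mmap; congr mmap; apply: funext => j /=.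
  exact: ic.
exact: gE.
Qed.

End AlgebraicDependence.

(** * Derivations and elimination *)

Section Derivations.

Variable S : comNzRingType.

Definition derivation (D : S -> S) :=
  (forall x y, D (x + y) = D x + D y) /\ (forall x y, D (x * y) = D x * y + x * D y).

Section Leibniz.

Variable D : S -> S.
Hypothesis derD : derivation D.

Lemma derivation0 : D 0 = 0.
Proof. by apply: (@addrI _ (D 0)); rewrite -derD.1 !addr0. Qed.

Lemma derivation_sum (I : Type) (r : seq I) (u : I -> S) :
  D (\sum_(i <- r) u i) = \sum_(i <- r) D (u i).
Proof. exact: (big_morph D derD.1 derivation0). Qed.

Lemma derivation_nat x k : D (x *+ k) = D x *+ k.
Proof. by elim: k => [|k IH]; rewrite ?mulr0n ?derivation0 // !mulrS derD.1 IH. Qed.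

Lemma iter_derivation0 k : iter k D 0 = 0.
Proof. by elim: k => //= k ->; rewrite derivation0. Qed.

Lemma iter_derivationD k x y : iter k D (x + y) = iter k D x + iter k D y.
Proof. by elim: k => //= k ->; rewrite derD.1. Qed.

Lemma leibniz k x y : iter k D (x * y) =
  \sum_(i < k.+1) (iter i D x * iter (k - i) D y) *+ 'C(k, i).
Proof.
elim: k => [|k IH]; first by rewrite big_ord1 mulr1n.
rewrite iterS IH derivation_sum.
under eq_bigr => i _ do rewrite derivation_nat derD.2 mulrnDl.
rewrite big_split /= big_ord_recr /= addrC [in RHS]big_ord_recr /=.
rewrite [RHS]addrC big_ord_recl [in RHS]big_ord_recl /=.
rewrite !subnn !binn !bin0 !mulr1n !subn0.
rewrite [RHS]addrCA -addrA; congr (_ + _); rewrite addrA [RHS]addrC; congr (_ + _).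
rewrite -big_split /=; apply: eq_bigr => i _; rewrite /bump leq0n /= !add1n.
by rewrite subSS binS mulrnDr add0n -(iterS (k - i.+1)) -subSn // subSS.
Qed.

End Leibniz.

(* The largest D-stable ideal inside a prime is prime when the residue          *)
(* characteristic is zero: the first derivatives of x and y outside P produce   *)
(* exactly one term outside P in the Leibniz expansion.                         *)
Lemma differential_core_prime (D : S -> S) (P : prime_idealr S) :
  derivation D -> (forall k, k.+1%:R \notin P) ->
  exists Q : prime_idealr S, forall g, (g \in Q) <-> forall k, iter k D g \in P.
Proof.
move=> derD natP; apply: prime_idealr_of.
- by move=> k; rewrite iter_derivation0 // idealr0.
- by move=> x y Hx Hy k; rewrite iter_derivationD // rpredD.
- move=> a x Hx k; rewrite leibniz //; apply: rpred_sum => i _.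
  by rewrite rpredMn // idealMr.
- by move=> /(_ 0%N); rewrite /= idealr1.
move=> x y Hxy; apply: contrapT => H.
have first_out z : ~ (forall k, iter k D z \in P) ->
    exists m, iter m D z \notin P /\ forall k, (k < m)%N -> iter k D z \in P.
  move=> Hz; have ex : exists m, iter m D z \notin P.
    apply: contrapT => Hn; apply: Hz => k; apply: contraT => kn; case: Hn; by exists k.
  case: (ex_minnP ex) => m mP minm; exists m; split=> // k km.
  by apply: contraT => /minm; rewrite leqNgt km.
have [] := first_out x; first by move=> Hx; apply: H; left.
move=> m [mx xm]; have [] := first_out y; first by move=> Hy; apply: H; right.
move=> k [ky yk]; have := Hxy (m + k)%N; rewrite leibniz //.
have mi : (m < (m + k).+1)%N by rewrite ltnS leq_addr.
rewrite (bigD1 (Ordinal mi)) //= addKn => Hs.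
have : (iter m D x * iter k D y) *+ 'C(m + k, m) \in P.
  rewrite -[X in X \in _](addrK (\sum_(i < (m + k).+1 | i != Ordinal mi)
    (iter i D x * iter (m + k - i) D y) *+ 'C(m + k, i))) rpredB //.
  apply: rpred_sum => i; rewrite -val_eqE /= => im; rewrite rpredMn //.
  have [lt|le] := ltnP i m; first by rewrite mulrC idealMr ?xm.
  by rewrite idealMr // yk //; have := ltn_ord i; lia.
rewrite -mulr_natr; have : (0 < 'C(m + k, m))%N by rewrite bin_gt0 leq_addr.
case: 'C(_, _) => // l _; rewrite !prime_idealrM (negPf mx) (negPf ky).
by rewrite (negPf (natP l)).
Qed.

(** Put [R 0 = P] and let [R k.+1] be the largest [D k]-stable ideal in [R k]. Since [D k] kills
    every other [c j], the element [c k] survives into [R k]; it leaves [R k.+1] because [D k (c k)]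
    is outside [P]. *)
Lemma derivation_chain (P : prime_idealr S) (f : S) d (D : nat -> S -> S) (c : nat -> S) :
  (forall k, k.+1%:R \notin P) -> f \in P ->
  (forall j, derivation (D j)) -> (forall j, D j f = 0) ->
  (forall j, (j < d)%N -> c j \in P) ->
  (forall i j, (i < d)%N -> (j < d)%N -> i != j -> D i (c j) = 0) ->
  (forall j, (j < d)%N -> D j (c j) \notin P) ->
  exists Q : 'I_d.+1 -> prime_idealr S,
    [/\ strict_chain Q, forall i, {subset Q i <= P} & forall i, f \in Q i].
Proof.
move=> natP fP derD Df cP Dc Dcc.
have step (x : nat * prime_idealr S) : exists R : prime_idealr S,
    (forall k, k.+1%:R \notin x.2) ->
    forall g, (g \in R) <-> forall k, iter k (D x.1) g \in x.2.
  have [H|H] := pselect (forall k, k.+1%:R \notin x.2); last by exists P => /H.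
  by have [R RE] := differential_core_prime (derD x.1) H; exists R.
have [core coreP] := choice step.
pose R := fix R k := if k is k'.+1 then core (k', R k') else P.
have [RP RE] : (forall k, {subset R k <= P}) /\
    forall k g, (g \in R k.+1) <-> forall l, iter l (D k) g \in R k.
  have sub k : {subset R k <= P}.
    elim: k => // k IH g.
    have natR l : l.+1%:R \notin (k, R k).2 by apply/negP => /IH; apply/negP.
    by move/(coreP (k, R k) natR)/(_ 0%N)/IH.
  split=> // k; apply: (coreP (k, R k)) => l; by apply/negP => /sub; apply/negP.
have R_dec k l : {subset R (k + l)%N <= R k}.
  elim: l => [|l IH] g; first by rewrite addn0.
  by rewrite addnS => /RE/(_ 0%N)/IH.
have cR k j : (k <= j < d)%N -> c j \in R k.
  elim: k => [|k IH] /andP [kj jd]; first exact: cP.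
  apply/RE => -[|l]; first by apply: IH; rewrite ltnW.
  rewrite iterSr Dc ?iter_derivation0 ?idealr0 //; first exact: ltn_trans jd.
  by rewrite ltn_eqF.
have fR k : f \in R k.
  elim: k => // k IH; apply/RE => -[|l] //.
  by rewrite iterSr Df iter_derivation0 ?idealr0.
(* [R] descends while a [strict_chain] ascends, hence the reversed index. *)
exists (fun i => R (d - i)%N); split=> //.
move=> i j ij; have id := ltn_ord i; have jd := ltn_ord j.
have Rij : {subset R (d - i)%N <= R (d - j).+1}.
  have -> : (d - i = (d - j).+1 + (j - i).-1)%N by lia.
  exact: R_dec.
split=> [g /Rij/RE/(_ 0%N) //|H].
have jd' : (d - j < d)%N by lia.
have /H/Rij/RE/(_ 1%N) : c (d - j)%N \in R (d - j)%N by apply: cR; rewrite leqnn.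
by move=> /RP; apply/negP/Dcc.
Qed.

End Derivations.

(** * Generators of a prime, up to localization, over successively adjoined elements *)

Section Elimination.

Variables (S : comNzRingType) (P : prime_idealr S).

Definition subring_pred (A : S -> Prop) :=
  [/\ A 1, forall x y, A x -> A y -> A (x - y) & forall x y, A x -> A y -> A (x * y)].

Definition adjoin (A : S -> Prop) (x y : S) :=
  exists2 q : {poly S}, forall i, A q`_i & y = q.[x].

(** Only the elements to be generated are restricted to [A]; multiplier and coefficients range over
    the whole ring, so this is generation after localizing at [P]. *)
Definition locally_generates (A : S -> Prop) k (m : nat -> S) :=
  (forall i, (i < k)%N -> m i \in P) /\
  forall a, A a -> a \in P -> exists2 s, s \notin P & genby k m (s * a).

Section SubringFacts.
Variable A : S -> Prop.
Hypothesis subA : subring_pred A.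

Lemma subring_pred0 : A 0.
Proof. by rewrite -(subrr 1); have [A1 AB _] := subA; apply: (AB). Qed.

Lemma subring_predD x y : A x -> A y -> A (x + y).
Proof.
move=> Ax Ay; have [_ AB _] := subA; rewrite -[y]opprK -[- y]sub0r.
by apply: (AB) => //; apply: (AB) => //; apply: subring_pred0.
Qed.

Lemma subring_pred_sum (I : Type) (r : seq I) (u : I -> S) :
  (forall i, A (u i)) -> A (\sum_(i <- r) u i).
Proof.
by move=> Au; elim/big_ind: _ => //; [exact: subring_pred0|exact: subring_predD].
Qed.

Lemma adjoin_subring x : subring_pred (adjoin A x).
Proof.
have [A1 AB AM] := subA; split.
- by exists 1; rewrite ?hornerC // => i; rewrite coef1; case: eqP => _ //; apply: subring_pred0.
- move=> _ _ [p Ap ->] [q Aq ->]; exists (p - q); rewrite ?hornerD ?hornerN //.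
  by move=> i; rewrite coefB; apply: (AB).
- move=> _ _ [p Ap ->] [q Aq ->]; exists (p * q); rewrite ?hornerM //.
  by move=> i; rewrite coefM; apply: subring_pred_sum => j; apply: (AM).
Qed.

Lemma adjoin_sub x a : A a -> adjoin A x a.
Proof.
move=> Aa; exists a%:P; rewrite ?hornerC // => i; rewrite coefC; case: eqP => _ //.
exact: subring_pred0.
Qed.

Lemma adjoin_mem x : adjoin A x x.
Proof.
exists 'X; rewrite ?hornerX // => i; rewrite coefX; case: eqP => _; last exact: subring_pred0.
by case: subA.
Qed.

End SubringFacts.

(* The new generator is the value at x of a polynomial of least degree among    *)
(* those over A vanishing at x modulo P with leading coefficient outside P.     *)
Lemma locally_generates_adjoin (A : S -> Prop) k m x :
  subring_pred A -> locally_generates A k m ->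
  exists m', locally_generates (adjoin A x) k.+1 m'.
Proof.
move=> subA [mP gen]; have [A1 AB AM] := subA.
pose good (q : {poly S}) := [/\ forall i, A q`_i, q.[x] \in P & lead_coef q \notin P].
have [m0 [m0A m0P m0min]] : exists m0 : {poly S}, [/\ forall i, A m0`_i, m0.[x] \in P &
    forall q, good q -> lead_coef m0 \notin P /\ (size m0 <= size q)%N].
  (* Without a good polynomial the new generator is 0: every polynomial over [A] that vanishes at
     [x] modulo [P] then has its leading coefficient in [P], and the reduction below only strips
     leading terms. *)
  have [[q0 q0g]|H] := pselect (exists q, good q); last first.
    exists 0; split=> [i||q qg]; rewrite ?horner0 ?idealr0 //; last by case: H; exists q.
    by rewrite coef0; apply: subring_pred0.
  have ex : exists N, `[< exists2 q, good q & size q = N >].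
    by exists (size q0); apply/asboolP; exists q0.
  case: (ex_minnP ex) => N /asboolP [m0 [m0A m0P m0l] <-] minN.
  by exists m0; split=> // q qg; split=> //; apply: minN; apply/asboolP; exists q.
pose m' i := if (i < k)%N then m i else m0.[x].
have gen_le a : genby k m a -> genby k.+1 m' a.
  move=> [b ->]; exists (fun i => if (i < k)%N then b i else 0).
  rewrite big_ord_recr /= ltnn mul0r addr0; apply: eq_bigr => i _.
  by rewrite /m' !ltn_ord.
have gen_m0 : genby k.+1 m' m0.[x].
  by have -> : m0.[x] = m' k; [rewrite /m' ltnn|apply: genby_mem].
have [G0 GD GM] := genby_ideal k.+1 m'.
exists m'; split=> [i ik|_ [q qA ->]].
  by rewrite /m'; case: ifP => // /mP.
have [N] := ubnP (size q); elim: N q qA => // N IH q qA szq qP.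
have [->|q0] := eqVneq q 0.
  by exists 1; rewrite ?idealr1 // horner0 mulr0.
have sq : (0 < size q)%N by rewrite size_poly_gt0.
have lA : A (lead_coef q) by apply: qA.
have [lP|lP] := boolP (lead_coef q \in P).
  pose r := q - lead_coef q *: 'X^((size q).-1).
  have rA i : A r`_i.
    rewrite coefB coefZ coefXn; apply: (AB) => //; apply: (AM) => //.
    by case: eqP => _ //; apply: subring_pred0.
  have [||s sP sg] := IH r rA.
  - rewrite -ltnS; apply: leq_trans szq; rewrite ltnS -(prednK sq) ltnS.
    apply/leq_sizeP => j Hj; rewrite coefB coefZ coefXn.
    have [->|ne] := eqVneq j (size q).-1; first by rewrite mulr1 subrr.
    rewrite mulr0 subr0 nth_default // -(prednK sq) ltn_neqAle eq_sym ne //.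
  - by rewrite hornerD hornerN hornerZ rpredB // mulrC idealMr.
  have [t tP tg] := gen _ lA lP.
  exists (s * t); first by rewrite prime_idealrM negb_or sP.
  have -> : s * t * q.[x] = t * (s * r.[x]) + s * x ^+ ((size q).-1) * (t * lead_coef q).
    rewrite hornerD hornerN hornerZ hornerXn; ring.
  apply: (GD); apply: (GM) => //; exact: gen_le.
have [l0P sz0] := m0min q (And3 qA qP lP).
(* Pseudo-division by [m0], whose leading coefficient is outside [P] and joins the multiplier. *)
pose r := lead_coef m0 *: q - lead_coef q *: ('X^(size q - size m0) * m0).
have m00 : m0 != 0 by apply: contraNneq l0P => ->; rewrite lead_coef0 idealr0.
have rA i : A r`_i.
  rewrite coefB !coefZ; apply: (AB); first by apply: (AM) => //; apply: m0A.
  apply: (AM) => //; rewrite coefXnM; case: ifP => _ //; exact: subring_pred0.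
have [||s sP sg] := IH r rA.
- rewrite -ltnS; apply: leq_trans szq; rewrite ltnS -(prednK sq) ltnS.
  apply/leq_sizeP => j Hj; rewrite coefB !coefZ coefXnM.
  have s0 : (0 < size m0)%N by rewrite size_poly_gt0.
  rewrite ifN; last by rewrite -leqNgt; move: Hj sz0 s0 sq; move: (size q) (size m0) => u v; lia.
  have [->|ne] := eqVneq j (size q).-1.
    have -> : ((size q).-1 - (size q - size m0) = (size m0).-1)%N.
      by move: sz0 s0 sq; move: (size q) (size m0) => u v; lia.
    by rewrite -/(lead_coef q) -/(lead_coef m0) mulrC subrr.
  rewrite !nth_default ?mulr0 ?subrr //; move: Hj ne sz0 s0 sq; move: (size q) (size m0) => u v; lia.
- rewrite hornerD hornerN !hornerZ hornerM.
  by rewrite rpredB // !idealMr.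
exists (s * lead_coef m0); first by rewrite prime_idealrM negb_or sP.
have -> : s * lead_coef m0 * q.[x] =
    s * r.[x] + s * lead_coef q * x ^+ (size q - size m0) * m0.[x].
  rewrite hornerD hornerN !hornerZ hornerM hornerXn; ring.
by apply: (GD) => //; apply: (GM).
Qed.

Lemma locally_generates_seq (A : S -> Prop) k m (r : seq S) :
  subring_pred A -> locally_generates A k m ->
  exists A' m', [/\ subring_pred A', forall a, A a -> A' a, forall x, x \in r -> A' x &
    locally_generates A' (k + size r) m'].
Proof.
elim: r A k m => [|x r IH] A k m subA Agen; first by exists A, m; rewrite addn0.
have [m1 gen1] := locally_generates_adjoin x subA Agen.
have [A' [m' [subA' AA' rA' gen']]] := IH _ _ _ (adjoin_subring subA x) gen1.
exists A', m'; split=> [//|a Aa|y|]; last by rewrite /= addnS -addSn.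
  by apply: AA'; apply: adjoin_sub.
rewrite inE => /orP [/eqP ->|/rA' //].
by apply: AA'; apply: adjoin_mem.
Qed.

End Elimination.

Section MpolyDerivatives.

Variables (F : numFieldType) (n : nat).
Implicit Types g h : {mpoly F[n]}.

Lemma msize_mderiv i g : g != 0 -> (msize g^`M(i) < msize g)%N.
Proof.
move=> g0; have : (0 < msize g)%N by rewrite lt0n msize_poly_eq0.
move=> /prednK sg; rewrite -sg ltnS [msize (mderiv i g)]msizeE.
apply/bigmax_leqP_seq => m; rewrite mcoeff_msupp mcoeff_mderiv => H _.
have : (m + U_(i))%MM \in msupp g.
  by rewrite mcoeff_msupp; apply: contraNneq H => ->; rewrite mul0rn.
by move/msize_mdeg_lt; rewrite mdegD mdeg1 addn1 -sg ltnS.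
Qed.

Lemma mderiv_coef0 i g (m : 'X_{1..n}) : g^`M(i) = 0 -> (0 < m i)%N -> g@_m = 0.
Proof.
move=> gi mi; have := congr1 (mcoeff (m - U_(i))) gi.
rewrite mcoeff_mderiv mcoeff0 submK; last first.
  by apply/mnm_lepP => j; rewrite mnm1E; case: eqP => [<-|].
by move/eqP; rewrite mulrn_eq0 /= => /eqP.
Qed.

Lemma mderiv0_const g : (forall i, g^`M(i) = 0) -> g = (g@_0)%:MP.
Proof.
move=> gi; apply/mpolyP => m; rewrite mcoeffC.
have [->|] := eqVneq m 0%MM; first by rewrite mulr1.
rewrite mulr0 -mdeg_eq0 mdegE => m0.
have /existsP [i mi] : [exists i, (0 < m i)%N].
  apply: contraNT m0; rewrite negb_exists => /forallP H.
  by rewrite sum_nat_eq0; apply/forallP => i; have := H i; rewrite -eqn0Ngt.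
exact: mderiv_coef0 (gi i) mi.
Qed.

Lemma mderiv_mmap0 m i (x : 'I_m -> {mpoly F[n]}) q :
  (forall k, (x k)^`M(i) = 0) -> (mmap (@mpolyC n F) x q)^`M(i) = 0.
Proof.
move=> xi; rewrite /mmap raddf_sum big1 //= => k _.
rewrite mderiv_mulC [X in _ * X](_ : _ = 0) ?mulr0 // /mmap1.
have D0 y z : y^`M(i) = 0 -> z^`M(i) = 0 -> (y * z)^`M(i) = 0.
  by move=> yi zi; rewrite mderivM yi zi mul0r mulr0 addr0.
elim/big_ind: _ => [|y z|j _]; [by rewrite -mpolyC1 mderivC|exact: D0|].
by elim: (k j) => [|l IH]; rewrite ?exprS ?D0 // expr0 -mpolyC1 mderivC.
Qed.

Lemma mmap_vars_inj m (e : 'I_m -> 'I_n) q : injective e ->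
  mmap (@mpolyC n F) (fun k => 'X_(e k)) q = 0 -> q = 0.
Proof.
move=> inje E.
pose h := mmap (@mpolyC m F) (fun i => if [pick k | e k == i] is Some k then 'X_k else 0).
have := congr1 h E; rewrite /h rmorph0 rmorph_mmap => <-.
rewrite [LHS]mpolyE /mmap; apply: eq_bigr => k _ /=.
rewrite mmapC mul_mpolyC mpolyXE_id; congr (_ *: _); apply: eq_bigr => i _.
rewrite /= mmapX mmap1U; case: pickP => [j /eqP/inje -> //|/(_ i)].
by rewrite eqxx.
Qed.

End MpolyDerivatives.

(** * Primes containing f but not all of its partial derivatives *)

Section SmoothPrime.

Variables (F : numFieldType) (n : nat) (P : prime_idealr {mpoly F[n]}).
Variables (f : {mpoly F[n]}) (j0 : 'I_n).
Hypotheses (fP : f \in P) (fj0 : f^`M(j0) \notin P).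

Lemma const_notin_prime (c : F) : c != 0 -> c%:MP \notin P.
Proof.
move=> c0; apply/negP => /(idealMr (c^-1)%:MP).
by rewrite -mpolyCM mulVf // mpolyC1 idealr1.
Qed.

Lemma nat_notin_prime k : k.+1%:R \notin P.
Proof.
rewrite -mpolyC_nat; apply: const_notin_prime; by rewrite pnatr_eq0.
Qed.

(** In characteristic zero this says that [g] is a polynomial in the variables of [B]; in this form
    closure under ring operations is the Leibniz rule. *)
Definition free_of (B : {set 'I_n}) (g : {mpoly F[n]}) :=
  forall i, i \notin B -> g^`M(i) = 0.

Definition indep_vars (B : {set 'I_n}) := forall g, free_of B g -> g \in P -> g = 0.

(** [j0] is kept out of [B] because [f] itself, whose derivative there is outside [P], serves as the
    relation for that variable. *)
Lemma maximal_indep_vars : exists B : {set 'I_n}, [/\ j0 \notin B, indep_vars B &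
  forall j, j \notin B -> j != j0 -> ~ indep_vars (j |: B)].
Proof.
pose Pr (B : {set 'I_n}) := (j0 \notin B) && `[< indep_vars B >].
have P0 : Pr set0.
  rewrite /Pr inE /=; apply/asboolP => g g0 gP.
  have gE : g = (g@_0)%:MP by apply: mderiv0_const => i; apply: g0; rewrite inE.
  apply/eqP; apply: contraTT gP => gn0; rewrite gE; apply: const_notin_prime.
  by apply: contraNneq gn0 => c0; rewrite gE c0 mpolyC0.
have [B /maxsetP [/andP [jB /asboolP indB] maxB] _] := maxset_exists P0.
exists B; split=> // j jnB jj0 indj.
have : j |: B = B.
  apply: maxB; last exact: subsetUr.
  rewrite /Pr !inE negb_or eq_sym jj0 jB /=; exact/asboolP.
by move/setP/(_ j); rewrite !inE eqxx (negPf jnB).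
Qed.

(** For a relation of least degree, the derivative along [j] is of smaller degree, so it lies in [P]
    only if it is zero; the relation would then involve [B] alone. *)
Lemma minimal_relation (B : {set 'I_n}) j : indep_vars B -> ~ indep_vars (j |: B) ->
  exists c, [/\ c \in P, free_of (j |: B) c & c^`M(j) \notin P].
Proof.
move=> indB nind.
have ex : exists N, `[< exists2 g, [/\ g \in P, free_of (j |: B) g & g != 0] & msize g = N >].
  apply: contrapT => H; apply: nind => g gf gP; apply/eqP; apply: contraT => g0.
  by case: H; exists (msize g); apply/asboolP; exists g.
case: (ex_minnP ex) => N /asboolP [c [cP cf c0] <-] minN.
exists c; split=> //; apply/negP => cjP.
have [cj0|cj0] := eqVneq (c^`M(j)) 0.
  have /indB/(_ cP)/eqP : free_of B c; last by rewrite (negPf c0).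
  move=> i iB; have [-> //|ij] := eqVneq i j.
  by apply: cf; rewrite !inE negb_or ij.
have := minN (msize c^`M(j)); rewrite leqNgt msize_mderiv // => H.
suff: ~~ true by []. apply: H; apply/asboolP; exists (c^`M(j)) => //; split=> // i iB.
by rewrite mderiv_comm cf // mderiv0.
Qed.

Lemma free_of_subring B : subring_pred (free_of B).
Proof.
split=> [i _|x y xf yf i iB|x y xf yf i iB].
- by rewrite -mpolyC1 mderivC.
- by rewrite mderivB xf ?yf // subr0.
- by rewrite mderivM xf ?yf // mul0r mulr0 addr0.
Qed.

Lemma local_generators (B : {set 'I_n}) : indep_vars B ->
  exists m : nat -> {mpoly F[n]}, (forall i, (i < #|~: B|)%N -> m i \in P) /\
    forall g, g \in P -> exists2 s, s \notin P & genby #|~: B| m (s * g).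
Proof.
move=> indB.
have gen0 : locally_generates P (free_of B) 0 (fun=> 0).
  split=> // a af aP; exists 1; rewrite ?idealr1 // (indB a af aP) mulr0.
  by exists (fun=> 0); rewrite big_ord0.
have [A' [m [subA AA' rA' [mP gen]]]] :=
  locally_generates_seq [seq 'X_i | i in ~: B] (free_of_subring B) gen0.
rewrite add0n size_map -cardE in mP gen.
exists m; split=> // g; apply: gen.
have [A1 AB AM] := subA.
have AC c : A' c%:MP by apply: AA' => i _; rewrite mderivC.
elim/mpolyind: g => [|c k g _ _ IH]; first by rewrite -mpolyC0.
apply: subring_predD => //; rewrite -mul_mpolyC; apply: (AM) => //.
rewrite mpolyXE_id; elim/big_ind: _ => // i _.
have AX : A' 'X_i.
  have [iB|iB] := boolP (i \in B).
    apply: AA' => l lB; rewrite mderivX mnm1E; case: eqP => [E|_].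
      by rewrite -E iB in lB.
    by rewrite scale0r.
  by apply: rA'; apply/mapP; exists i; rewrite // mem_enum inE.
by elim: (k i) => [|l IHl]; rewrite ?expr0 // exprS; apply: (AM).
Qed.

Lemma det_mod_prime (S : comNzRingType) (I : prime_idealr S) N (X Y : 'M[S]_N) :
  (forall a b, X a b - Y a b \in I) -> \det X - \det Y \in I.
Proof.
move=> XY; pose h := \pi_({ideal_quot I})%qT : {rmorphism S -> {ideal_quot I}}.
have hE x y : (x - y \in I) = (h x == h y) by rewrite Quotient.idealrBE.
rewrite hE -!det_map_mx; apply/eqP; congr (\det _); apply/matrixP => a b.
by rewrite !mxE; apply/eqP; rewrite -hE.
Qed.

Lemma mderiv_sq_ideal i g : g \in sq_ideal P -> g^`M(i) \in P.
Proof.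
move=> /sq_idealP [k [u [v [uvP ->]]]]; rewrite raddf_sum; apply: rpred_sum => j _ /=.
have [uP vP] := uvP j.
by rewrite mderivM rpredD //; [rewrite idealMr|rewrite mulrC idealMr].
Qed.

(** [r] is the number of independent variables and [d] the number of the others except [j0]. The
    [c i] together with [f] span P modulo its square; the last clause gives the independence of the
    [c i] in the ring modulo [f]. *)
Lemma smooth_prime_data :
  exists d r (c : 'I_d -> {mpoly F[n]}) (x : 'I_r -> {mpoly F[n]})
         (Q : 'I_d.+1 -> prime_idealr {mpoly F[n]}),
    [/\ (d + r).+1 = n, strict_chain Q, forall i, {subset Q i <= P},
        forall i, f \in Q i & alg_indep (@mpolyC n F) P x] /\
    [/\ forall i, c i \in P,
        forall g, g \in P -> exists2 s, s \notin P &
          exists (a : 'I_d -> {mpoly F[n]}) u, s * g = \sum_i a i * c i + u * f &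
        forall (a : 'I_d -> {mpoly F[n]}) u,
          \sum_i a i * c i - u * f \in sq_ideal P -> forall i, a i \in P].
Proof.
have [B [jB indB maxB]] := maximal_indep_vars.
pose J := ~: B :\ j0; pose d := #|J|; pose r := #|B|.
have cardB : #|~: B| = d.+1 by rewrite (cardsD1 j0) inE jB.
pose e (k : 'I_d) : 'I_n := enum_val k.
have eJ k : (e k \notin B) /\ (e k != j0).
  by have := enum_valP k; rewrite !inE => /andP [].
have inje : injective e by apply: enum_val_inj.
have [c cP] := choice (fun k => minimal_relation indB (maxB _ (eJ k).1 (eJ k).2)).
have c_other k l : k != l -> (c k)^`M(e l) = 0.
  have [_ cf _] := cP k; move=> kl; apply: cf; rewrite !inE negb_or (eJ l).1 andbT.
  by rewrite (inj_eq inje) eq_sym.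
have c_j0 k : (c k)^`M(j0) = 0.
  have [_ cf _] := cP k; apply: cf; rewrite !inE negb_or jB andbT eq_sym.
  exact: (eJ k).2.
(* These derivations annihilate f, and D k detects c k among all the c l.       *)
pose D (k : 'I_d) g := f^`M(j0) * g^`M(e k) - f^`M(e k) * g^`M(j0).
have derD k : derivation (D k).
  split=> y z; rewrite /D ?mderivD ?mderivM; ring.
pose D' (k : nat) := if insub k is Some i then D i else fun=> 0.
pose c' (k : nat) := if insub k is Some i then c i else 0.
have insE k (kd : (k < d)%N) : insub k = Some (Ordinal kd) by rewrite insubT.
have [|||||Q [Qlt QP Qf]] := @derivation_chain _ P f d D' c' nat_notin_prime fP.
- by move=> k; rewrite /D'; case: insubP => // _; split=> ? ?; rewrite ?mul0r ?mulr0 addr0.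
- by move=> k; rewrite /D'; case: insubP => // i _ _; rewrite /D; ring.
- by move=> k kd; rewrite /c' insE; have [] := cP (Ordinal kd).
- move=> k l kd ld kl; rewrite /D' /c' !insE /D c_j0 c_other ?mulr0 ?subr0 //.
  by rewrite -val_eqE eq_sym.
- move=> k kd; rewrite /D' /c' !insE /D c_j0 mulr0 subr0 prime_idealrM negb_or fj0.
  by have [] := cP (Ordinal kd).
exists d, r, c, (fun k : 'I_r => 'X_(enum_val k)), Q.
have cdiag k : (c k)^`M(e k) \notin P by have [] := cP k.
have cPP k : c k \in P by have [] := cP k.
split; split=> //.
- by rewrite addnC -addnS -cardB cardsC card_ord.
- move=> q qP; apply: (@mmap_vars_inj _ n _ (@enum_val _ (mem B))); first exact: enum_val_inj.
  apply: indB => // i iB; apply: mderiv_mmap0 => k; rewrite mderivX mnm1E.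
  by case: eqP => [E|_]; rewrite ?scale0r //; rewrite -E enum_valP in iB.
(* The family [cf], that is [c] followed by [f], is compared with the d + 1 local generators [m].
   Differentiating the expressions of [cf] through [m] gives X = M Jm modulo [P]. As X is triangular
   with diagonal outside [P], det M is outside [P], and Cramer's rule expresses [m] through [cf]. *)
- have [m [mP gen]] := local_generators indB.
  rewrite cardB in mP gen; pose e' := snoc e j0; pose cf := snoc c f.
  have cfP a : cf a \in P by rewrite /cf /snoc; case: unlift.
  have H a : exists sM : {mpoly F[n]} * (nat -> {mpoly F[n]}),
      sM.1 \notin P /\ sM.1 * cf a = \sum_(b < d.+1) sM.2 b * m b.
    by have [s sP [M ME]] := gen _ (cfP a); exists (s, M).
  have [sM sME] := choice H.
  pose M : 'M_d.+1 := \matrix_(a, b) (sM a).2 b.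
  pose Jm : 'M_d.+1 := \matrix_(a, b) (m a)^`M(e' b).
  pose X : 'M_d.+1 := \matrix_(a, b) ((sM a).1 * (cf a)^`M(e' b)).
  have detM : \det M \notin P.
    have detX : \det X \notin P.
      rewrite det_trig; last first.
        apply/is_trig_mxP => a b ab; rewrite mxE /cf /e' /snoc.
        have [a' aE|aE] := unliftP ord_max a; last first.
          by move: ab; rewrite aE ltnNge -ltnS ltn_ord.
        have [b' bE|bE] := unliftP ord_max b; rewrite ?c_j0 ?mulr0 //.
        rewrite c_other ?mulr0 //; apply: contraTneq ab => E.
        by rewrite aE bE E ltnn.
      apply: prime_prod => a; rewrite mxE prime_idealrM negb_or (sME a).1 /=.
      by rewrite /cf /e' /snoc; case: unliftP.
    apply: contra detX => MP.
    rewrite -(subrK (\det (M *m Jm)) (\det X)) rpredD //.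
      apply: det_mod_prime => a b; rewrite !mxE.
      have := congr1 (mderiv (e' b)) (sME a).2.
      rewrite mderivM raddf_sum /= => /(canRL (addKr _)) ->.
      rewrite -addrA rpredD //; first by rewrite rpredN idealMr.
      by rewrite -sumrB; apply: rpred_sum => i _;
        rewrite mderivM !mxE addrK idealMr // mP.
    by rewrite det_mulmx mulrC idealMr.
  move=> g gP; have [s sP [b bE]] := gen g gP.
  pose bv : 'rV_d.+1 := \row_k b k.
  pose av : 'rV_d.+1 := bv *m \adj M *m diag_mx (\row_a (sM a).1).
  exists (\det M * s); first by rewrite prime_idealrM negb_or detM.
  exists (fun i => av 0 (lift ord_max i)), (av 0 ord_max).
  pose mv : 'cV_d.+1 := \col_k m k; pose cv : 'cV_d.+1 := \col_k cf k.
  have Mm : M *m mv = diag_mx (\row_a (sM a).1) *m cv.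
    apply/colP => a; rewrite mul_diag_mx !mxE (sME a).2.
    by apply: eq_bigr => k _; rewrite !mxE.
  have sg : s * g = (bv *m mv) 0 0.
    by rewrite bE mxE; apply: eq_bigr => k _; rewrite !mxE.
  have -> : \det M * s * g = (av *m cv) 0 0.
    rewrite -mulrA sg /av -!mulmxA -Mm (mulmxA (\adj M)) mul_adj_mx.
    by rewrite mul_scalar_mx -scalemxAr [RHS]mxE.
  rewrite mxE (bigD1 ord_max) //= addrC; congr (_ + _); last by rewrite [cv _ _]mxE /cf snoc_max.
  rewrite (reindex_omap (lift ord_max) (unlift ord_max)) /=; last first.
    by move=> i; case: unliftP => [j ->|->]; rewrite ?eqxx //= liftK.
  apply: eq_big => [k|k _]; last by rewrite [cv _ _]mxE /cf /snoc liftK.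
  by rewrite liftK eqxx eq_sym neq_lift.
(* The derivative along [j0] sees only [f] and puts [u] in [P]; the derivative along [e i] then
   isolates [a i]. *)
- move=> a u H i.
  have D0 j : (\sum_i a i * c i - u * f)^`M(j) \in P by apply: mderiv_sq_ideal.
  have D1 j : \sum_i a i * (c i)^`M(j) - u * f^`M(j) \in P.
    have := D0 j; rewrite mderivB mderivM raddf_sum /=.
    under eq_bigr => k _ do rewrite mderivM.
    rewrite big_split /= opprD addrACA => H2.
    rewrite -[X in X \in _](addKr (\sum_i0 (a i0)^`M(j) * c i0 - u^`M(j) * f)) rpredD //.
    by rewrite rpredN rpredB ?idealMr //; apply: rpred_sum => k _; rewrite idealMr.
  have uP : u \in P.
    have := D1 j0; rewrite big1 => [|k _]; last by rewrite c_j0 mulr0.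
    by rewrite sub0r rpredN prime_idealrM (negPf fj0) orbF.
  have := D1 (e i); rewrite (bigD1 i) //= big1 => [|k ki]; last first.
    by rewrite c_other ?mulr0 // eq_sym.
  rewrite addr0 => H3.
  have : a i * (c i)^`M(e i) \in P.
    by rewrite -(subrK (u * f^`M(e i)) (a i * _)) rpredD // mulrC idealMr.
  by rewrite prime_idealrM (negPf (cdiag i)) orbF.
Qed.

End SmoothPrime.

(** * Regularity of hypersurface rings at smooth primes *)

Section HypersurfaceQuotient.

Variables (F : numFieldType) (n : nat) (f : {mpoly F[n]}) (A : comNzRingType).
Variable h : {rmorphism {mpoly F[n]} -> A}.
Hypotheses (surjh : forall a, exists g, a = h g).
Hypotheses (kerh : forall g, h g = 0 <-> exists u, g = u * f).
Hypothesis f0 : f != 0.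

Lemma quotient_map_f : h f = 0.
Proof. by apply/kerh; exists 1; rewrite mul1r. Qed.

Lemma prime_preimage (P : prime_idealr A) :
  exists P' : prime_idealr {mpoly F[n]}, forall g, (g \in P') <-> (h g \in P).
Proof.
apply: prime_idealr_of.
- by rewrite rmorph0 idealr0.
- by move=> x y Hx Hy; rewrite rmorphD rpredD.
- by move=> a x Hx; rewrite rmorphM idealMr.
- by rewrite rmorph1 idealr1.
- by move=> x y; rewrite rmorphM prime_idealrM => /orP.
Qed.

Lemma prime_image (Q : prime_idealr {mpoly F[n]}) : f \in Q ->
  exists Q' : prime_idealr A, forall g, (h g \in Q') <-> (g \in Q).
Proof.
move=> fQ; pose I a := exists2 g, g \in Q & a = h g.
have hI g : I (h g) -> g \in Q.
  move=> [g' g'Q E]; have /kerh [u uE] : h (g - g') = 0 by rewrite rmorphB E subrr.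
  by rewrite -(subrK g' g) rpredD // uE idealMr.
have [|||||Q' QE] := @prime_idealr_of A I.
- by exists 0; rewrite ?rmorph0 ?idealr0.
- by move=> _ _ [a aQ ->] [b bQ ->]; exists (a + b); rewrite ?rmorphD ?rpredD.
- move=> x _ [a aQ ->]; have [b ->] := surjh x.
  by exists (b * a); rewrite ?rmorphM ?idealMr.
- by rewrite -(rmorph1 h) => /hI; rewrite idealr1.
- move=> x y; have [a ->] := surjh x; have [b ->] := surjh y.
  rewrite -rmorphM => /hI; rewrite prime_idealrM => /orP [H|H]; [left|right].
    by exists a.
  by exists b.
exists Q' => g; split=> [/QE/hI //|gQ]; apply/QE; by exists g.
Qed.

Lemma chain_image d (Q : 'I_d.+1 -> prime_idealr {mpoly F[n]}) :
  strict_chain Q -> (forall i, f \in Q i) ->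
  exists Q' : 'I_d.+1 -> prime_idealr A, strict_chain Q' /\
    forall i g, (h g \in Q' i) <-> (g \in Q i).
Proof.
move=> Qlt Qf; have [Q' QE] := choice (fun i => prime_image (Qf i)).
exists Q'; split=> // i j ij; have [H1 H2] := Qlt i j ij; split.
  by move=> a; have [g ->] := surjh a => /QE/H1/QE.
by move=> H; apply: H2 => g /QE/H/QE.
Qed.

Lemma quotient_chain_bound e (Q : 'I_e.+1 -> prime_idealr A) m (x : 'I_m -> A) :
  strict_chain Q -> alg_indep (h \o @mpolyC n F) (Q ord_max) x -> (e + m < n)%N.
Proof. exact: (@chain_bound F n A A (h \o @mpolyC n F) idfun h f). Qed.

Lemma quotient_regular_at (P : prime_idealr A) j0 :
  h f^`M(j0) \notin P -> regular_at P.
Proof.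
move=> smooth; have [P' PE] := prime_preimage P.
have fP' : f \in P' by apply/PE; rewrite quotient_map_f idealr0.
have fj' : f^`M(j0) \notin P' by apply: contra smooth => /PE.
have [d [r [c [x [Q [[dr Qlt QP Qf indx] [cP span indep]]]]]]] := smooth_prime_data fP' fj'.
have [Q' [Qlt' QE]] := chain_image Qlt Qf.
apply: (@regular_at_intro _ _ d (h \o c)).
- by apply: (fg_ideals_surj surjh); apply: fg_ideals_mpoly.
- by exists Q'; split=> // i a; have [g ->] := surjh a => /QE/QP/PE.
(* The [r] elements independent modulo [P] remain so modulo the top of any chain below [P], which
   leaves at most n - 1 - r = d steps. *)
- move=> e [Qe [QeP Qelt]]; rewrite -(leq_add2r r) -ltnS dr.
  apply: (@quotient_chain_bound e Qe r (h \o x) Qelt) => q /QeP qP; apply: indx; apply/PE.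
  by rewrite rmorph_mmap.
- by move=> i; apply/PE/cP.
- move=> a; have [g ->] := surjh a => /PE/span [s sP [b [u E]]].
  exists (h s); first by apply: contra sP => /PE.
  exists (h \o b); rewrite -rmorphM E rmorphD rmorphM quotient_map_f mulr0 addr0.
  have -> : \sum_i (h \o b) i * (h \o c) i = h (\sum_i b i * c i).
    by rewrite rmorph_sum; apply: eq_bigr => i _; rewrite rmorphM.
  by rewrite subrr; have [] := sq_ideal_is_ideal P.
- move=> a /sq_idealP [k [u [v [uvP E]]]] i.
  have [a' aE] := choice (fun i => surjh (a i)).
  have [u' uE] := choice (fun i => surjh (u i)); have [v' vE] := choice (fun i => surjh (v i)).
  have /kerh [w wE] : h (\sum_i a' i * c i - \sum_i u' i * v' i) = 0.
    apply/eqP; rewrite rmorphB !rmorph_sum subr_eq0; apply/eqP.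
    transitivity (\sum_i a i * (h \o c) i).
      by apply: eq_bigr => j _; rewrite rmorphM -aE.
    by rewrite E; apply: eq_bigr => j _; rewrite rmorphM -uE -vE.
  rewrite aE; apply/PE; apply: (indep a' w).
  rewrite -wE opprB addrC subrK; apply/sq_idealP; exists k, u', v'; split=> // j.
  by have [uP vP] := uvP j; split; apply/PE; rewrite -?uE -?vE.
Qed.

(** At a rational point every element is congruent to a constant, so r = 0, and smoothness gives a
    chain of length n - 1 below that point. *)
Lemma quotient_krull_dim (x0 : 'I_n -> F) j0 :
  f.@[x0] = 0 -> f^`M(j0).@[x0] != 0 -> krull_dim A n.-1.
Proof.
move=> fx fjx; have n0 : (0 < n)%N by apply: leq_trans (ltn_ord j0).
split; last first.
  move=> e [Q Qlt]; rewrite -ltnS (prednK n0) -[e]addn0.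
  apply: (@quotient_chain_bound e Q 0 (fun=> 0) Qlt) => q qQ.
  have qE : q = (q@_0)%:MP by apply: mderiv0_const => -[].
  apply/eqP; apply: contraTT qQ => q0; rewrite qE mmapC; apply/negP.
  move=> /(idealMr (h (q@_0)^-1%:MP)).
  rewrite -rmorphM -mpolyCM mulVf ?mpolyC1 ?rmorph1 ?idealr1 //.
  by apply: contraNneq q0 => c0; rewrite qE c0 mpolyC0.
have [|||||P PE] := @prime_idealr_of {mpoly F[n]} (fun g => g.@[x0] = 0).
- by rewrite meval0.
- by move=> x y xP yP; rewrite mevalD xP yP addr0.
- by move=> a x xP; rewrite mevalM xP mulr0.
- by rewrite meval1 => /eqP; rewrite oner_eq0.
- by move=> x y; rewrite mevalM => /eqP; rewrite mulf_eq0 => /orP [] /eqP; [left|right].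
have fP : f \in P by apply/PE.
have fj : f^`M(j0) \notin P by apply/negP => /PE/eqP; rewrite (negPf fjx).
have [d [r [c [x [Q [[dr Qlt _ Qf indx] _]]]]]] := smooth_prime_data fP fj.
case: r => [|r] in dr x indx *; last first.
  have /indx/(congr1 (mcoeff U_(ord0))) :
      mmap (@mpolyC n F) x ('X_ord0 - (x ord0).@[x0]%:MP) \in P.
    by apply/PE; rewrite rmorphB /= mmapX mmap1U mmapC mevalB mevalC subrr.
  rewrite mcoeffB mcoeffXU mcoeffC eqxx mnm1_eq0 mulr0 subr0 mcoeff0 => /eqP.
  by rewrite oner_eq0.
have [Q' [Qlt' _]] := chain_image Qlt Qf.
have -> : n.-1 = d by rewrite -dr addn0.
by exists Q'.
Qed.

End HypersurfaceQuotient.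

(** * The canonical ring *)

Section SignatureFacts.

Variables (n : nat) (p : signature n).

Lemma sig_gt1 i : (1 < p i)%N.
Proof.
have p0 := sig_gt0 p i; rewrite ltn_neqAle eq_sym p0 andbT; apply/eqP => p1.
have := sig_lt1 p; rewrite (bigD1 i) //= p1 invr1 ltNge lerDl => /negP; apply.
by apply: sumr_ge0 => j _; rewrite invr_ge0 ler0n.
Qed.

Lemma mondegE (m : 'X_{1..n}) : mondeg p m =
  \pi_(degree_group p)%qT ([ffun i => (m i)%:Z], 0) :> degree_group p.
Proof.
pose h := \pi_(degree_group p)%qT : {additive pre_group n -> degree_group p}.
rewrite /mondeg (eq_bigr (fun i => h (preX i *+ m i))) => [|i _]; last by rewrite raddfMn.
rewrite -raddf_sum; congr (h _); rewrite [LHS]surjective_pairing; congr pair.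
  rewrite raddf_sum /=; apply/ffunP => j; rewrite sum_ffunE ffunE (bigD1 j) //=.
  rewrite big1 => [|i ij]; rewrite raddfMn /= ffunMnE ffunE ?eqxx ?addr0 ?natz //.
  by rewrite eq_sym (negPf ij) mul0rn.
by rewrite raddf_sum big1 // => i _; rewrite raddfMn /= mul0rn.
Qed.

Lemma omegaE k : omega p *+ k =
  \pi_(degree_group p)%qT ([ffun=> - k%:Z], k%:Z) :> degree_group p.
Proof.
pose h := \pi_(degree_group p)%qT : {additive pre_group n -> degree_group p}.
transitivity (h ((prec n - \sum_i preX i) *+ k)).
  by rewrite raddfMn raddfB raddf_sum.
congr (h _); rewrite [LHS]surjective_pairing; congr pair.
  rewrite raddfMn raddfB raddf_sum /=; apply/ffunP => j.
  rewrite ffunMnE sub0r !ffunE sum_ffunE (bigD1 j) //= big1 => [|i ij]; last first.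
    by rewrite ffunE eq_sym (negPf ij).
  by rewrite ffunE eqxx addr0 mulr1n mulNrn natz.
rewrite raddfMn raddfB raddf_sum /= big1 ?subr0 ?natz //.
Qed.

(** Moving the X_i part of k omega to the left, the equation reads: the sum of (m_i + k) X_i equals
    k c. The [t i] count the relations p_i X_i = c that are used. *)
Lemma mondeg_omegaP (m : 'X_{1..n}) k : mondeg p m = omega p *+ k <->
  exists t : 'I_n -> int, (forall i, (m i)%:Z + k%:Z = (p i)%:Z * t i) /\ \sum_i t i = k%:Z.
Proof.
have relE (a : 'I_n -> int) : \sum_i (preX i *+ p i - prec n) *~ a i =
    ([ffun i => (p i)%:Z * a i], - \sum_i a i).
  rewrite [LHS]surjective_pairing; congr pair.
    rewrite raddf_sum; apply/ffunP => j; rewrite sum_ffunE ffunE (bigD1 j) //=.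
    have E i : ((preX i *+ p i - prec n) *~ a i).1 = [ffun j => (j == i)%:R] *+ p i *~ a i.
      by rewrite raddfMz raddfB raddfMn /= subr0.
    rewrite big1 => [|i ij]; rewrite E ffunMzE ffunMnE ffunE.
      by rewrite eqxx addr0 natz mulrzz.
    by rewrite eq_sym (negPf ij) mul0rn mul0rz.
  rewrite raddf_sum /= -sumrN; apply: eq_bigr => i _.
  by rewrite raddfMz raddfB raddfMn /= mul0rn sub0r mulrzz mulN1r.
rewrite mondegE omegaE; split.
  move/eqP; rewrite -Quotient.idealrBE => /asboolP [a]; rewrite relE => -[] /ffunP E1 E2.
  exists a; split=> [i|]; first by have := E1 i; rewrite !ffunE opprK.
  by move: E2; rewrite sub0r => /oppr_inj ->.
move=> [t [E1 E2]]; apply/eqP; rewrite -Quotient.idealrBE; apply/asboolP; exists t.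
rewrite relE; congr pair; last by rewrite /= E2 sub0r.
by apply/ffunP => i; rewrite !ffunE opprK E1.
Qed.

(** If k omega = 0 with k > 0, then k = p_i t_i for all i with the [t i] summing to k, so the 1/p_i
    would sum to 1. *)
Lemma mondeg0 k : mondeg p 0%MM = omega p *+ k -> k = 0%N.
Proof.
move=> /mondeg_omegaP [t [tE ts]]; apply/eqP; apply: contraT => k0.
have := sig_lt1 p; have -> : \sum_i ((p i)%:R)^-1 = 1 :> rat; last by rewrite ltxx.
have kQ : k%:R != 0 :> rat by rewrite pnatr_eq0.
apply: (mulfI kQ); rewrite mulr1 mulr_sumr.
have -> : k%:R = (k%:Z)%:~R :> rat by rewrite pmulrn.
rewrite -[in RHS]ts rmorph_sum; apply: eq_bigr => i _ /=.
have pQ : (p i)%:R != 0 :> rat by rewrite pnatr_eq0 -lt0n sig_gt0.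
apply: (mulIf pQ); rewrite mulfVK //.
have := tE i; rewrite mnm0E add0r => ->.
by rewrite rmorphM mulrC.
Qed.

Lemma mondeg_eq0 (m : 'X_{1..n}) : mondeg p m = 0 -> m = 0%MM.
Proof.
rewrite -(mulr0n (omega p)) => /mondeg_omegaP [t [tE ts]].
have t0 i : 0 <= t i.
  have := tE i; rewrite addr0 => E; have : 0 <= (p i)%:Z * t i by rewrite -E.
  by rewrite pmulr_rge0 // ltz_nat sig_gt0.
apply/mnmP => i; rewrite mnm0E; apply/eqP; rewrite -eqz_nat.
have := tE i; rewrite addr0 => ->; have /eqP := ts; rewrite psumr_eq0 //.
by move=> /allP /(_ i); rewrite mem_index_enum => /(_ isT)/eqP ->; rewrite mulr0.
Qed.

End SignatureFacts.

Section CanonicalRingFacts.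

Variables (F : numFieldType) (n : nat) (p : signature n).
Local Notation S := {mpoly F[n]}.
Local Notation f := (fermat_poly F p).
Local Notation T := (fermat_ring F p).
Local Notation R := (canonical_ring F p).

Lemma to_fermat_eq0 (g : S) : to_fermat p g = 0 <-> exists u, g = u * f.
Proof.
rewrite /to_fermat -(rmorph0 (to_fermat p)); split.
  by move/eqP; rewrite -Quotient.idealrBE subr0 => /asboolP.
by move=> H; apply/eqP; rewrite -Quotient.idealrBE subr0; apply/asboolP.
Qed.

Lemma to_fermat_surj (t : T) : exists g, t = to_fermat p g.
Proof. by exists (repr t); rewrite /to_fermat reprK. Qed.

Lemma fermat_mderiv i : f^`M(i) = (p i)%:R *: 'X_i ^+ (p i).-1.
Proof.
rewrite raddf_sum /= (bigD1 i) //= big1 => [|j ji].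
  rewrite addr0 !mpolyXn mderivX mulmnE mnm1E eqxx mul1n; congr (_ *: 'X_[_]).
  apply/mnmP => j; rewrite mnmBE !mulmnE mnm1E; case: (i == j); rewrite ?mul1n ?mul0n //.
  by rewrite subn1.
by rewrite mpolyXn mderivX mulmnE mnm1E (negPf ji) mul0n scale0r.
Qed.

Lemma fermat_meval (x : 'I_n -> F) : f.@[x] = \sum_i x i ^+ p i.
Proof. by rewrite raddf_sum /=; apply: eq_bigr => i _; rewrite rmorphXn /= mevalXU. Qed.

Lemma fermat_mderiv_meval i (x : 'I_n -> F) :
  (f^`M(i)).@[x] = (p i)%:R * x i ^+ (p i).-1.
Proof. by rewrite fermat_mderiv mevalZ rmorphXn /= mevalXU. Qed.

Lemma fermat_neq0 : (0 < n)%N -> f != 0.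
Proof.
move=> n0; apply/eqP => /(congr1 (fun g => (g^`M(Ordinal n0)).@[fun=> 1])).
rewrite fermat_mderiv_meval mderiv0 meval0 expr1n mulr1 => /eqP.
by rewrite pnatr_eq0 -leqn0 leqNgt sig_gt0.
Qed.

Lemma fermat_coef0 : f@_0 = 0.
Proof.
rewrite raddf_sum /= big1 // => i _; rewrite mpolyXn mcoeffX.
case: eqP => // /mnmP /(_ i); rewrite mulmnE mnm1E eqxx mul1n mnm0E => pi0.
by have := sig_gt0 p i; rewrite pi0.
Qed.

Definition in_canonical (m : 'X_{1..n}) := exists k, mondeg p m = omega p *+ k.

Definition canonical_poly (g : S) := forall m, m \in msupp g -> in_canonical m.

Lemma canonical_polyD g h : canonical_poly g -> canonical_poly h -> canonical_poly (g + h).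
Proof.
by move=> gM hM m /msuppD_le; rewrite mem_cat => /orP [/gM|/hM].
Qed.

Lemma canonical_polyZ c g : canonical_poly g -> canonical_poly (c *: g).
Proof. by move=> gM m /msuppZ_le /gM. Qed.

Lemma canonical_poly0 : canonical_poly 0.
Proof. by move=> m; rewrite msupp0. Qed.

Lemma canonical_polyX m : in_canonical m -> canonical_poly 'X_[m].
Proof. by move=> mM m'; rewrite msuppX inE => /eqP ->. Qed.

Lemma canonical_polyC c : canonical_poly c%:MP.
Proof.
move=> m; rewrite msuppC; case: eqP => // _; rewrite inE => /eqP ->.
by exists 0%N; rewrite mulr0n /mondeg big1 // => i _; rewrite mnm0E mulr0n.
Qed.

Lemma can_predP t : t \in can_pred F p <-> exists2 g, canonical_poly g & t = to_fermat p g.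
Proof.
split=> [/asboolP [N [r [rP ->]]]|[g gM ->]].
  elim/big_ind: _ => [|_ _ [g gM ->] [h hM ->]|k _].
  - by exists 0; rewrite ?rmorph0 //; apply: canonical_poly0.
  - by exists (g + h); rewrite ?rmorphD //; apply: canonical_polyD.
  - have /asboolP [g [gk ->]] := rP k; exists g => // m /gk E; by exists k.
rewrite [g]mpolyE rmorph_sum big_seq_cond; apply: rpred_sum => m; rewrite andbT => mg.
have [k mk] := gM m mg; apply: (@can_part_sub F n p k); apply/asboolP.
by exists (g@_m *: 'X_[m]); split=> // m' /msuppZ_le; rewrite msuppX inE => /eqP ->.
Qed.

Lemma canonical_lift (x : R) : exists2 g, canonical_poly g & val x = to_fermat p g.
Proof. by apply/can_predP; exact: (valP x). Qed.

Lemma canonical_elt g : canonical_poly g -> exists x : R, val x = to_fermat p g.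
Proof.
move=> gM; have tP : to_fermat p g \in can_pred F p by apply/can_predP; exists g.
by exists (Sub (to_fermat p g) tP); rewrite SubK.
Qed.

(** Degree 0 contains only constants and the monomial 1 has degree k omega only for k = 0, so
    positive degree amounts to a lift without constant term. *)
Lemma canonical_maxP (x : R) : x \in canonical_max F p <->
  exists g, [/\ canonical_poly g, g@_0 = 0 & val x = to_fermat p g].
Proof.
split=> [/asboolP [N [r [rP E]]]|[g [gM g0 E]]].
  suff [g [gM g0 gE]] : exists g, [/\ canonical_poly g, g@_0 = 0 &
      \sum_(1 <= k < N) r k = to_fermat p g].
    by exists g; split=> //; rewrite -gE.
  clear E; rewrite big_seq_cond; elim/big_ind: _ => [|_ _ [g [gM g0 ->]] [h [hM h0 ->]]|k].
  - by exists 0; rewrite mcoeff0 rmorph0; split=> //; apply: canonical_poly0.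
  - by exists (g + h); rewrite mcoeffD g0 h0 addr0 rmorphD; split=> //; apply: canonical_polyD.
  - rewrite mem_index_iota andbT => /andP [k0 _].
    have /asboolP [g [gk ->]] := rP k; exists g; split=> // [m /gk mk|]; first by exists k.
    apply/eqP; rewrite mcoeff_eq0; apply/negP => /gk/mondeg0 kE.
    by rewrite kE in k0.
have kof (m : 'X_{1..n}) : exists k, m \in msupp g -> mondeg p m = omega p *+ k.
  by have [/gM [k kE]|_] := boolP (m \in msupp g); [exists k|exists 0%N].
have [kf kfE] := choice kof.
have kf0 m : m \in msupp g -> (0 < kf m)%N.
  move=> mg; rewrite lt0n; apply/eqP => k0; have := kfE m mg; rewrite k0 mulr0n.
  by move/mondeg_eq0 => m0; move: mg; rewrite m0 mcoeff_msupp g0 eqxx.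
pose N := (\max_(m <- msupp g) kf m).+1.
apply/asboolP; exists N, (fun k => to_fermat p
  (\sum_(m <- msupp g) (if kf m == k then g@_m *: 'X_[m] else 0))).
split.
  move=> k; rewrite rmorph_sum big_seq_cond; apply: rpred_sum => m.
  rewrite andbT => mg; case: eqP => [kE|_]; last by rewrite rmorph0 rpred0.
  apply/asboolP; exists (g@_m *: 'X_[m]); split=> // m' /msuppZ_le.
  by rewrite msuppX inE => /eqP ->; rewrite kfE // kE.
rewrite E -rmorph_sum; congr (to_fermat p _); rewrite exchange_big /= [LHS]mpolyE.
rewrite big_seq_cond [RHS]big_seq_cond; apply: eq_bigr => m; rewrite andbT => mg.
have mN : kf m \in index_iota 1 N.
  by rewrite mem_index_iota kf0 // ltnS leq_bigmax_seq.
rewrite (bigD1_seq (kf m)) ?iota_uniq //= eqxx big1 ?addr0 // => k /negPf.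
by rewrite eq_sym => ->.
Qed.

Definition canonical_const (a : F) : R := a *: (1 : R).

Lemma val_canonical_const a : val (canonical_const a) = to_fermat p a%:MP.
Proof. by rewrite [LHS](_ : _ = a *: (1 : T)) // [LHS]mulr1. Qed.

Lemma canonical_const_zmod_morphism : zmod_morphism canonical_const.
Proof. by move=> a b; rewrite /canonical_const scalerBl. Qed.
Lemma canonical_const_monoid_morphism : monoid_morphism canonical_const.
Proof.
split=> [|a b]; first by rewrite /canonical_const scale1r.
apply: val_inj; rewrite [RHS](_ : _ = val (canonical_const a) * val (canonical_const b)) //.
by rewrite !val_canonical_const mpolyCM rmorphM.
Qed.
HB.instance Definition _ := GRing.isZmodMorphism.Build F R canonical_const
  canonical_const_zmod_morphism.
HB.instance Definition _ := GRing.isMonoidMorphism.Build F R canonical_const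
  canonical_const_monoid_morphism.

Lemma canonical_chain_bound d (Q : 'I_d.+1 -> prime_idealr R) :
  (0 < n)%N -> strict_chain Q -> (d < n)%N.
Proof.
move=> n0 Qlt; rewrite -[d]addn0.
apply: (@chain_bound F n R T canonical_const val (to_fermat p) f d Q 0 (fun=> 0)) => //.
- by move=> a b ab; apply: (@val_inj _ _ R).
- exact: to_fermat_surj.
- exact: val_canonical_const.
- exact: fermat_neq0.
- exact: to_fermat_eq0.
move=> q qQ; have qE : q = (q@_0)%:MP by apply: mderiv0_const => -[].
apply/eqP; apply: contraTT qQ => q0; rewrite qE mmapC; apply/negP.
move=> /(idealMr (canonical_const (q@_0)^-1)).
rewrite -rmorphM mulVf ?rmorph1 ?idealr1 //.
by apply: contraNneq q0 => c0; rewrite qE c0 mpolyC0.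
Qed.

End CanonicalRingFacts.

(** * Integral weights of the variables and of omega *)

Section Weights.

Variables (n : nat) (p : signature n).

Definition sig_prod := (\prod_i p i)%N.
Definition sig_weight i := (\prod_(j | j != i) p j)%N.
(* The degree of omega when X_i has degree [sig_weight i] and c has degree [sig_prod]. *)
Definition omega_weight := (sig_prod - \sum_i sig_weight i)%N.

Local Notation P := sig_prod.
Local Notation q := sig_weight.
Local Notation w := omega_weight.

Lemma sig_prodE i : P = (p i * q i)%N.
Proof. by rewrite /P (bigD1 i). Qed.

Lemma sig_prod_gt0 : (0 < P)%N.
Proof. by apply: prodn_gt0 => i; apply: sig_gt0. Qed.

Lemma sum_inv_sig : \sum_i ((p i)%:R)^-1 = (\sum_i q i)%:R / P%:R :> rat.
Proof.
rewrite natr_sum mulr_suml; apply: eq_bigr => i _.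
have qQ : (q i)%:R != 0 :> rat.
  by rewrite pnatr_eq0 -lt0n; apply: prodn_cond_gt0 => j _; apply: sig_gt0.
by rewrite (sig_prodE i) natrM invfM mulrCA mulfV ?mulr1.
Qed.

Lemma sum_weight_lt : (\sum_i q i < P)%N.
Proof.
have := sig_lt1 p; rewrite sum_inv_sig ltr_pdivrMr ?ltr0n ?sig_prod_gt0 //.
by rewrite mul1r ltr_nat.
Qed.

Lemma omega_weight_gt0 : (0 < w)%N.
Proof. by rewrite subn_gt0 sum_weight_lt. Qed.

Lemma omega_weightE : (w + \sum_i q i = P)%N.
Proof. by rewrite subnK // ltnW // sum_weight_lt. Qed.

Lemma omega_weight_eq1 :
  (\sum_i ((p i)%:R)^-1 + (\prod_i (p i)%:R)^-1 = 1 :> rat) <-> w = 1%N.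
Proof.
have PQ : P%:R != 0 :> rat by rewrite pnatr_eq0 -lt0n sig_prod_gt0.
rewrite sum_inv_sig -natr_prod -/P -[X in _ + X]mul1r -mulrDl.
split=> [E|w1].
  have /eqP : (\sum_i q i)%:R + 1 = P%:R :> rat by rewrite -[LHS](divfK PQ) E mul1r.
  rewrite -(natrD _ _ 1) eqr_nat -omega_weightE addnC eqn_add2r.
  by move/eqP.
by rewrite -(natrD _ _ 1) addn1 -add1n -w1 omega_weightE divff.
Qed.

(** Apply the homomorphism with X_i to q_i, c to P, omega to w. *)
Lemma weight_mondeg (m : 'X_{1..n}) k :
  mondeg p m = omega p *+ k -> (\sum_i q i * m i = k * w)%N.
Proof.
move=> /mondeg_omegaP [t [tE ts]].
have E : (\sum_i q i * m i + k * \sum_i q i = k * P)%N.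
  rewrite big_distrr -big_split /=; apply/eqP; rewrite -eqz_nat; apply/eqP.
  rewrite (big_morph Posz PoszD (erefl _)) PoszM -[in RHS]ts mulr_suml; apply: eq_bigr => i _.
  by rewrite [(k * _)%N]mulnC -mulnDr PoszM PoszD tE (sig_prodE i) PoszM; ring.
by apply/eqP; rewrite -(eqn_add2r (k * \sum_i q i)) E -mulnDr omega_weightE.
Qed.

Definition pairwise_coprime := forall i j, i != j -> coprime (p i) (p j).

(** A common factor of two of the p_i divides P and every q_k, hence w. *)
Lemma pairwise_coprime_of_weight1 : w = 1%N -> pairwise_coprime.
Proof.
move=> w1 i j ij; set d := gcdn (p i) (p j).
have dq k : (d %| q k)%N.
  have [ki|ki] := eqVneq k i.
    rewrite /q (bigD1 j) ?dvdn_mulr ?dvdn_gcdr // ki eq_sym //.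
  by rewrite /q (bigD1 i) ?dvdn_mulr ?dvdn_gcdl // eq_sym.
have dP : (d %| P)%N by rewrite (sig_prodE i) dvdn_mulr ?dvdn_gcdl.
have : (d %| 1)%N.
  rewrite -w1 -(dvdn_addl _ (_ : d %| \sum_i q i)%N) ?omega_weightE //.
  by apply: dvdn_sum => k _; apply: dq.
by rewrite dvdn1.
Qed.

Section Coprime.
Hypothesis cop : pairwise_coprime.

Lemma coprime_sig_weight i : coprime (p i) (q i).
Proof.
rewrite /q; elim/big_ind: _ => [|x y cx cy|j ji]; first exact: coprimen1.
  by rewrite coprimeMr cx.
by apply: cop; rewrite eq_sym.
Qed.

Lemma coprime_omega_sig i : coprime w (p i).
Proof.
rewrite /coprime -dvdn1; set d := gcdn w (p i).
have dp : (d %| p i)%N by apply: dvdn_gcdr.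
have dq : (d %| q i)%N.
  have : (d %| w + \sum_i q i)%N by rewrite omega_weightE (sig_prodE i) dvdn_mulr.
  rewrite dvdn_addr ?dvdn_gcdl // (bigD1 i) //= dvdn_addl //.
  apply: dvdn_sum => k ki.
  by rewrite /q (bigD1 i) ?dvdn_mulr // eq_sym.
by have /eqP <- := coprime_sig_weight i; rewrite dvdn_gcd dp dq.
Qed.

Lemma coprime_omega_weight i : coprime w (q i).
Proof.
rewrite /q; elim/big_ind: _ => [|x y cx cy|j _]; first exact: coprimen1.
  by rewrite coprimeMr cx.
exact: coprime_omega_sig.
Qed.

(** With k the weight divided by w, the sum of q_i (m_i + k) is k P. Each p_i divides k P and all
    q_j with j different from i, so by coprimality it divides m_i + k; the quotients are the
    required [t i]. *)
Lemma in_canonicalP (m : 'X_{1..n}) : (w %| \sum_i q i * m i)%N -> in_canonical p m.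
Proof.
move=> /dvdnP [k E]; exists k; apply/mondeg_omegaP.
have sumE : (\sum_i q i * (m i + k) = k * P)%N.
  rewrite (eq_bigr (fun i => q i * m i + q i * k)%N) => [|i _]; last by rewrite mulnDr.
  by rewrite big_split /= E -big_distrl /= [(_ * k)%N]mulnC -mulnDr omega_weightE.
have pdvd i : (p i %| m i + k)%N.
  rewrite -(@Gauss_dvdr _ (q i)) ?coprime_sig_weight //.
  have : (p i %| \sum_i q i * (m i + k))%N.
    by rewrite sumE (sig_prodE i) dvdn_mull // dvdn_mulr.
  rewrite (bigD1 i) //= dvdn_addl //.
  apply: dvdn_sum => j ji.
  by rewrite dvdn_mulr // /q (bigD1 i) ?dvdn_mulr // eq_sym.
exists (fun i => ((m i + k) %/ p i)%N%:Z); split=> [i|].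
  by rewrite -PoszM mulnC divnK // PoszD.
rewrite -(big_morph Posz PoszD (erefl _)); congr Posz.
apply/eqP; rewrite -(eqn_pmul2r sig_prod_gt0) -sumE big_distrl /=; apply/eqP.
apply: eq_bigr => i _; rewrite (sig_prodE i) mulnA divnK // mulnC //.
Qed.

End Coprime.

End Weights.

(** * Point derivations as a test for regularity *)

Section PointDerivations.

Variables (F : numFieldType) (n : nat) (p : signature n).
Local Notation S := {mpoly F[n]}.
Local Notation f := (fermat_poly F p).
Local Notation R := (canonical_ring F p).

Variable x : 'I_n -> F.
Hypothesis fx : f.@[x] = 0.

Lemma to_fermat_meval g h : to_fermat p g = to_fermat p h -> g.@[x] = h.@[x].
Proof.
move=> E; have /to_fermat_eq0 [u uE] : to_fermat p (g - h) = 0 by rewrite rmorphB /= E subrr.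
by rewrite -(subrK h g) uE mevalD mevalM fx mulr0 add0r.
Qed.

Definition is_point_prime (P : prime_idealr R) :=
  forall (y : R) g, val y = to_fermat p g -> (y \in P) <-> g.@[x] = 0.

Lemma point_prime : exists P : prime_idealr R, is_point_prime P.
Proof.
pose I (y : R) := exists2 g, val y = to_fermat p g & g.@[x] = 0.
have IE (y : R) g : val y = to_fermat p g -> I y -> g.@[x] = 0.
  by move=> yE [h hE h0]; rewrite -h0; apply: to_fermat_meval; rewrite -yE -hE.
have [|||||P PE] := @prime_idealr_of R I.
- by exists 0; rewrite ?rmorph0 ?meval0.
- move=> y z [g gE g0] [h hE h0]; exists (g + h); last by rewrite mevalD g0 h0 addr0.
  by rewrite !rmorphD /= gE hE.
- move=> a y [g gE g0]; have [h _ hE] := canonical_lift a.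
  by exists (h * g); rewrite ?mevalM ?g0 ?mulr0 // !rmorphM /= gE hE.
- move=> /(IE 1 1); rewrite !rmorph1 => /(_ erefl)/eqP; by rewrite oner_eq0.
- move=> y z; have [g _ gE] := canonical_lift y; have [h _ hE] := canonical_lift z.
  move=> /(IE _ (g * h)); rewrite !rmorphM /= gE hE => /(_ erefl)/eqP.
  by rewrite mulf_eq0 => /orP [] /eqP E; [left; exists g|right; exists h].
exists P => y g gE; split=> [/PE/(IE _ _ gE) //|g0]; apply/PE; by exists g.
Qed.

(* The cotangent space of the regular local ring at x has dimension less than   *)
(* n, hence the linear relation; v accounts for the values of the point         *)
(* derivations on the multiples of f, which vanish in the ring.                 *)
Lemma regular_point_derivations (P : prime_idealr R) t
    (lam : 'I_t -> S -> F) (v : 'I_t -> F) :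
  (0 < n)%N -> is_point_prime P -> regular_at P ->
  (forall i g h, lam i (g + h) = lam i g + lam i h) ->
  (forall i g h, canonical_poly p g -> canonical_poly p h ->
     lam i (g * h) = g.@[x] * lam i h + lam i g * h.@[x]) ->
  (forall i h, lam i (h * f) = h.@[x] * v i) ->
  (n < t)%N \/ (n <= t)%N /\ (forall i, v i = 0) ->
  exists a : 'I_t -> F, (exists i, a i != 0) /\
    forall g, canonical_poly p g -> g.@[x] = 0 -> \sum_i a i * lam i g = 0.
Proof.
move=> n0 PE /regular_at_elim [d [b [[Q [_ /(canonical_chain_bound n0) dn]] bP span]]].
move=> lamD lamM lamf tn.
have lift (y : R) : exists g, canonical_poly p g /\ val y = to_fermat p g.
  by have [g] := canonical_lift y; exists g.
have [beta betaP] := choice (fun k => lift (b k)).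
have [a [a0 [ab av]]] : exists a : 'I_t -> F, (exists i, a i != 0) /\
    (forall k, \sum_i a i * lam i (beta k) = 0) /\ \sum_i a i * v i = 0.
  case: tn => [nt|[nt v0]].
    have [|a [a0 aM]] := @wide_matrix_kernel F 'I_t (option 'I_d)
      (fun i k => if k is Some k' then lam i (beta k') else v i).
      by rewrite card_option !card_ord; apply: leq_ltn_trans nt.
    by exists a; split=> //; split=> [k|]; [apply: (aM (Some k))|apply: (aM None)].
  have [|a [a0 aM]] := @wide_matrix_kernel F 'I_t 'I_d (fun i k => lam i (beta k)).
    by rewrite !card_ord; apply: leq_trans nt.
  by exists a; split=> //; split=> //; rewrite big1 // => i _; rewrite v0 mulr0.
exists a; split=> // g gM gx.
pose L h := \sum_i a i * lam i h.
have LD h h' : L (h + h') = L h + L h'.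
  by rewrite -big_split; apply: eq_bigr => i _ /=; rewrite lamD mulrDr.
have L0 : L 0 = 0 by apply: (@addrI _ (L 0)); rewrite -LD !addr0.
have Lsum k (h : 'I_k -> S) : L (\sum_i h i) = \sum_i L (h i) by apply: (big_morph L LD L0).
have LM h h' : canonical_poly p h -> canonical_poly p h' ->
    L (h * h') = h.@[x] * L h' + L h * h'.@[x].
  move=> hM hM'; rewrite /L mulr_sumr mulr_suml -big_split; apply: eq_bigr => i _ /=.
  by rewrite lamM //; ring.
(* Multiples of [f] need separate treatment: the cofactor [h] that appears when lifting from the
   ring need not be canonical, so [LM] does not apply. *)
have Lf h : L (h * f) = 0.
  transitivity (h.@[x] * \sum_i a i * v i); last by rewrite av mulr0.
  by rewrite /L [RHS]mulr_sumr; apply: eq_bigr => i _; rewrite lamf; ring.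
have [y yE] := canonical_elt gM.
have /span [s sP [c]] : y \in P by apply/(PE y g yE).
move=> /sq_idealP [l [u [z [uzP E]]]].
have [sg [sgM sgE]] := lift s.
have [ga gaP] := choice (fun k => lift (c k)).
have [mu muP] := choice (fun k => lift (u k)); have [nu nuP] := choice (fun k => lift (z k)).
have betax k : (beta k).@[x] = 0 by apply/(PE (b k) (beta k)) => //; have [] := betaP k.
have mux k : (mu k).@[x] = 0.
  by have [uP _] := uzP k; apply/(PE (u k) (mu k)) => //; have [] := muP k.
have nux k : (nu k).@[x] = 0.
  by have [_ zP] := uzP k; apply/(PE (z k) (nu k)) => //; have [] := nuP k.
have sgx : sg.@[x] != 0 by apply: contra sP => /eqP; apply: (PE s sg sgE).2.
have /to_fermat_eq0 [h hE] : to_fermat p (sg * g -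
    (\sum_k ga k * beta k + \sum_k mu k * nu k)) = 0.
  rewrite rmorphB rmorphD !rmorph_sum rmorphM /= -yE -sgE; apply/eqP; rewrite subr_eq0.
  have := congr1 val E; rewrite rmorphB rmorphM !rmorph_sum /= => /(canRL (subrK _)) ->.
  rewrite addrC; apply/eqP; congr (_ + _); apply: eq_bigr => k _.
    by rewrite !rmorphM /= (gaP k).2 (betaP k).2.
  by rewrite !rmorphM /= (muP k).2 (nuP k).2.
move/(canRL (subrK _)): hE => /(congr1 L).
rewrite !LD !Lsum Lf (LM _ _ sgM gM) gx mulr0 addr0 add0r.
have -> : \sum_k L (ga k * beta k) = 0.
  rewrite big1 // => k _; rewrite (LM _ _ (gaP k).1 (betaP k).1) betax mulr0 addr0.
  by rewrite /L ab mulr0.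
have -> : \sum_k L (mu k * nu k) = 0.
  by rewrite big1 // => k _; rewrite (LM _ _ (muP k).1 (nuP k).1) mux nux mul0r mulr0 addr0.
by rewrite addr0 => /eqP; rewrite mulf_eq0 (negPf sgx) => /eqP.
Qed.

End PointDerivations.

(** * The case of a common factor *)

Section CanonicalExponents.

Variables (n : nat) (p : signature n).

(* The exponent of X_i3 absorbs the balance of degrees; the witness is          *)
(* k = N sig_prod - u for N large.                                              *)
Lemma in_canonical_extend i3 (a : 'I_n -> nat) u :
  (forall j, j != i3 -> a j = u %[mod p j]) ->
  exists m, in_canonical p m /\ forall j, j != i3 -> m j = a j.
Proof.
move=> au; pose z j : int := (a j %/ p j)%N%:Z - (u %/ p j)%N%:Z.
have zE j : j != i3 -> (a j)%:Z = u%:Z + (p j)%:Z * z j.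
  move=> /au E; rewrite {1}(divn_eq (a j) (p j)) {1}(divn_eq u (p j)) E /z !PoszD !PoszM.
  by move: (a j %/ p j)%N (u %/ p j)%N => s t; ring.
have za j : z j <= (a j)%:Z.
  have H : ((a j %/ p j) <= a j)%N by apply: leq_div.
  by rewrite /z; move: (a j %/ p j)%N (u %/ p j)%N H => s t H; lia.
pose N := (u + \sum_(j | j != i3) a j)%N; pose P := sig_prod p.
pose q := sig_weight p; pose w := omega_weight p.
have NP : (u <= N * P)%N.
  by rewrite (leq_trans (leq_addr (\sum_(j | j != i3) a j) u)) // leq_pmulr // sig_prod_gt0.
pose Z := \sum_(j | j != i3) z j.
pose r : int := (p i3)%:Z * ((N * w)%N%:Z - u%:Z - Z) + u%:Z.
have r0 : 0 <= r.
  rewrite addr_ge0 // mulr_ge0 // subr_ge0.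
  have ZN : Z <= (\sum_(j | j != i3) a j)%N%:Z.
    by rewrite (big_morph Posz PoszD (erefl _)); apply: ler_sum => j _.
  have wN : (N <= N * w)%N by rewrite leq_pmulr // omega_weight_gt0.
  by move: ZN wN; rewrite {1 2}/N; lia.
have [m3 m3E] : exists m3 : nat, r = m3%:Z by exists `|r|%N; rewrite gez0_abs.
exists [multinom (if j == i3 then m3 else a j) | j < n]; split; last first.
  by move=> j ji; rewrite mnmE (negPf ji).
exists (N * P - u)%N; apply/mondeg_omegaP.
have kE : (N * P - u)%N%:Z = N%:Z * P%:Z - u%:Z by rewrite -subzn // PoszM.
pose tt j : int := if j == i3 then N%:Z * (q i3)%:Z + ((N * w)%N%:Z - u%:Z - Z)
                   else z j + N%:Z * (q j)%:Z.
exists tt; split=> [j|].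
  rewrite mnmE kE /tt [P](sig_prodE p j) PoszM; case: eqP => [->|/eqP ji].
    by rewrite -m3E /r /q; ring.
  by rewrite (zE j ji) /q; ring.
rewrite (bigD1 i3) //= {1}/tt eqxx.
rewrite (eq_bigr (fun j => z j + N%:Z * (q j)%:Z)) => [|j ji]; last by rewrite /tt (negPf ji).
rewrite big_split /= -mulr_sumr -/Z kE.
have -> : P%:Z = w%:Z + (q i3)%:Z + \sum_(j | j != i3) (q j)%:Z.
  rewrite /P -(omega_weightE p) PoszD -addrA; congr (_ + _).
  by rewrite (bigD1 i3) //= PoszD (big_morph Posz PoszD (erefl _)).
by rewrite PoszM; ring.
Qed.

(** In L one has P omega = P c - sum of q_i p_i X_i = w c, which is also the degree of X_j to the
    power w p_j. *)
Lemma in_canonical_var j : exists2 N, (0 < N)%N & in_canonical p (U_(j) *+ N)%MM.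
Proof.
exists (omega_weight p * p j)%N; first by rewrite muln_gt0 omega_weight_gt0 sig_gt0.
exists (sig_prod p); apply/mondeg_omegaP.
exists (fun i => (sig_weight p i)%:Z + (if i == j then (omega_weight p)%:Z else 0)).
split=> [i|].
  rewrite mulmnE mnm1E (sig_prodE p i) eq_sym; case: eqP => [->|_].
    by rewrite mul1n !PoszM; ring.
  by rewrite mul0n PoszM; ring.
rewrite big_split /= -(big_morph Posz PoszD (erefl _)) -big_mkcond big_pred1_eq.
by rewrite addrC -PoszD omega_weightE.
Qed.

End CanonicalExponents.

Section NonCoprime.

Variables (F : numFieldType) (n : nat) (p : signature n).
Local Notation S := {mpoly F[n]}.
Local Notation f := (fermat_poly F p).
Local Notation R := (canonical_ring F p).

Variables (x : 'I_n -> F) (i1 i2 i3 : 'I_n).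
Hypotheses (fx : f.@[x] = 0) (x0 : forall j, (x j == 0) = (j == i1) || (j == i2)).
Hypotheses (i12 : i1 != i2) (i31 : i3 != i1) (i32 : i3 != i2).

Local Notation g := (gcdn (p i1) (p i2)).
Hypothesis g1 : (1 < g)%N.

Definition balanced (m : 'X_{1..n}) := m i1 = m i2 %[mod g].

(** Both exponents are congruent to -k modulo [g]. *)
Lemma in_canonical_balanced m : in_canonical p m -> balanced m.
Proof.
move=> [k /mondeg_omegaP [t [tE _]]].
have H i : (g %| p i)%N -> (g %| m i + k)%N.
  move=> gi; have := tE i; rewrite -PoszD => E.
  by rewrite -[(m i + k)%N]/(`|(m i + k)%N%:Z|%N) E abszM dvdn_mulr.
apply/eqP; rewrite -(eqn_modDr k).
have /eqP := H i1 (dvdn_gcdl _ _); have /eqP := H i2 (dvdn_gcdr _ _).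
by rewrite /dvdn => -> ->.
Qed.

(* Restriction of G to the line through x in the direction of the indicator     *)
(* function of D.                                                               *)
Definition line_restr (D : {set 'I_n}) (G : S) : {poly F} :=
  mmap (@polyC F) (fun j => (x j)%:P + (j \in D)%:R *: 'X) G.

HB.instance Definition _ D := GRing.RMorphism.copy (line_restr D)
  (mmap (@polyC F) (fun j => (x j)%:P + (j \in D)%:R *: 'X)).

Lemma line_restr_coef0 D G : (line_restr D G)`_0 = G.@[x].
Proof.
rewrite -horner_coef0 -/(horner_eval 0 _) /line_restr rmorph_mmap /meval; congr mmap.
  by apply: funext => c; rewrite /= /horner_eval hornerC.
by apply: funext => j; rewrite /= /horner_eval hornerD hornerC hornerZ hornerX mulr0 addr0.
Qed.

Lemma line_restrZ D c G : line_restr D (c *: G) = c%:P * line_restr D G.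
Proof. by rewrite /line_restr mmapZ. Qed.

Lemma line_restrX D (m : 'X_{1..n}) : line_restr D 'X_[m] =
  \prod_j ((x j)%:P + (j \in D)%:R *: 'X) ^+ m j.
Proof. by rewrite /line_restr mmapX. Qed.

Lemma line_restrX0 (D : {set 'I_n}) (m : 'X_{1..n}) b : x b = 0 -> b \notin D -> (0 < m b)%N -> line_restr D 'X_[m] = 0.
Proof.
move=> xb bD mb; rewrite line_restrX (bigD1 b) //= xb (negPf bD) scale0r addr0.
by rewrite expr0n eqn0Ngt mb mul0r.
Qed.

Lemma line_restrX_zeros (D : {set 'I_n}) (m : 'X_{1..n}) : D \subset [set i1; i2] ->
  line_restr D 'X_[m] = (\prod_(j | j \notin D) x j ^+ m j)%:P * 'X^(\sum_(j in D) m j).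
Proof.
move=> DS; rewrite line_restrX (bigID (mem D)) /= mulrC; congr (_ * _).
  rewrite rmorph_prod; apply: eq_bigr => j /negPf ->.
  by rewrite scale0r addr0 rmorphXn.
rewrite -prodrXr; apply: eq_bigr => j jD; rewrite jD scale1r.
have /subsetP /(_ j jD) := DS; rewrite !inE -x0 => /eqP ->.
by rewrite add0r.
Qed.

(* The stabilizer of x acts on the two directions i1 and i2 by inverse g-th    *)
(* roots of unity, so the invariants have the three transversal coordinates     *)
(* X_i1^g, X_i2^g and X_i1 X_i2; the last one is read off the diagonal line,    *)
(* which is given the index [ord_max].                                          *)
Definition line_dir (i : 'I_n.+1) : {set 'I_n} :=
  if unlift ord_max i is Some j then [set j] else [set i1; i2].

Definition line_order (i : 'I_n.+1) : nat :=
  if unlift ord_max i is Some j then (if j \in [set i1; i2] then g else 1) else 2.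

Lemma line_order_gt0 i : (0 < line_order i)%N.
Proof.
by rewrite /line_order; case: unlift => // j; case: ifP => // _; apply: ltnW.
Qed.

(** Along the line of i1, a monomial survives only without X_i2, and then [g] divides its exponent
    of X_i1; symmetrically for i2. On the diagonal, order 1 would need exponents 1 and 0, which are
    not balanced. *)
Lemma line_restrX_low i m k : balanced m -> (0 < k < line_order i)%N ->
  (line_restr (line_dir i) 'X_[m])`_k = 0.
Proof.
have one a b : x b = 0 -> b != a -> a \in [set i1; i2] -> m a = m b %[mod g] ->
    (0 < k < g)%N -> (line_restr [set a] 'X_[m])`_k = 0.
  move=> xb ba aS mab kg; have [mb|mb] := posnP (m b); last first.
    by rewrite (line_restrX0 xb) ?coef0 // inE.
  rewrite line_restrX_zeros ?sub1set // big_set1 coefCM coefXn.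
  case: eqP => [E|]; rewrite ?mulr0 //.
  move: mab; rewrite mb mod0n -E modn_small; last by case/andP: kg.
  by move=> k0; rewrite k0 in kg.
rewrite /balanced /line_dir /line_order => bal; case: unliftP => [j _|_].
  case: ifP => [jS|_]; last by move=> {one}; case: k => [|[]].
  move: (jS); rewrite !inE => /orP [] /eqP E; rewrite E in jS *.
    by apply: (one _ i2) => //; [apply/eqP; rewrite x0 eqxx orbT|rewrite eq_sym].
  by apply: (one _ i1) => //; apply/eqP; rewrite x0 eqxx.
clear one; case: k => [|[|k]] // _; rewrite line_restrX_zeros // coefCM coefXn.
rewrite big_setU1 ?big_set1 ?inE //=; case: eqP => [E|]; rewrite ?mulr0 //.
move: bal; case: (m i1) (m i2) E => [|[|a]] [|[|b]] //= _; rewrite ?mod0n modn_small //.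
Qed.

Lemma line_restr_low i G k : (forall m, m \in msupp G -> balanced m) ->
  (0 < k < line_order i)%N -> (line_restr (line_dir i) G)`_k = 0.
Proof.
move=> Gb kd; rewrite [G]mpolyE rmorph_sum coef_sum big_seq_cond big1 // => m.
by rewrite andbT => /Gb mb; rewrite /= line_restrZ coefCM line_restrX_low ?mulr0.
Qed.

Definition line_der i G := (line_restr (line_dir i) G)`_(line_order i).

(** The orders strictly between 0 and [line_order i] vanish for [G], so only the two extreme terms
    of the product remain. Balance of one factor suffices, so the rule also covers arbitrary
    multiples of [f]. *)
Lemma line_derM i G H : (forall m, m \in msupp G -> balanced m) ->
  line_der i (H * G) = H.@[x] * line_der i G + line_der i H * G.@[x].
Proof.
move=> Gb; have low k := @line_restr_low i G k Gb; move: low.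
rewrite /line_der rmorphM coefM -(line_restr_coef0 (line_dir i) H).
rewrite -(line_restr_coef0 (line_dir i) G).
have := line_order_gt0 i; case: (line_order i) => // o _ low.
rewrite big_ord_recl big_ord_recr /= subn0 subnn big1 ?add0r // => k _.
by rewrite low ?mulr0 // /bump /= add1n subSS subn_gt0 ltn_ord ltnS leq_subr.
Qed.

Lemma line_derD i G H : line_der i (G + H) = line_der i G + line_der i H.
Proof. by rewrite /line_der rmorphD coefD. Qed.

Lemma line_derC i c : line_der i c%:MP = 0.
Proof.
rewrite /line_der [line_restr _ _]mmapC coefC.
by have := line_order_gt0 i; case: line_order.
Qed.

Lemma fermat_balanced m : m \in msupp f -> balanced m.
Proof.
move=> /msupp_sum_le /flatten_mapP [j _]; rewrite mpolyXn msuppX inE => /eqP ->.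
have H i : (g %| p i)%N -> ((j == i) * p j)%N = 0 %[mod g].
  by move=> gi; case: eqP => [->|_]; rewrite ?mul1n ?mul0n // mod0n; apply/eqP.
by rewrite /balanced !mulmnE !mnm1E !H ?dvdn_gcdl ?dvdn_gcdr.
Qed.

Lemma prod_x_neq0 (m : 'X_{1..n}) (D : {set 'I_n}) :
  (forall j, j \notin D -> x j = 0 -> m j = 0%N) -> \prod_(j | j \notin D) x j ^+ m j != 0.
Proof.
move=> H; apply/prodf_neq0 => j jD; rewrite expf_eq0 negb_and.
have [xj|] := eqVneq (x j) 0; last by rewrite orbT.
by rewrite (H j jD xj).
Qed.

(** There are n + 1 point derivations, too many for a regular point, so they would satisfy a linear
    relation. Testing it on suitable invariant monomials shows that all its coefficients vanish. *)
Lemma noncoprime_not_regular (P : prime_idealr R) :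
  is_point_prime x P -> ~ regular_at P.
Proof.
move=> PE Preg; have n0 : (0 < n)%N by apply: leq_trans (ltn_ord i1).
have xi1 : x i1 = 0 by apply/eqP; rewrite x0 eqxx.
have xi2 : x i2 = 0 by apply/eqP; rewrite x0 eqxx orbT.
have [|||a [[i ai] aE]] := regular_point_derivations (lam := line_der)
    (v := fun i => line_der i f) n0 PE Preg line_derD.
- move=> i G H GM HM; apply: line_derM => m /HM; exact: in_canonical_balanced.
- by move=> i h; rewrite line_derM ?fx ?mulr0 ?addr0 //; apply: fermat_balanced.
- by left.
pose e (j : 'I_n) := lift (@ord_max n) j.
have dirE j : line_dir (e j) = [set j] by rewrite /line_dir liftK.
have dirM : line_dir ord_max = [set i1; i2] by rewrite /line_dir unlift_none.
have ordE j : line_order (e j) = if j \in [set i1; i2] then g else 1.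
  by rewrite /line_order liftK.
have ordM : line_order ord_max = 2 by rewrite /line_order unlift_none.
have ext (b c u : nat) : b = u %[mod p i1] -> c = u %[mod p i2] ->
    exists m, [/\ in_canonical p m, m i1 = b & m i2 = c].
  move=> bu cu; pose am j := if j == i1 then b else if j == i2 then c else u.
  have [|m [mM mE]] := @in_canonical_extend n p i3 am u.
    by move=> j _; rewrite /am; case: eqP => [->|_] //; case: eqP => [->|].
  exists m; rewrite !mE /am ?eqxx; [|by rewrite eq_sym|by rewrite eq_sym].
  by rewrite eq_sym (negPf i12).
have X_meval (m : 'X_{1..n}) b : x b = 0 -> (0 < m b)%N -> ('X_[m] : S).@[x] = 0.
  move=> xb mb; rewrite mevalX (bigD1 b) //= xb expr0n eqn0Ngt mb mul0r //.
have der0 (m : 'X_{1..n}) (j b : 'I_n) : x b = 0 -> b != j -> (0 < m b)%N -> line_der (e j) 'X_[m] = 0.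
  by move=> xb bj mb; rewrite /line_der dirE (line_restrX0 xb) ?coef0 // inE.
(* The diagonal coefficient is settled first, with exponents 1 and 1: if [g] is 2, the diagonal line
   also detects the squares of X_i1 and X_i2 used afterwards. *)
have aM : a ord_max = 0.
  have [m [mM m1 m2]] := ext 1 1 1 erefl erefl.
  have /aE : canonical_poly p ('X_[m] : S) by apply: canonical_polyX.
  rewrite (X_meval m i1) ?m1 // => /(_ erefl).
  rewrite (bigD1 ord_max) //= big1 ?addr0 => [/eqP|k]; last first.
    have [j ->|->] := unliftP ord_max k; last by rewrite eqxx.
    have [ji|ji] := eqVneq j i1; last by rewrite (der0 _ _ i1) ?m1 ?mulr0 // eq_sym.
    by rewrite (der0 _ _ i2) ?m2 ?mulr0 // ji eq_sym.
  rewrite /line_der dirM ordM line_restrX_zeros // coefCM coefXn.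
  rewrite big_setU1 ?big_set1 ?inE //= m1 m2 mulr1 mulf_eq0 => /orP [/eqP //|].
  rewrite (negPf (prod_x_neq0 _)) // => j; rewrite !inE => /norP [j1 j2] /eqP.
  by rewrite x0 (negPf j1) (negPf j2).
have az b c u k : k = i1 \/ k = i2 -> b = u %[mod p i1] -> c = u %[mod p i2] ->
    (if k == i1 then b else c) = g -> (if k == i1 then c else b) = 0%N -> a (e k) = 0.
  move=> kS bu cu bg c0; have [m [mM m1 m2]] := ext b c u bu cu.
  have mk : m k = g by case: kS => E; move: bg; rewrite E ?eqxx ?m1 // eq_sym (negPf i12) m2.
  have mo j : x j = 0 -> j != k -> m j = 0%N.
    move=> /eqP; rewrite x0 => /orP [] /eqP ->; rewrite ?m1 ?m2.
      move=> ik; move: c0; rewrite eq_sym (negPf ik) //.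
    case: kS => kE ik; last by rewrite kE eqxx in ik.
    by move: c0; rewrite kE eqxx.
  have xk : x k = 0 by case: kS => ->.
  have /aE : canonical_poly p ('X_[m] : S) by apply: canonical_polyX.
  rewrite (X_meval m k) ?mk ?(ltnW g1) // => /(_ erefl).
  rewrite (bigD1 (e k)) //= big1 ?addr0 => [/eqP|l]; last first.
    have [j ->|->] := unliftP ord_max l; last by rewrite aM mul0r.
    rewrite (inj_eq lift_inj) => jk.
    by rewrite (der0 _ _ k) ?mk ?(ltnW g1) ?mulr0 // eq_sym.
  have kS' : k \in [set i1; i2] by rewrite !inE; case: kS => ->; rewrite eqxx ?orbT.
  rewrite /line_der dirE ordE kS' line_restrX_zeros ?sub1set // coefCM coefXn.
  rewrite big_set1 mk eqxx mulr1 mulf_eq0 => /orP [/eqP //|].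
  rewrite (negPf (prod_x_neq0 _)) // => j; rewrite inE => jk xj; exact: mo.
have bez (k l : 'I_n) : exists u, gcdn (p k) (p l) = u %[mod p k] /\ 0 = u %[mod p l].
  have [b _ bE] := Bezoutl (p l) (sig_gt0 p k).
  exists (b * p l * (p k).-1)%N; split; last by rewrite mod0n mulnAC modnMl.
  apply/eqP; rewrite eq_sym -(eqn_modDr (b * p l)) -mulnSr prednK ?sig_gt0 //.
  by rewrite modnMl eq_sym; apply: bE.
have ai1 : a (e i1) = 0.
  have [u [u1 u2]] := bez i1 i2.
  by apply: (az g 0%N u i1); rewrite ?eqxx //; left.
have ai2 : a (e i2) = 0.
  have [u [u1 u2]] := bez i2 i1; rewrite gcdnC in u1.
  by apply: (az 0%N g u i2); rewrite ?[i2 == i1]eq_sym ?(negPf i12) //; right.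
have aj j : a (e j) = 0.
  have [->//|j1] := eqVneq j i1; have [->//|j2] := eqVneq j i2.
  have [N N0 NM] := in_canonical_var p j.
  have /aE : canonical_poly p ('X_[U_(j) *+ N] - (x j ^+ N)%:MP : S).
    apply: canonical_polyD; first exact: canonical_polyX.
    by rewrite -mpolyCN; apply: canonical_polyC.
  rewrite mevalB mevalC -mpolyXn rmorphXn /= mevalXU subrr => /(_ erefl).
  have der l : line_der l ('X_j ^+ N - (x j ^+ N)%:MP) = line_der l ('X_j ^+ N).
    by rewrite -mpolyCN line_derD line_derC addr0.
  rewrite (bigD1 (e j)) //= big1 ?addr0 => [/eqP|l]; last first.
    have [k ->|->] := unliftP ord_max l; last by rewrite aM mul0r.
    rewrite (inj_eq lift_inj) => jk; rewrite der /line_der rmorphXn /=.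
    rewrite [line_restr _ _]mmapX mmap1U dirE inE eq_sym (negPf jk) scale0r addr0.
    rewrite -rmorphXn coefC; have := line_order_gt0 (e k).
    by case: (line_order (e k)) => // o _; rewrite mulr0.
  rewrite der /line_der ordE !inE (negPf j1) (negPf j2) /= rmorphXn /=.
  rewrite [line_restr _ _]mmapX mmap1U dirE inE eqxx scale1r.
  have -> : (((x j)%:P + 'X) ^+ N)`_1 = N%:R * x j ^+ N.-1.
    rewrite -[LHS]mulr1n -coef_deriv deriv_exp derivD derivC derivX add0r mul1r.
    rewrite coefMn -horner_coef0 horner_exp hornerD hornerC hornerX addr0.
    by rewrite mulr_natl.
  rewrite !mulf_eq0 pnatr_eq0 eqn0Ngt N0 /= expf_eq0 x0 (negPf j1) (negPf j2) andbF orbF.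
  by move/eqP.
move: ai; have [j ->|->] := unliftP ord_max i; last by rewrite aM eqxx.
by rewrite aj eqxx.
Qed.

End NonCoprime.

(** * Ideals of maximal minors *)

Lemma mul_col_rowE (A : comNzRingType) m n (C : 'cV[A]_m) (b : 'rV_n) i k :
  (C *m b) i k = C i 0 * b 0 k.
Proof. by rewrite mxE big_ord1. Qed.

Section SplittingFromRegularSequence.

Variables (A : comNzRingType) (n : nat) (J : 'M[A]_(n, n + 1)).

(** The signed maximal minors of [J]: the appended unit row selects the minor without column [i]. *)
Definition minor_col : 'cV[A]_(n + 1) := \col_i \det (col_mx J (delta_mx 0 i)).

Local Notation Delta := minor_col.

Section OneElement.
Variables (x : A) (Ax : 'M[A]_(n + 1, n)).
Hypothesis JAx : J *m Ax = x%:M.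
Hypothesis regx : forall a, x * a = 0 -> a = 0.

Lemma regular_exp k a : x ^+ k * a = 0 -> a = 0.
Proof. by elim: k => [|k IH]; rewrite ?expr0 ?mul1r // exprS -mulrA => /regx. Qed.

(** Multiplying [J], extended by the unit row, with the block matrix (Ax, v) gives a block
    triangular matrix with diagonal blocks x I and v_i. *)
Lemma minor_col_kernel (v : 'cV_(n + 1)) i : J *m v = 0 ->
  x ^+ n * v i 0 = Delta i 0 * \det (row_mx Ax v).
Proof.
move=> Jv; rewrite mxE -det_mulmx mul_col_row JAx Jv det_lblock det_scalar det_mx11.
congr (_ * _); rewrite mxE (bigD1 i) //= mxE !eqxx mul1r big1 ?addr0 // => j ji.
by rewrite mxE (negPf ji) andbF mul0r.
Qed.

(* x I - Ax J has its columns in the kernel of J and trace x.                   *)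
Lemma kernel_regular c : (forall (v : 'cV_(n + 1)) i, J *m v = 0 -> c * (x ^+ n * v i 0) = 0) -> c = 0.
Proof.
move=> H; pose E : 'M_(n + 1) := x%:M - Ax *m J.
have JE : J *m E = 0 by rewrite mulmxBr mulmxA JAx mul_mx_scalar mul_scalar_mx subrr.
have trE : \tr E = x.
  by rewrite raddfB /= mxtrace_scalar mxtrace_mulC JAx mxtrace_scalar -mulrnBr ?leq_addr // addKn.
have E0 : c * (x ^+ n * \tr E) = 0.
  rewrite /mxtrace !mulr_sumr big1 // => i _.
  have Ji : J *m col i E = 0 by rewrite colE mulmxA JE mul0mx.
  by have := H _ i Ji; rewrite mxE.
apply: regx; apply: (@regular_exp n); rewrite -[RHS]E0 trE; ring.
Qed.

Lemma minor_col_regular c : (forall i, c * Delta i 0 = 0) -> c = 0.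
Proof.
move=> H; apply: kernel_regular => v i Jv.
by rewrite minor_col_kernel // mulrA H mul0r.
Qed.

(** For v in the kernel, multiplying Delta by det (Ax, v) turns it into x^n v, which [J] kills;
    [kernel_regular] then removes the factor. *)
Lemma mul_minor_col : J *m Delta = 0.
Proof.
apply/colP => k; rewrite [RHS]mxE; apply: kernel_regular => v i Jv.
rewrite minor_col_kernel // mulrCA [X in _ * X](_ : _ = 0) ?mulr0 //.
rewrite mxE mulr_suml.
transitivity (\sum_j J k j * (x ^+ n * v j 0)).
  by apply: eq_bigr => j _; rewrite minor_col_kernel // mulrA.
have /colP /(_ k) := Jv; rewrite !mxE => E.
transitivity (x ^+ n * \sum_j J k j * v j 0); last by rewrite E mulr0.
by rewrite mulr_sumr; apply: eq_bigr => j _; ring.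
Qed.

End OneElement.

Variables (x y z : A) (Ax Ay Az : 'M[A]_(n + 1, n)).
Hypotheses (JAx : J *m Ax = x%:M) (JAy : J *m Ay = y%:M) (JAz : J *m Az = z%:M).
Hypothesis regx : forall a, x * a = 0 -> a = 0.
Hypothesis regxy : forall a b, x * a = y * b -> exists c, b = x * c.
Hypothesis regxyn : forall a b, x ^+ n * a = y ^+ n * b -> exists c, b = x ^+ n * c.
Hypothesis regxyz : forall a b c, x * a + y * b + z * c = 0 -> exists u v, c = x * u + y * v.

(** The formulas for x and y give x^n det (Ay, v) = y^n det (Ax, v) after cancelling the minors;
    hence x^n divides det (Ax, v), and the quotient is t. *)
Lemma kernel_minor_col (v : 'cV_(n + 1)) : J *m v = 0 -> exists t, v = t *: Delta.
Proof.
move=> Jv; have [t tE] : exists t, \det (row_mx Ax v) = x ^+ n * t.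
  apply: (regxyn (a := \det (row_mx Ay v))).
  apply/eqP; rewrite -subr_eq0; apply/eqP; apply: (minor_col_regular JAx regx) => i.
  have ex := minor_col_kernel JAx i Jv; have ey := minor_col_kernel JAy i Jv.
  transitivity (x ^+ n * (Delta i 0 * \det (row_mx Ay v))
    - y ^+ n * (Delta i 0 * \det (row_mx Ax v))); first by ring.
  rewrite -ex -ey; ring.
exists t; apply/colP => i; rewrite [RHS]mxE; apply/eqP; rewrite -subr_eq0; apply/eqP.
apply: (regular_exp regx (k := n)); rewrite mulrBr (minor_col_kernel JAx) // tE; ring.
Qed.

Lemma kernel_minor_mx (V : 'M_(n + 1, n)) : J *m V = 0 ->
  exists b : 'rV_n, V = Delta *m b.
Proof.
move=> JV; have H k : exists t, col k V = t *: Delta.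
  by apply: kernel_minor_col; rewrite colE mulmxA JV mul0mx.
have [t tE] := choice H; exists (\row_k t k); apply/matrixP => i k.
by have /colP /(_ i) := tE k; rewrite !mxE big_ord1 !mxE mulrC => ->.
Qed.

(* The commutators s At - t As of the contractions of J lie in its rank one     *)
(* kernel; exactness of the Koszul complex of (x, y, z) makes them coboundaries *)
(* and corrects Ax to a matrix divisible by x.                                  *)
Lemma split_of_regular_sequence : exists D, J *m D = 1%:M.
Proof.
have cross (s t : A) (As At : 'M_(n + 1, n)) : J *m As = s%:M -> J *m At = t%:M ->
    exists b : 'rV_n, s *: At - t *: As = Delta *m b.
  move=> JAs JAt; apply: kernel_minor_mx.
  by rewrite mulmxBr -!scalemxAr JAs JAt !scale_scalar_mx mulrC subrr.
have [b1 E1] := cross _ _ _ _ JAx JAy; have [b2 E2] := cross _ _ _ _ JAy JAz.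
have [b3 E3] := cross _ _ _ _ JAz JAx.
have H k : exists uv, b1 0 k = x * uv.1 + y * uv.2.
  (* The cyclic sum x (y Az - z Ay) + y (z Ax - x Az) + z (x Ay - y Ax) vanishes identically, and
     Delta can be cancelled from it. *)
  suff : x * b2 0 k + y * b3 0 k + z * b1 0 k = 0.
    by move=> /regxyz [u [v E]]; exists (u, v).
  apply: (minor_col_regular JAx regx) => i.
  have entry (V : 'M_(n + 1, n)) b : V = Delta *m b -> V i k = Delta i 0 * b 0 k.
    by move=> ->; rewrite mul_col_rowE.
  have := entry _ _ E1; have := entry _ _ E2; have := entry _ _ E3.
  move: (Delta i 0) => dl; rewrite !mxE => e3 e2 e1.
  transitivity (x * (dl * b2 0 k) + y * (dl * b3 0 k) + z * (dl * b1 0 k)); first by ring.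
  rewrite -e1 -e2 -e3; ring.
have [uv uvE] := choice H.
pose v : 'rV_n := \row_k (uv k).2; pose u : 'rV_n := \row_k (uv k).1.
(* With b1 = x u + y v, the first commutator relation becomes x (Ay - Delta u) = y (Ax + Delta v),
   so x divides Ax + Delta v. The quotient splits [J] because J Delta = 0. *)
have HD i : exists r : 'I_n -> A, forall k, (Ax + Delta *m v) i k = x * r k.
  suff Hk k : exists c, (Ax + Delta *m v) i k = x * c.
    by have [r rE] := choice Hk; exists r.
  apply: (regxy (a := (Ay - Delta *m u) i k)).
  have eu : (Ay - Delta *m u) i k = Ay i k - Delta i 0 * (uv k).1.
    by rewrite mxE [X in _ + X]mxE mul_col_rowE [u _ _]mxE.
  have ev : (Ax + Delta *m v) i k = Ax i k + Delta i 0 * (uv k).2.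
    by rewrite mxE mul_col_rowE [v _ _]mxE.
  have e1 : x * Ay i k - y * Ax i k = Delta i 0 * (x * (uv k).1 + y * (uv k).2).
    by rewrite -uvE -mul_col_rowE -E1 !mxE.
  rewrite eu ev; apply/eqP; rewrite -subr_eq0; apply/eqP.
  move: (Delta i 0) e1 => dl e1.
  transitivity (x * Ay i k - y * Ax i k - dl * (x * (uv k).1 + y * (uv k).2)); first by ring.
  by rewrite e1 subrr.
have [D DE] := choice HD.
exists (\matrix_(i, k) D i k); apply/matrixP => k l.
apply/eqP; rewrite -subr_eq0; apply/eqP; apply: regx; rewrite mulrBr.
have xD : x *: (\matrix_(i, k) D i k) = Ax + Delta *m v.
  by apply/matrixP => i j; rewrite [LHS]mxE [X in _ * X]mxE -DE.
have -> : x * (J *m \matrix_(i, k) D i k) k l = (J *m (Ax + Delta *m v)) k l.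
  by rewrite -xD -scalemxAr [RHS]mxE.
rewrite mulmxDr mulmxA (mul_minor_col JAx regx) mul0mx addr0 JAx !mxE.
by rewrite mulr_natr subrr.
Qed.

End SplittingFromRegularSequence.

(** * The pairwise coprime case *)

Section MonomialIdeals.

Variables (F : numFieldType) (n : nat).
Local Notation S := {mpoly F[n]}.

(** Membership in the ideal generated by the [N]-th powers of the variables in [I], tested monomial
    by monomial. *)
Definition monomial_ideal (I : {set 'I_n}) (N : nat) (g : S) :=
  forall m, m \in msupp g -> exists2 i, i \in I & (N <= m i)%N.

Lemma monomial_idealD I N g h :
  monomial_ideal I N g -> monomial_ideal I N h -> monomial_ideal I N (g + h).
Proof. by move=> gI hI m /msuppD_le; rewrite mem_cat => /orP [/gI|/hI]. Qed.

Lemma monomial_idealM (I : {set 'I_n}) N i g : i \in I -> monomial_ideal I N ('X_i ^+ N * g).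
Proof.
move=> iI m; rewrite mpolyXn => /msuppM_le /allpairsP [[a b] /= [aX _ ->]].
move: aX; rewrite msuppX inE => /eqP ->; exists i => //.
by rewrite mnmDE mulmnE mnm1E eqxx mul1n leq_addr.
Qed.

Lemma monomial_ideal_set0 N g : monomial_ideal set0 N g -> g = 0.
Proof.
move=> gI; apply/mpolyP => m; rewrite mcoeff0; apply/eqP; rewrite mcoeff_eq0.
apply/negP => mg; case: (gI m mg) => i; by rewrite inE.
Qed.

Lemma monomial_ideal_split I N i g : monomial_ideal (i |: I) N g ->
  exists a b, g = 'X_i ^+ N * a + b /\ monomial_ideal I N b.
Proof.
move=> gI.
exists (\sum_(m <- msupp g | (N <= m i)%N) g@_m *: 'X_[m - (U_(i) *+ N)]).
exists (\sum_(m <- msupp g | ~~ (N <= m i)%N) g@_m *: 'X_[m]); split.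
  rewrite {1}[g]mpolyE (bigID (fun m : 'X_{1..n} => (N <= m i)%N)) /=; congr (_ + _).
  rewrite mulr_sumr; apply: eq_bigr => m Nm; rewrite -scalerAr mpolyXn -mpolyXD addmC submK //.
  apply/mnm_lepP => j; rewrite mulmnE mnm1E; case: eqP => [<-|_]; by rewrite ?mul1n ?mul0n.
move=> m; rewrite mcoeff_msupp raddf_sum /=.
have [mg|mg] := boolP ((m \in msupp g) && ~~ (N <= m i)%N).
  case/andP: mg => /gI [j]; rewrite !inE => /orP [/eqP -> ->|jI Nj _ _] //.
  by exists j.
rewrite big_seq_cond big1 ?eqxx // => k /andP [kg Nk]; rewrite mcoeffZ mcoeffX.
case: eqP => [E|]; rewrite ?mulr0 //.
by move: mg; rewrite -E kg Nk.
Qed.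

Lemma monomial_ideal_cancel (I : {set 'I_n}) N j g : j \notin I ->
  monomial_ideal I N ('X_j ^+ N * g) -> monomial_ideal I N g.
Proof.
move=> jI H m mg; have [|i iI] := H (m + U_(j) *+ N)%MM.
  by rewrite mpolyXn mulrC mcoeff_msupp addmC mcoeffMX -mcoeff_msupp.
rewrite mnmDE mulmnE mnm1E; have [E|ne] := eqVneq j i; first by rewrite E iI in jI.
by rewrite mul0n addn0 => Nm; exists i.
Qed.

End MonomialIdeals.

Section FermatRegularSequence.

Variables (F : numFieldType) (n : nat) (p : signature n).
Local Notation S := {mpoly F[n]}.
Local Notation f := (fermat_poly F p).
Local Notation T := (fermat_ring F p).

(* f is monic in X_i4, a variable foreign to I: compare the top coefficients.   *)
Lemma fermat_monomial_regular (I : {set 'I_n}) N i4 h : i4 \notin I ->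
  monomial_ideal I N (h * f) -> monomial_ideal I N h.
Proof.
move=> i4I hf.
pose bad (m : 'X_{1..n}) := (m \in msupp h) && [forall i in I, (m i < N)%N].
suff nobad m : ~~ bad m.
  move=> m mh; apply: contrapT => H; case/negP: (nobad m); rewrite /bad mh /=.
  apply/forall_inP => i iI; rewrite ltnNge; apply/negP => Nm; apply: H; by exists i.
apply/negP => mbad.
have ex : exists k, has (fun m => bad m && (m i4 == k)) (msupp h).
  exists (m i4); apply/hasP; exists m; rewrite ?mbad ?eqxx //.
  by case/andP: mbad.
have bound k : has (fun m => bad m && (m i4 == k)) (msupp h) -> (k <= \max_(m <- msupp h) m i4)%N.
  by move=> /hasP [m' m'h /andP [_ /eqP <-]]; apply: leq_bigmax_seq.
case: (ex_maxnP ex bound) => k /hasP [m0 m0h /andP [m0b /eqP m0k]] maxk.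
have m0I i : i \in I -> (m0 i < N)%N by case/andP: m0b => _ /forall_inP H /H.
(* [m0] has the largest exponent of X_i4 among the monomials of [h] outside the ideal; any other
   contribution to [m1] would come from such a monomial with a larger one. *)
pose m1 := (m0 + U_(i4) *+ p i4)%MM.
have m1i i : i != i4 -> m1 i = m0 i.
  by move=> ii4; rewrite mnmDE mulmnE mnm1E eq_sym (negPf ii4) mul0n addn0.
have coef1 : (h * f)@_m1 = h@_m0.
  rewrite mulr_sumr raddf_sum /= (bigD1 i4) //= big1 ?addr0.
    by rewrite mpolyXn /m1 addmC mcoeffMX.
  move=> j ji4; apply/eqP; rewrite mcoeff_eq0; apply/negP.
  rewrite mpolyXn => /msuppM_le /allpairsP [[a b] /= [ah]].
  rewrite msuppX inE => /eqP -> E.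
  have m1E i : (m1 i = a i + (j == i) * p j)%N by rewrite E mnmDE mulmnE mnm1E.
  have ai4 : a i4 = (k + p i4)%N.
    have := m1E i4; rewrite (negPf ji4) mul0n addn0 => <-.
    by rewrite /m1 mnmDE mulmnE mnm1E eqxx mul1n m0k.
  have : (a i4 <= k)%N.
    apply: maxk; apply/hasP; exists a; rewrite // eqxx andbT /bad ah /=.
    apply/forall_inP => i iI; have ii4 : i != i4 by apply: contraNneq i4I => <-.
    apply: leq_ltn_trans (m0I i iI); rewrite -(m1i i ii4) m1E leq_addr //.
  by rewrite ai4 -[X in (_ <= X)%N]addn0 leq_add2l leqNgt sig_gt0.
have [|i iI] := hf m1.
  by rewrite mcoeff_msupp coef1 -mcoeff_msupp.
rewrite m1i; last by apply: contraNneq i4I => <-.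
by rewrite leqNgt m0I.
Qed.

Variables (i1 i2 i3 i4 : 'I_n).
Hypothesis dist : uniq [:: i1; i2; i3; i4].

Definition var_pow i N : T := to_fermat p ('X_i ^+ N).

Lemma dist_neq : [/\ i1 != i2, i1 != i3, i1 != i4, i2 != i3 & i2 != i4 /\ i3 != i4].
Proof.
move: dist; rewrite /= !inE !negb_or => /and4P [/and3P [-> -> ->] /andP [-> ->] -> _].
by [].
Qed.

(** The three regularity lemmas share one descent: a relation in T is a relation in S up to h f. As
    [f] is regular modulo the monomial ideal, h lies in that ideal, and correcting the coefficients
    by multiples of [f] leaves a relation between pure powers in S. *)
Lemma var_pow_regular1 N (a : T) : var_pow i1 N * a = 0 -> a = 0.
Proof.
have [_ _ n14 _ _] := dist_neq.
have [g ->] := to_fermat_surj a; rewrite -rmorphM => /to_fermat_eq0 [h hE].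
have : monomial_ideal [set i1] N h.
  apply: (@fermat_monomial_regular _ N i4); first by rewrite inE eq_sym.
  by rewrite -hE; apply: monomial_idealM; rewrite inE.
rewrite -[[set i1]]setU0 => /monomial_ideal_split [h1 [b [hE1 /monomial_ideal_set0 b0]]].
apply/to_fermat_eq0; exists h1; apply/eqP; rewrite -subr_eq0.
have : 'X_i1 ^+ N * (g - h1 * f) = 0.
  by rewrite mulrBr hE hE1 b0 addr0 mulrA subrr.
move/eqP; rewrite mulf_eq0 expf_eq0; case/orP => // /andP [_].
by rewrite -msize_poly_eq0 msizeX.
Qed.

Lemma var_pow_regular2 N (a b : T) : var_pow i1 N * a = var_pow i2 N * b ->
  exists c, b = var_pow i1 N * c.
Proof.
have [n12 _ n14 _ [n24 _]] := dist_neq.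
have [g ->] := to_fermat_surj a; have [k ->] := to_fermat_surj b.
move/eqP; rewrite -subr_eq0 -!rmorphM -rmorphB => /eqP/to_fermat_eq0 [h hE].
have : monomial_ideal [set i1; i2] N h.
  apply: (@fermat_monomial_regular _ N i4).
    by rewrite !inE negb_or ![i4 == _]eq_sym n14.
  rewrite -hE -mulrN; apply: monomial_idealD; apply: monomial_idealM; rewrite !inE eqxx //.
  by rewrite orbT.
rewrite -[[set i2]]setU0 => /monomial_ideal_split [h1 [h' [hE1]]].
move=> /monomial_ideal_split [h2 [b' [hE2 /monomial_ideal_set0 b0]]].
have E : 'X_i2 ^+ N * (k + h2 * f) = 'X_i1 ^+ N * (g - h1 * f).
  have : 'X_i1 ^+ N * g - 'X_i2 ^+ N * k - h * f = 0 by rewrite hE subrr.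
  rewrite hE1 hE2 b0 => E0; apply/eqP; rewrite eq_sym -subr_eq0 -[X in _ == X]E0; apply/eqP.
  ring.
have : monomial_ideal [set i1] N (k + h2 * f).
  apply: (@monomial_ideal_cancel _ _ _ _ i2); first by rewrite inE eq_sym.
  by rewrite E; apply: monomial_idealM; rewrite inE.
rewrite -[[set i1]]setU0 => /monomial_ideal_split [c [b2 [cE /monomial_ideal_set0 b20]]].
exists (to_fermat p c); rewrite -rmorphM; apply/eqP; rewrite -subr_eq0 -rmorphB.
apply/eqP/to_fermat_eq0; exists (- h2).
by rewrite mulNr -[k](addrK (h2 * f)) cE b20; ring.
Qed.

Lemma var_pow_regular3 N (a b c : T) :
  var_pow i1 N * a + var_pow i2 N * b + var_pow i3 N * c = 0 ->
  exists u v, c = var_pow i1 N * u + var_pow i2 N * v.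
Proof.
have [n12 n13 n14 n23 [n24 n34]] := dist_neq.
have [g ->] := to_fermat_surj a; have [k ->] := to_fermat_surj b.
have [l ->] := to_fermat_surj c.
rewrite -!rmorphM -!rmorphD => /to_fermat_eq0 [h hE].
have : monomial_ideal [set i1; i2; i3] N h.
  apply: (@fermat_monomial_regular _ N i4).
    by rewrite !inE !negb_or ![i4 == _]eq_sym n14 n24 n34.
  rewrite -hE; do 2?apply: monomial_idealD; apply: monomial_idealM; by rewrite !inE eqxx ?orbT.
rewrite -setUA -[[set i3]]setU0 => /monomial_ideal_split [h1 [h' [hE1]]].
move=> /monomial_ideal_split [h2 [h'' [hE2]]].
move=> /monomial_ideal_split [h3 [b' [hE3 /monomial_ideal_set0 b0]]].
have E : 'X_i3 ^+ N * (l - h3 * f) =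
    'X_i1 ^+ N * - (g - h1 * f) + 'X_i2 ^+ N * - (k - h2 * f).
  have : 'X_i1 ^+ N * g + 'X_i2 ^+ N * k + 'X_i3 ^+ N * l - h * f = 0 by rewrite hE subrr.
  rewrite hE1 hE2 hE3 b0 => E0; apply/eqP; rewrite -subr_eq0 -[X in _ == X]E0; apply/eqP.
  ring.
have : monomial_ideal [set i1; i2] N (l - h3 * f).
  apply: (@monomial_ideal_cancel _ _ _ _ i3).
    by rewrite !inE negb_or ![i3 == _]eq_sym n13.
  rewrite E; apply: monomial_idealD; apply: monomial_idealM; by rewrite !inE eqxx ?orbT.
rewrite -[[set i2]]setU0 => /monomial_ideal_split [u [b2 [uE]]].
move=> /monomial_ideal_split [v [b3 [vE /monomial_ideal_set0 b30]]].
exists (to_fermat p u), (to_fermat p v); rewrite -!rmorphM -rmorphD.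
apply/eqP; rewrite -subr_eq0 -rmorphB; apply/eqP/to_fermat_eq0; exists h3.
by rewrite -[l](subrK (h3 * f)) uE vE b30; ring.
Qed.

End FermatRegularSequence.

Section WeightComponents.

Variables (F : numFieldType) (n : nat) (q : 'I_n -> nat).
Local Notation S := {mpoly F[n]}.

Definition mweight_of (m : 'X_{1..n}) := (\sum_i q i * m i)%N.

(* The weight components are the coefficients of a ring morphism, hence their   *)
(* product formula.                                                             *)
Definition weight_map (g : S) : {poly S} :=
  mmap (polyC \o @mpolyC n F) (fun i => 'X_i *: 'X^(q i)) g.

HB.instance Definition _ := GRing.RMorphism.copy weight_map
  (mmap (polyC \o @mpolyC n F) (fun i => 'X_i *: 'X^(q i))).

Definition weight_comp (W : nat) (g : S) : S := (weight_map g)`_W.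

Lemma weight_map_monomial m : weight_map 'X_[m] = 'X_[m] *: 'X^(mweight_of m).
Proof.
rewrite /weight_map mmapX /mmap1.
transitivity (\prod_(i < n) (('X_i ^+ m i : S)%:P * 'X^(q i * m i))).
  apply: eq_bigr => i _; rewrite -mul_polyC exprMn -exprM; congr (_ * _).
  by rewrite rmorphXn.
by rewrite big_split /= prodrXr -rmorph_prod -mpolyXE_id mul_polyC.
Qed.

Lemma weight_mapZ c g : weight_map (c *: g) = c%:MP *: weight_map g.
Proof. by rewrite /weight_map mmapZ mul_polyC. Qed.

Lemma weight_compD W g h : weight_comp W (g + h) = weight_comp W g + weight_comp W h.
Proof. by rewrite /weight_comp rmorphD coefD. Qed.

Lemma weight_comp0 W : weight_comp W 0 = 0.
Proof. by rewrite /weight_comp rmorph0 coef0. Qed.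

Lemma weight_comp_sum W k (g : 'I_k -> S) :
  weight_comp W (\sum_i g i) = \sum_i weight_comp W (g i).
Proof. exact: (big_morph (weight_comp W) (weight_compD W) (weight_comp0 W)). Qed.

Lemma weight_compZ W c g : weight_comp W (c *: g) = c *: weight_comp W g.
Proof. by rewrite /weight_comp weight_mapZ coefZ mul_mpolyC. Qed.

Lemma weight_compX W m : weight_comp W 'X_[m] = if W == mweight_of m then 'X_[m] else 0.
Proof.
rewrite /weight_comp weight_map_monomial coefZ coefXn.
by case: eqP => _; rewrite ?mulr1 ?mulr0.
Qed.

Lemma weight_compM W g h : weight_comp W (g * h) =
  \sum_(i < W.+1) weight_comp i g * weight_comp (W - i) h.
Proof. by rewrite /weight_comp rmorphM coefM. Qed.

Lemma weight_comp_coef W g m :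
  (weight_comp W g)@_m = if W == mweight_of m then g@_m else 0.
Proof.
rewrite {1}[g]mpolyE (big_morph (weight_comp W) (weight_compD W) (weight_comp0 W)).
rewrite raddf_sum /=.
have [mg|mg] := boolP (m \in msupp g); last first.
  rewrite big_seq_cond big1 => [|k]; first by rewrite memN_msupp_eq0 // if_same.
  rewrite andbT => kg; rewrite weight_compZ weight_compX mcoeffZ.
  case: eqP => _; rewrite ?mcoeff0 ?mulr0 // mcoeffX; case: eqP => [E|]; rewrite ?mulr0 //.
  by rewrite -E kg in mg.
rewrite (bigD1_seq m) ?msupp_uniq //= big1 ?addr0 => [|k km].
  rewrite weight_compZ weight_compX mcoeffZ; case: eqP => _; rewrite ?mcoeff0 ?mulr0 //.
  by rewrite mcoeffX eqxx mulr1.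
rewrite weight_compZ weight_compX mcoeffZ; case: eqP => _; rewrite ?mcoeff0 ?mulr0 //.
by rewrite mcoeffX (negPf km) mulr0.
Qed.

Lemma weight_comp_supp W g m : m \in msupp (weight_comp W g) -> m \in msupp g.
Proof.
by rewrite !mcoeff_msupp weight_comp_coef; case: ifP => // _; rewrite eqxx.
Qed.

Definition weight_homog W (g : S) := forall m, m \in msupp g -> mweight_of m = W.

Lemma weight_comp_homog W g : weight_homog W (weight_comp W g).
Proof.
by move=> m; rewrite mcoeff_msupp weight_comp_coef; case: ifP => [/eqP ->|]; rewrite ?eqxx.
Qed.

Lemma weight_homog_comp W W' g : weight_homog W g ->
  weight_comp W' g = if W' == W then g else 0.
Proof.
move=> gW; apply/mpolyP => m; rewrite weight_comp_coef.
have [mg|mg] := boolP (m \in msupp g); first by rewrite (gW m mg); case: eqP; rewrite ?mcoeff0.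
by case: ifP => _; case: ifP => _; rewrite ?mcoeff0 ?memN_msupp_eq0.
Qed.

End WeightComponents.

Section CoprimeCase.

Variables (F : numFieldType) (n : nat) (p : signature n).
Local Notation S := {mpoly F[n]}.
Local Notation f := (fermat_poly F p).
Local Notation T := (fermat_ring F p).
Local Notation R := (canonical_ring F p).
Local Notation q := (sig_weight p).
Local Notation w := (omega_weight p).
Local Notation wt := (mweight_of q).
Local Notation comp := (weight_comp q).

Lemma fermat_homog : weight_homog q (sig_prod p) f.
Proof.
move=> m /msupp_sum_le /flatten_mapP [j _]; rewrite mpolyXn msuppX inE => /eqP ->.
rewrite /mweight_of (bigD1 j) //= big1 ?addn0; last first.
  by move=> i ij; rewrite mulmnE mnm1E eq_sym (negPf ij) mul0n muln0.
by rewrite mulmnE mnm1E eqxx mul1n mulnC -sig_prodE.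
Qed.

(* Lifts of the elements of the ideal m of the canonical ring.                  *)
Definition augmented (g : S) := canonical_poly p g /\ g@_0 = 0.

Lemma augmented_comp W g : augmented g -> augmented (comp W g).
Proof.
move=> [gM g0]; split; first by move=> m /weight_comp_supp/gM.
by rewrite weight_comp_coef g0 if_same.
Qed.

Lemma augmented_comp0 g : augmented g -> comp 0 g = 0.
Proof.
move=> [gM g0]; apply/mpolyP => m; rewrite weight_comp_coef mcoeff0.
case: eqP => // /esym/eqP; rewrite sum_nat_eq0 => /forallP /= H.
suff -> : m = 0%MM by [].
apply/mnmP => i; rewrite mnm0E; have := H i; rewrite muln_eq0 => /orP [|/eqP //].
rewrite eqn0Ngt (_ : 0 < q i)%N //; apply: prodn_cond_gt0 => j _; exact: sig_gt0.
Qed.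

Lemma augmentedZ c g : augmented g -> augmented (c *: g).
Proof. by move=> [gM g0]; split; [apply: canonical_polyZ|rewrite mcoeffZ g0 mulr0]. Qed.

(* Lifts of the elements of m^2.                                                *)
Definition decomposable (g : S) := exists l (u v : 'I_l -> S) h,
  (forall i, augmented (u i) /\ augmented (v i)) /\ g = \sum_i u i * v i + h * f.

Lemma decomposable0 : decomposable 0.
Proof.
exists 0%N, (fun=> 0), (fun=> 0), 0; split=> [[]//|].
by rewrite big_ord0 mul0r addr0.
Qed.

Lemma decomposableD g g' : decomposable g -> decomposable g' -> decomposable (g + g').
Proof.
move=> [l [u [v [h [uv ->]]]]] [l' [u' [v' [h' [uv' ->]]]]].
exists (l + l')%N, (fun i => match split i with inl j => u j | inr j => u' j end),
    (fun i => match split i with inl j => v j | inr j => v' j end), (h + h'); split.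
  by move=> i; case: split.
rewrite big_split_ord /= addrACA -mulrDl; congr (_ + _ + _); apply: eq_bigr => i _.
  by rewrite (unsplitK (inl i)).
by rewrite (unsplitK (inr i)).
Qed.

Lemma decomposableZ c g : decomposable g -> decomposable (c *: g).
Proof.
move=> [l [u [v [h [uv ->]]]]]; exists l, (fun i => c *: u i), v, (c *: h); split.
  by move=> i; have [ui vi] := uv i; split=> //; apply: augmentedZ.
by rewrite scalerDr scaler_sumr -scalerAl; congr (_ + _); apply: eq_bigr => i _; rewrite -scalerAl.
Qed.

Lemma decomposable_sum k (g : 'I_k -> S) :
  (forall i, decomposable (g i)) -> decomposable (\sum_i g i).
Proof.
by move=> gd; elim/big_ind: _ => //; [exact: decomposable0|exact: decomposableD].
Qed.

Lemma embedding_dim_span e : embedding_dim F p e ->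
  exists beta : 'I_e -> S, forall g, augmented g ->
    exists a : 'I_e -> F, decomposable (g - \sum_i a i *: beta i).
Proof.
move=> [b [bm span _]].
have H i : exists g, augmented g /\ val (b i) = to_fermat p g.
  by have /canonical_maxP [g [gM g0 E]] := bm i; exists g.
have [beta betaP] := choice H; exists beta => g [gM g0].
have [y yE] := canonical_elt gM.
have /span [a] : y \in canonical_max F p by apply/canonical_maxP; exists g.
move=> /asboolP [l [u [v [uvm E]]]]; exists a.
have Hu i : exists g, augmented g /\ val (u i) = to_fermat p g.
  by have [/canonical_maxP [g' [g'M g'0 E']] _] := uvm i; exists g'.
have Hv i : exists g, augmented g /\ val (v i) = to_fermat p g.
  by have [_ /canonical_maxP [g' [g'M g'0 E']]] := uvm i; exists g'.
have [u' uP] := choice Hu; have [v' vP] := choice Hv.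
have /to_fermat_eq0 [h hE] : to_fermat p (g - \sum_i a i *: beta i - \sum_i u' i * v' i) = 0.
  rewrite !rmorphB !rmorph_sum /= -yE; apply/eqP; rewrite subr_eq0; apply/eqP.
  have := congr1 val E; rewrite rmorphB !rmorph_sum /= => E'.
  transitivity (\sum_i val (u i * v i)); last first.
    by apply: eq_bigr => i _; rewrite !rmorphM /= (uP i).2 (vP i).2.
  rewrite -E'; congr (_ - _); apply: eq_bigr => i _.
  by rewrite -mul_mpolyC rmorphM /= -(betaP i).2.
exists l, u', v', h; split; first by move=> i; split; [exact: (uP i).1|exact: (vP i).1].
by rewrite -hE [RHS]addrC subrK.
Qed.

Definition indep_mod t (z : 'I_t -> S) :=
  forall a : 'I_t -> F, decomposable (\sum_i a i *: z i) -> forall i, a i = 0.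

Definition homog_family t (z : 'I_t -> S) :=
  forall i, augmented (z i) /\ exists W, weight_homog q W (z i).

(** A maximal homogeneous family independent modulo decomposables has at most [e] members, and by
    maximality it captures every homogeneous element. *)
Lemma homogeneous_generators e : embedding_dim F p e -> exists t (z : 'I_t -> S),
  [/\ (t <= e)%N, homog_family z & forall W g, augmented g -> weight_homog q W g ->
     exists a : 'I_t -> F, decomposable (g - \sum_i a i *: z i)].
Proof.
move=> /embedding_dim_span [beta span].
have bound t (z : 'I_t -> S) : homog_family z -> indep_mod z -> (t <= e)%N.
  move=> zh zi; rewrite leqNgt; apply/negP => et.
  have [A AE] := choice (fun i => span (z i) (zh i).1).
  have [|a [[i ai] aA]] := @wide_matrix_kernel F 'I_t 'I_e A; first by rewrite !card_ord.
  have /zi/(_ i)/eqP : decomposable (\sum_i a i *: z i); last by rewrite (negPf ai).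
  have -> : \sum_i a i *: z i = \sum_i a i *: (z i - \sum_k A i k *: beta k).
    rewrite [RHS](eq_bigr (fun i => a i *: z i - \sum_k (a i * A i k) *: beta k)).
      rewrite sumrB exchange_big /= [X in _ - X]big1 ?subr0 // => k _.
      by rewrite -scaler_suml aA scale0r.
    by move=> j _; rewrite scalerBr scaler_sumr; congr (_ - _); apply: eq_bigr => k _;
      rewrite scalerA.
  by apply: decomposable_sum => j; apply: decomposableZ.
pose ok t := `[< exists2 z : 'I_t -> S, homog_family z & indep_mod z >].
have ex0 : exists t, ok t.
  by exists 0%N; apply/asboolP; exists (fun=> 0) => [[]|a _ []].
have okb t : ok t -> (t <= e)%N by move=> /asboolP [z zh zi]; apply: bound zh zi.
case: (ex_maxnP ex0 okb) => t /asboolP [z zh zi] tmax.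
exists t, z; split=> // [|W g ga gW]; first exact: bound zh zi.
apply: contrapT => H; have := tmax t.+1; rewrite ltnn => H'.
suff: false by []. apply: H'; apply/asboolP; exists (snoc z g).
  by rewrite /snoc => i; case: unlift => // ; split=> //; exists W.
move=> a aD; have E : \sum_i a i *: snoc z g i =
    \sum_i a (widen_ord (leqnSn t) i) *: z i + a ord_max *: g.
  rewrite big_ord_recr /= snoc_max; congr (_ + _); apply: eq_bigr => i _.
  by rewrite snoc_widen.
rewrite E in aD.
have amax : a ord_max = 0.
  apply/eqP; apply: contraT => a0; case: H.
  exists (fun i => - (a ord_max)^-1 * a (widen_ord (leqnSn t) i)).
  have := decomposableZ (a ord_max)^-1 aD; rewrite scalerDr scalerA mulVf // scale1r addrC.
  rewrite scaler_sumr -[X in _ + X]opprK -sumrN; under eq_bigr => i _ do rewrite scalerA -scaleNr -mulNr.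
  by [].
rewrite amax scale0r addr0 in aD => i; have [j ->|->//] := unliftP ord_max i.
have := zi _ aD j; congr (a _ = 0); apply: val_inj; rewrite /= /bump leqNgt ltn_ord //.
Qed.

End CoprimeCase.

(** * The Jacobian matrix of homogeneous generators *)

Section JacobianOfGenerators.

Variables (F : numFieldType) (n : nat) (p : signature n).
Local Notation S := {mpoly F[n]}.
Local Notation f := (fermat_poly F p).
Local Notation T := (fermat_ring F p).
Local Notation q := (sig_weight p).
Local Notation w := (omega_weight p).
Local Notation comp := (weight_comp q).

Hypotheses (cop : pairwise_coprime p) (w1 : (1 < w)%N).

Definition homog_generators t (z : 'I_t -> S) :=
  homog_family p z /\ forall W g, augmented p g -> weight_homog q W g ->
     exists a : 'I_t -> F, decomposable p (g - \sum_i a i *: z i).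

Lemma augmented0 : augmented p (0 : S).
Proof. by split; [apply: canonical_poly0|rewrite mcoeff0]. Qed.

(** Zeros are added to reach exactly [n] generators, so that with df the matrix has the shape n by n
    + 1. *)
Lemma homog_generators_pad t (z : 'I_t -> S) k : (t <= k)%N -> homog_generators z ->
  exists z' : 'I_k -> S, homog_generators z'.
Proof.
move=> /subnK kE; move: (k - t)%N kE => l <- {k}; elim: l => [|l IH] zg; first by exists z.
have [z' [zh zs]] := IH zg; exists (snoc z' 0); split.
  rewrite /snoc => i; case: unlift => //; split; first exact: augmented0.
  by exists 0%N => m; rewrite msupp0.
move=> W g ga gW; have [a aD] := zs W g ga gW; exists (snoc a 0).
rewrite big_ord_recr /= !snoc_max scale0r addr0.
by under eq_bigr => i _ do rewrite !snoc_widen.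
Qed.

Variable z : 'I_n -> S.
Hypothesis zgen : homog_generators z.

Definition diff (g : S) : 'cV[T]_n := \col_i to_fermat p g^`M(i).

(** Its cokernel is the module of differentials of T relative to the subalgebra generated by [z]. *)
Definition jacobian : 'M[T]_(n, n + 1) :=
  row_mx (\matrix_(i, j) to_fermat p (z j)^`M(i)) (diff f).

Local Notation J := jacobian.

Definition in_image (v : 'cV[T]_n) := exists c, v = J *m c.

Lemma in_image0 : in_image 0.
Proof. by exists 0; rewrite mulmx0. Qed.

Lemma in_imageD u v : in_image u -> in_image v -> in_image (u + v).
Proof. by move=> [c ->] [c' ->]; exists (c + c'); rewrite mulmxDr. Qed.

Lemma in_imageZ a v : in_image v -> in_image (a *: v).
Proof. by move=> [c ->]; exists (a *: c); rewrite scalemxAr. Qed.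

Lemma in_image_sum k (v : 'I_k -> 'cV_n) :
  (forall i, in_image (v i)) -> in_image (\sum_i v i).
Proof. by move=> H; elim/big_ind: _ => //; [exact: in_image0|exact: in_imageD]. Qed.

Lemma in_image_gen j : in_image (diff (z j)).
Proof.
exists (delta_mx (lshift 1 j) 0); rewrite -colE; apply/colP => i.
by rewrite [RHS]mxE row_mxEl !mxE.
Qed.

Lemma in_image_fermat : in_image (diff f).
Proof.
exists (delta_mx (rshift n 0) 0); rewrite -colE; apply/colP => i.
by rewrite [RHS]mxE row_mxEr.
Qed.

Lemma diffD g h : diff (g + h) = diff g + diff h.
Proof. by apply/colP => i; rewrite !mxE mderivD rmorphD. Qed.

Lemma diff0 : diff 0 = 0.
Proof. by apply/colP => i; rewrite !mxE mderiv0 rmorph0. Qed.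

Lemma diff_sum k (g : 'I_k -> S) : diff (\sum_i g i) = \sum_i diff (g i).
Proof. exact: (big_morph diff diffD diff0). Qed.

Lemma diffM g h : diff (g * h) = to_fermat p g *: diff h + to_fermat p h *: diff g.
Proof.
by apply/colP => i; rewrite !mxE mderivM rmorphD !rmorphM /= addrC; congr (_ + _); rewrite mulrC.
Qed.

Lemma diffZ c g : diff (c *: g) = to_fermat p c%:MP *: diff g.
Proof. by apply/colP => i; rewrite !mxE mderivZ -mul_mpolyC rmorphM. Qed.

Lemma to_fermat_f : to_fermat p f = 0.
Proof. by apply/to_fermat_eq0; exists 1; rewrite mul1r. Qed.

(** Induction on the weight: the generators and [f] contribute columns of [J], and d(uv) = u dv + v
    du reduces products to smaller weights. *)
Lemma in_image_homog W g : augmented p g -> weight_homog q W g -> in_image (diff g).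
Proof.
elim/ltn_ind: W g => W IH g ga gW; have [zh zs] := zgen.
have [a [l [u [v [h [uv E]]]]]] := zs W g ga gW.
(* Passing to the part of weight [W] leaves only products whose factors have positive weight less
   than [W], since augmented elements have no part of weight 0. *)
have {}E : g = \sum_i a i *: comp W (z i) +
    (\sum_i comp W (u i * v i) + comp W (h * f)).
  rewrite -[LHS](_ : comp W g = g); last by rewrite (weight_homog_comp _ gW) eqxx.
  rewrite -{1}(subrK (\sum_i a i *: z i) g) E 2!weight_compD !weight_comp_sum addrC.
  by congr (_ + _); apply: eq_bigr => i _; rewrite weight_compZ.
rewrite E diffD diffD !diff_sum; apply: in_imageD; last apply: in_imageD.
- apply: in_image_sum => i; rewrite diffZ; apply: in_imageZ.
  have [_ [W' zW']] := zh i; rewrite (weight_homog_comp _ zW').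
  by case: ifP => _; [apply: in_image_gen|rewrite diff0; apply: in_image0].
- apply: in_image_sum => i; rewrite weight_compM diff_sum; apply: in_image_sum => j.
  have [ui vi] := uv i.
  have [j0|j0] := posnP j.
    by rewrite j0 (augmented_comp0 ui) mul0r diff0; apply: in_image0.
  have [jW|jW] := eqVneq (j : nat) W.
    by rewrite jW subnn (augmented_comp0 vi) mulr0 diff0; apply: in_image0.
  have jlt : (j < W)%N by rewrite ltn_neqAle jW -ltnS ltn_ord.
  rewrite diffM; apply: in_imageD; apply: in_imageZ.
    apply: (IH (W - j)%N); first by rewrite ltn_subrL j0 (leq_trans j0 (ltnW jlt)).
      exact: augmented_comp.
    exact: weight_comp_homog.
  apply: (IH j) => //; first exact: augmented_comp.
  exact: weight_comp_homog.
- have [h' ->] : exists h', comp W (h * f) = h' * f.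
    rewrite weight_compM.
    exists (\sum_(i < W.+1) (if (W - i)%N == sig_prod p then comp i h else 0)).
    rewrite mulr_suml; apply: eq_bigr => i _.
    by rewrite (weight_homog_comp _ (@fermat_homog F n p)); case: ifP => _; rewrite ?mul0r ?mulr0.
  rewrite diffM to_fermat_f scale0r addr0; apply: in_imageZ; exact: in_image_fermat.
Qed.

Lemma in_image_monomial m : (w %| mweight_of q m)%N -> m != 0%MM ->
  in_image (diff 'X_[m]).
Proof.
move=> wm m0; apply: (@in_image_homog (mweight_of q m)).
  split; first by apply: canonical_polyX; apply: in_canonicalP.
  by rewrite mcoeffX (negPf m0).
by move=> k; rewrite msuppX inE => /eqP ->.
Qed.

(** The invariant X_i0^w yields X_i0^(w-1) e_i0. For another k, choose s < w with X_i0^s X_k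
    invariant; X_i0^(w-1) times its differential, minus the component along e_i0, is X_i0^(w-1+s)
    e_k. All these exponents are below w + w. *)
Lemma in_image_var_pow i0 k : in_image (var_pow F p i0 (w + w) *: delta_mx k 0).
Proof.
have w0 : (0 < w)%N by apply: ltnW.
have diffX (m : 'X_{1..n}) i : diff 'X_[m] i 0 = to_fermat p ((m i)%:R *: 'X_[m - U_(i)]).
  by rewrite mxE mderivX.
have U0 i s : (0 < s)%N -> (U_(i) *+ s)%MM != 0%MM :> 'X_{1..n}.
  move=> s0; apply/eqP => /mnmP/(_ i); rewrite mulmnE mnm1E eqxx mul1n mnm0E => E.
  by rewrite E in s0.
have Ei0 : in_image (to_fermat p ('X_i0 ^+ w.-1) *: delta_mx i0 0).
  have : in_image (diff 'X_[U_(i0) *+ w]).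
    apply: in_image_monomial; last exact: U0.
    rewrite /mweight_of (bigD1 i0) //= big1 ?addn0; last first.
      by move=> i ii0; rewrite mulmnE mnm1E eq_sym (negPf ii0) mul0n muln0.
    by rewrite mulmnE mnm1E eqxx mul1n dvdn_mull.
  move/(in_imageZ (to_fermat p (w%:R^-1)%:MP)); congr in_image.
  apply/colP => i; rewrite [LHS]mxE [RHS]mxE diffX -rmorphM.
  rewrite mulmnE mnm1E mxE andbT; have [->|ne] := eqVneq i0 i.
    rewrite mul1n mulr1 mul_mpolyC scalerA mulVf ?scale1r ?pnatr_eq0 -?lt0n //.
    congr (to_fermat p _); rewrite mpolyXn; congr 'X_[_]; apply/mnmP => j.
    by rewrite mnmBE !mulmnE mnm1E; case: (i == j); rewrite ?mul1n ?mul0n // subn1.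
  by rewrite mul0n mulr0 scale0r mulr0 rmorph0.
have [ki|ki] := eqVneq k i0.
  rewrite ki; have := in_imageZ (to_fermat p ('X_i0 ^+ w.+1)) Ei0; congr in_image.
  rewrite scalerA -rmorphM -exprD /var_pow; congr (to_fermat p ('X_i0 ^+ _) *: _).
  by rewrite addSn -addnS prednK.
(* [q i0] is invertible modulo w, so s solves s q_i0 = - q_k there. *)
have [s [sw ws]] : exists s, (s < w)%N /\ (w %| s * q i0 + q k)%N.
  have [b _ bE] := Bezoutl (q i0) w0.
  have := coprime_omega_weight cop i0; rewrite /coprime => /eqP g1; rewrite g1 in bE.
  exists (b * q k %% w)%N; rewrite ltn_pmod //; split=> //.
  rewrite /dvdn -modnDml modnMml modnDml -/(dvdn _ _).
  have -> : (b * q k * q i0 + q k = q k * (1 + b * q i0))%N.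
    by rewrite mulnDr muln1 addnC mulnAC mulnC.
  by rewrite dvdn_mull.
pose m := (U_(i0) *+ s + U_(k))%MM.
have mE i : m i = ((i0 == i) * s + (k == i))%N by rewrite mnmDE mulmnE !mnm1E.
have Hm : in_image (diff 'X_[m]).
  apply: in_image_monomial; last first.
    by apply/eqP => /mnmP/(_ k); rewrite mE eqxx mnm0E addn1.
  rewrite /mweight_of (bigD1 i0) //= (bigD1 k) //= big1 ?addn0; last first.
    by move=> i /andP [ii0 ik]; rewrite mE ![_ == i]eq_sym (negPf ii0) (negPf ik) muln0.
  by rewrite !mE !eqxx (negPf ki) [i0 == k]eq_sym (negPf ki) mul1n addn0 mul0n add0n muln1 mulnC.
have E : diff 'X_[m] = to_fermat p ('X_i0 ^+ s) *: delta_mx k 0 +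
    to_fermat p (s%:R *: 'X_[m - U_(i0)]) *: delta_mx i0 0.
  apply/colP => i; rewrite diffX mE [RHS]mxE [X in _ = X + _]mxE [X in _ = _ + X]mxE !mxE !andbT.
  have [->|ik] := eqVneq i k.
    rewrite (negPf ki) [i0 == k]eq_sym (negPf ki) mul0n add0n mulr1 mulr0 addr0 scale1r.
    congr (to_fermat p _); rewrite mpolyXn; congr 'X_[_].
    by rewrite /m addmK.
  rewrite mulr0 add0r addn0.
  have [<-|ne] := eqVneq i i0; first by rewrite mul1n mulr1.
  by rewrite mul0n scale0r rmorph0 mulr0.
have Hk : in_image (to_fermat p ('X_i0 ^+ w.-1) *: (to_fermat p ('X_i0 ^+ s) *: delta_mx k 0)).
  have H1 := in_imageZ (to_fermat p ('X_i0 ^+ w.-1)) Hm.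
  have H2 := in_imageZ (- to_fermat p (s%:R *: 'X_[m - U_(i0)])) Ei0.
  have := in_imageD H1 H2; congr in_image.
  rewrite E scalerDr -addrA [X in _ + X](_ : _ = 0) ?addr0 //.
  by rewrite scaleNr !scalerA [X in X *: _]mulrC subrr.
have := in_imageZ (to_fermat p ('X_i0 ^+ (w + w - (w.-1 + s)))) Hk; congr in_image.
rewrite !scalerA -!rmorphM -!exprD /var_pow; congr (to_fermat p ('X_i0 ^+ _) *: _).
by rewrite -addnA subnK //; lia.
Qed.

Lemma jacobian_var_pow i0 : exists A0, J *m A0 = (var_pow F p i0 (w + w))%:M.
Proof.
have [c cE] := choice (in_image_var_pow i0).
exists (\matrix_(i, j) c j i 0); apply/matrixP => i j.
transitivity ((J *m c j) i 0).
  by rewrite [LHS]mxE [RHS]mxE; apply: eq_bigr => k _; rewrite [X in _ * X]mxE.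
by rewrite -cE !mxE andbT mulr_natr.
Qed.

(** No entry of [J] has a constant term: a variable is not invariant, because its weight is prime to
    w > 1, and [f] has no linear term as every p_i is at least 2. *)
Lemma jacobian_not_split D : (0 < n)%N -> J *m D <> 1%:M.
Proof.
move=> n0 /matrixP /(_ (Ordinal n0) (Ordinal n0)); rewrite !mxE eqxx => E.
have lift_J k : exists g : S, g@_0 = 0 /\ J (Ordinal n0) k = to_fermat p g.
  have zlin g i : augmented p g -> (g^`M(i))@_0 = 0.
    move=> [gM _]; rewrite mcoeff_mderiv add0m; apply/eqP; rewrite mulrn_eq0 /=.
    rewrite mcoeff_eq0; apply/negP => /gM [l /weight_mondeg].
    rewrite (bigD1 i) //= mnm1E eqxx muln1 big1 ?addn0 => [ql|j ji]; last first.
      by rewrite mnm1E eq_sym (negPf ji) muln0.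
    have := coprime_omega_weight cop i; rewrite ql /coprime gcdnMl.
    by move=> /eqP wE; have := w1; rewrite wE.
  rewrite /jacobian mxE; case: splitP => j _; rewrite mxE.
    by exists ((z j)^`M(Ordinal n0)); split=> //; apply: zlin; have [zh _] := zgen; have [] := zh j.
  exists (f^`M(Ordinal n0)); split=> //; rewrite fermat_mderiv mcoeffZ mpolyXn mcoeffX.
  case: eqP => [/mnmP/(_ (Ordinal n0))|]; rewrite ?mulr0 //.
  rewrite mulmnE mnm1E eqxx mul1n mnm0E => pE.
  by have := sig_gt1 p (Ordinal n0); rewrite -(prednK (sig_gt0 p _)) pE.
have [g gE] := choice lift_J.
have [d dE] := choice (fun k => to_fermat_surj (D k (Ordinal n0))).
have /to_fermat_eq0 [h hE] : to_fermat p (\sum_k g k * d k - 1) = 0.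
  rewrite rmorphB rmorph1 rmorph_sum /=; apply/eqP; rewrite subr_eq0; apply/eqP.
  rewrite -[RHS]E; apply: eq_bigr => k _.
  by rewrite rmorphM /= -(gE k).2 -dE.
have := congr1 (mcoeff 0) hE.
rewrite mcoeffB raddf_sum /= big1 => [|k _]; last by rewrite rmorphM /= (gE k).1 mul0r.
rewrite rmorphM /= fermat_coef0 mulr0 sub0r mcoeff1 eqxx => /eqP.
by rewrite oppr_eq0 oner_eq0.
Qed.

End JacobianOfGenerators.

Lemma coprime_embedding_dim (F : numFieldType) n (p : signature n) e :
  (4 <= n)%N -> pairwise_coprime p -> (e <= n)%N -> embedding_dim F p e ->
  omega_weight p = 1%N.
Proof.
move=> n4 cop en emb; apply/eqP; rewrite eq_sym eqn_leq omega_weight_gt0 /=.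
rewrite leqNgt; apply/negP => w1.
have [t [z0 [te zh zs]]] := homogeneous_generators emb.
have [z zgen] := homog_generators_pad (leq_trans te en) (conj zh zs).
pose i k (kn : (k < 4)%N) : 'I_n := Ordinal (leq_trans kn n4).
pose i1 := @i 0 isT; pose i2 := @i 1 isT; pose i3 := @i 2 isT; pose i4 := @i 3 isT.
have dist : uniq [:: i1; i2; i3; i4] by [].
have [A1 JA1] := jacobian_var_pow cop w1 zgen i1.
have [A2 JA2] := jacobian_var_pow cop w1 zgen i2.
have [A3 JA3] := jacobian_var_pow cop w1 zgen i3.
have n0 : (0 < n)%N by apply: leq_trans (n4).
have [||||D /(jacobian_not_split cop w1 zgen n0) //] := split_of_regular_sequence JA1 JA2 JA3.
- exact: var_pow_regular1 dist _.
- exact: var_pow_regular2 dist _.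
(* The n-th powers are again powers of variables, with exponent (w + w) n. *)
- move=> a b; rewrite /var_pow -!rmorphXn -!exprM; exact: var_pow_regular2 dist _ _ _.
- exact: var_pow_regular3 dist _.
Qed.

(** * The theorem *)

(** Outside [D] all coordinates are 1 except the one at [j0], a root of -N where N counts the ones;
    [j1] ensures N > 0, so that root is not zero. *)
Lemma fermat_point (F : numClosedFieldType) n (p : signature n) (D : {set 'I_n}) j0 j1 :
  j0 \notin D -> j1 \notin D -> j1 != j0 ->
  exists x : 'I_n -> F, (fermat_poly F p).@[x] = 0 /\ forall j, (x j == 0) = (j \in D).
Proof.
move=> j0D j1D j10; pose N := #|~: D :\ j0|.
have N0 : (0 < N)%N by apply/card_gt0P; exists j1; rewrite !inE j10.
pose r : F := (p j0).-root (- N%:R).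
have rE : r ^+ p j0 = - N%:R by rewrite /r rootCK // sig_gt0.
pose x j : F := if j \in D then 0 else if j == j0 then r else 1.
exists x; split=> [|j]; last first.
  rewrite /x; case: ifP => jD; first by rewrite eqxx.
  case: (j == j0); last by rewrite oner_eq0.
  by rewrite /r rootC_eq0 ?sig_gt0 // oppr_eq0 pnatr_eq0 -leqn0 leqNgt N0.
rewrite fermat_meval (bigD1 j0) //= {1}/x (negPf j0D) eqxx rE.
rewrite (bigID (mem D)) /= big1 ?add0r => [|j /andP [_ jD]]; last first.
  by rewrite /x jD expr0n eqn0Ngt sig_gt0.
rewrite (eq_bigr (fun=> 1)) => [|j /andP [jj0 jD]]; last first.
  by rewrite /x (negPf jD) (negPf jj0) expr1n.
rewrite sumr_const (_ : #|_| = N) ?addNr //.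
by apply: eq_card => j; rewrite !inE.
Qed.

Section Origin.

Variables (F : numFieldType) (n : nat) (p : signature n).
Local Notation S := {mpoly F[n]}.
Local Notation f := (fermat_poly F p).
Local Notation R := (canonical_ring F p).

Lemma meval_origin (g : S) : g.@[fun=> 0] = g@_0.
Proof.
rewrite mevalE (mpolyE g) raddf_sum /= -mpolyE; apply: eq_bigr => m _.
rewrite mcoeffZ mcoeffX; congr (_ * _); have [->|m0] := eqVneq m 0%MM.
  by rewrite big1 // => i _; rewrite mnm0E expr0.
have /existsP [i mi] : [exists i, m i != 0%N].
  apply: contraNT m0; rewrite negb_exists => /forallP H; apply/eqP/mnmP => i.
  by rewrite mnm0E; apply/eqP; have := H i; rewrite negbK.
by rewrite (bigD1 i) //= expr0n (negPf mi) mul0r.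
Qed.

Lemma fermat_origin : f.@[fun=> 0] = 0.
Proof. by rewrite meval_origin fermat_coef0. Qed.

Lemma point_prime_origin (o : prime_idealr R) :
  is_point_prime (fun=> 0) o -> o =i canonical_max F p.
Proof.
move=> oE x; apply/idP/idP.
  have [g gM gE] := canonical_lift x; move/(oE x g gE); rewrite meval_origin => g0.
  by apply/canonical_maxP; exists g.
by move/canonical_maxP => [g [_ g0 gE]]; apply/(oE x g gE); rewrite meval_origin.
Qed.

Lemma fermat_mderiv_coef0 i : (f^`M(i))@_0 = 0.
Proof.
rewrite -meval_origin fermat_mderiv_meval expr0n.
by have := sig_gt1 p i; case: (p i) => [|[|k]] //= _; rewrite mulr0.
Qed.

Lemma sq_ideal_ext (A : comNzRingType) (I J : {pred A}) :
  I =i J -> {subset sq_ideal I <= sq_ideal J}.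
Proof.
move=> IJ x /asboolP [k [u [v [uv E]]]]; apply/asboolP; exists k, u, v; split=> // i.
by have [ui vi] := uv i; rewrite -!IJ.
Qed.

End Origin.

(** * The case w = 1 *)

Section WeightOne.

Variables (F : numFieldType) (n : nat) (p : signature n).
Local Notation S := {mpoly F[n]}.
Local Notation f := (fermat_poly F p).
Local Notation T := (fermat_ring F p).
Local Notation R := (canonical_ring F p).

Hypotheses (w1 : omega_weight p = 1%N) (n0 : (0 < n)%N).

Lemma canonical_all (g : S) : canonical_poly p g.
Proof.
move=> m _; apply: in_canonicalP; first exact: pairwise_coprime_of_weight1.
by rewrite w1 dvd1n.
Qed.

Lemma to_canonical_subproof (g : S) : to_fermat p g \in can_pred F p.
Proof. by apply/can_predP; exists g => //; apply: canonical_all. Qed.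

Definition to_canonical (g : S) : R := Sub (to_fermat p g) (to_canonical_subproof g).

Lemma val_to_canonical g : val (to_canonical g) = to_fermat p g.
Proof. by rewrite SubK. Qed.

Lemma to_canonical_zmod_morphism : zmod_morphism to_canonical.
Proof. by move=> g h; apply: val_inj; rewrite rmorphB /= rmorphB. Qed.
Lemma to_canonical_monoid_morphism : monoid_morphism to_canonical.
Proof.
split=> [|g h]; apply: val_inj; first by rewrite rmorph1 /= rmorph1.
by rewrite rmorphM /= rmorphM.
Qed.
HB.instance Definition _ := GRing.isZmodMorphism.Build S R to_canonical
  to_canonical_zmod_morphism.
HB.instance Definition _ := GRing.isMonoidMorphism.Build S R to_canonical
  to_canonical_monoid_morphism.

Lemma to_canonical_surj (x : R) : exists g, x = to_canonical g.
Proof. by have [g _ E] := canonical_lift x; exists g; apply: val_inj. Qed.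

Lemma to_canonical_eq0 g : to_canonical g = 0 <-> exists u, g = u * f.
Proof.
rewrite -to_fermat_eq0 -val_to_canonical; split=> [->|E]; first by rewrite rmorph0.
by apply: val_inj; rewrite E rmorph0.
Qed.

Lemma mem_canonical_max g : (to_canonical g \in canonical_max F p) <-> g@_0 = 0.
Proof.
have [o oE] := point_prime (fermat_origin F p).
rewrite -(point_prime_origin oE) -meval_origin; apply: oE; exact: val_to_canonical.
Qed.

(** A prime other than the origin misses some X_i, and the derivative of [f] along X_i is a unit
    times a power of X_i. *)
Lemma regular_away (P : prime_idealr R) : ~ (P =i canonical_max F p) -> regular_at P.
Proof.
move=> Pm; have [i iP] : exists i, to_canonical 'X_i \notin P.
  apply: contrapT => H; apply: Pm.
  have XP i : to_canonical 'X_i \in P by apply: contraT => iP; case: H; exists i.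
  have gP g : g@_0 = 0 -> to_canonical g \in P.
    move=> g0; rewrite [g]mpolyE rmorph_sum big_seq_cond; apply: rpred_sum => m.
    rewrite andbT => mg; have /existsP [i mi] : [exists i, (0 < m i)%N].
      apply: contraT; rewrite negb_exists => /forallP H0; move: mg.
      rewrite (_ : m = 0%MM) ?mcoeff_msupp ?g0 ?eqxx //; apply/mnmP => i.
      by rewrite mnm0E; apply/eqP; have := H0 i; rewrite -eqn0Ngt.
    rewrite -(@submK _ U_(i)%MM m); last first.
      by apply/mnm_lepP => j; rewrite mnm1E; case: eqP => [<-|].
    by rewrite mpolyXD -mul_mpolyC !rmorphM !idealMr.
  move=> x; have [g ->] := to_canonical_surj x.
  apply/idP/idP => [gx|/mem_canonical_max/gP //]; apply/mem_canonical_max.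
  apply/eqP; apply: contraT => g0.
  have : to_canonical (g@_0)%:MP \in P.
    rewrite -[(g@_0)%:MP](subKr g) rmorphB rpredB // gP // mcoeffB mcoeffC eqxx mulr1 subrr //.
  move/(idealMr (to_canonical (g@_0)^-1%:MP)).
  by rewrite -rmorphM -mpolyCM mulVf // mpolyC1 rmorph1 idealr1.
apply: (quotient_regular_at to_canonical_surj to_canonical_eq0 (fermat_neq0 F p n0) (j0 := i)).
rewrite fermat_mderiv -mul_mpolyC rmorphM rmorphXn prime_idealrM negb_or (prime_exp _ iP) andbT.
apply/negP => /(idealMr (to_canonical ((p i)%:R^-1)%:MP)).
rewrite -rmorphM -mpolyCM mulVf ?mpolyC1 ?rmorph1 ?idealr1 //.
by rewrite pnatr_eq0 -lt0n sig_gt0.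
Qed.

(** All n partial derivatives at 0 annihilate multiples of [f], because [f] has neither constant nor
    linear term; a regular point would force a relation between them, refuted by the variables. *)
Lemma singular_origin (o : prime_idealr R) :
  is_point_prime (fun=> 0) o -> ~ regular_at o.
Proof.
move=> oE oreg.
have [||||a [[i ai] aE]] := regular_point_derivations
    (lam := fun i g => (g^`M(i))@_0) (v := fun=> 0) n0 oE oreg.
- by move=> i g h; rewrite mderivD mcoeffD.
- move=> i g h _ _; rewrite mderivM mcoeffD !meval_origin.
  rewrite [X in X + _]rmorphM [X in _ + X]rmorphM /= addrC; congr (_ + _).
- move=> i h; rewrite mderivM mcoeffD.
  by rewrite [X in X + _]rmorphM [X in _ + X]rmorphM /= fermat_coef0 fermat_mderiv_coef0 !mulr0 addr0.
- by right.
have := aE 'X_i (@canonical_all _); rewrite meval_origin mcoeffX mnm1_eq0 => /(_ erefl).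
rewrite (bigD1 i) //= big1 ?addr0 => [|j ji]; last first.
  by rewrite mderivX mnm1E eq_sym (negPf ji) scale0r mcoeff0 mulr0.
rewrite mcoeff_mderiv add0m mcoeffXU eqxx mnm0E mulr1n mulr1 => a0.
by rewrite a0 eqxx in ai.
Qed.

(** As [f] has neither constant nor linear term, it imposes no linear relation on the variables
    modulo the square of the ideal. *)
Lemma embedding_dim_weight1 : embedding_dim F p n.
Proof.
have [o oE] := point_prime (fermat_origin F p).
have om := point_prime_origin oE; have mo : canonical_max F p =i o by move=> x; rewrite om.
exists (fun i => to_canonical 'X_i); split=> [i|x|a].
- by apply/mem_canonical_max; rewrite mcoeffX mnm1_eq0.
- have [g ->] := to_canonical_surj x => /mem_canonical_max g0.
  exists (fun i => g@_U_(i)); apply: (sq_ideal_ext om).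
  pose g' := g - \sum_i g@_U_(i) *: 'X_i.
  rewrite (_ : _ - _ = to_canonical g'); last first.
    rewrite rmorphB rmorph_sum; congr (_ - _); apply: eq_bigr => i _.
    by apply: val_inj; rewrite /= -mul_mpolyC rmorphM.
  have g'low m : m \in msupp g' -> (1 < mdeg m)%N.
    rewrite mcoeff_msupp; apply: contraNT; rewrite -leqNgt mcoeffB raddf_sum /= => m1.
    have [m0|m0] := posnP (mdeg m).
      move/eqP: m0; rewrite mdeg_eq0 => /eqP ->; rewrite g0 big1 ?subr0 // => i _.
      by rewrite mcoeffZ mcoeffX mnm1_eq0 mulr0.
    have /mdeg1P [i /eqP ->] : mdeg m == 1%N by rewrite eqn_leq m1.
    rewrite (bigD1 i) //= big1 => [|j ji]; rewrite mcoeffZ mcoeffXU.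
      by rewrite eqxx mulr1 addr0 subrr.
    by rewrite (negPf ji) mulr0.
  have [Z D M] := sq_ideal_is_ideal o.
  rewrite [g']mpolyE rmorph_sum big_seq_cond; elim/big_ind: _ => // m; rewrite andbT => /g'low m1.
  have /existsP [i mi] : [exists i, (0 < m i)%N].
    apply: contraTT m1; rewrite negb_exists => /forallP H0; rewrite mdegE big1 // => i _.
    by apply/eqP; have := H0 i; rewrite -eqn0Ngt.
  rewrite -(@submK _ U_(i)%MM m); last first.
    by apply/mnm_lepP => j; rewrite mnm1E; case: eqP => [<-|].
  rewrite mpolyXD -mul_mpolyC !rmorphM; apply: M; apply: sq_ideal_mul.
    rewrite om; apply/mem_canonical_max; rewrite mcoeffX.
    case: eqP => // E; have : (mdeg m <= 1)%N; last by rewrite leqNgt m1.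
    rewrite -(@submK _ U_(i)%MM m) ?E ?mdegD ?mdeg0 ?mdeg1 //.
    by apply/mnm_lepP => j; rewrite mnm1E; case: eqP => [<-|].
  by rewrite om; apply/mem_canonical_max; rewrite mcoeffX mnm1_eq0.
move=> /asboolP [k [u [v [uv E]]]] i.
have [u' uE] := choice (fun j => to_canonical_surj (u j)).
have [v' vE] := choice (fun j => to_canonical_surj (v j)).
have u0 j : (u' j)@_0 = 0 by have [H _] := uv j; apply/mem_canonical_max; rewrite -uE.
have v0 j : (v' j)@_0 = 0 by have [_ H] := uv j; apply/mem_canonical_max; rewrite -vE.
have /to_canonical_eq0 [h hE] :
    to_canonical (\sum_i a i *: 'X_i - \sum_j u' j * v' j) = 0.
  rewrite rmorphB !rmorph_sum; apply/eqP; rewrite subr_eq0; apply/eqP.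
  transitivity (\sum_i a i *: to_canonical 'X_i).
    by apply: eq_bigr => j _; apply: val_inj; rewrite /= -mul_mpolyC rmorphM.
  by rewrite E; apply: eq_bigr => j _; rewrite [RHS]rmorphM uE vE.
have dM (g1 g2 : S) : ((g1 * g2)^`M(i))@_0 = (g1^`M(i))@_0 * g2@_0 + g1@_0 * (g2^`M(i))@_0.
  by rewrite mderivM mcoeffD [X in X + _]rmorphM [X in _ + X]rmorphM.
have := congr1 (fun g => (g^`M(i))@_0) hE; rewrite dM fermat_coef0 fermat_mderiv_coef0.
have dsum l (G : 'I_l -> S) : ((\sum_j G j)^`M(i))@_0 = \sum_j ((G j)^`M(i))@_0.
  by rewrite (raddf_sum (mderiv i)) /= raddf_sum.
rewrite !mulr0 addr0 mderivB mcoeffB !dsum [X in _ - X]big1 => [|j _]; last first.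
  by rewrite dM u0 v0 mulr0 mul0r addr0.
rewrite subr0 (bigD1 i) //= big1 ?addr0 => [|j ji].
  by rewrite mderivZ mcoeffZ mcoeff_mderiv add0m mcoeffXU eqxx mnm0E mulr1n mulr1 => ->; rewrite inE.
by rewrite mderivZ mcoeffZ mcoeff_mderiv add0m mcoeffXU (negPf ji) mul0rn mulr0.
Qed.

End WeightOne.

Theorem theorem1p3 (K : realType) (n : nat) (hn : (4 <= n)%N) (p : signature n) :
  (hypersurface K[i] p /\ isolated_singularity (canonical_max K[i] p)) <->
  \sum_i ((p i)%:R)^-1 + (\prod_i (p i)%:R)^-1 = 1 :> rat.
Proof.
have n0 : (0 < n)%N by apply: leq_trans (hn).
rewrite omega_weight_eq1; split=> [[[d [[Q Qlt] _] emb] [o om [_ reg]]]|w1].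
  (* Any chain of primes in R has length less than n, so the embedding dimension d + 1 is at most
     n. *)
  have dn : (d < n)%N by apply: canonical_chain_bound n0 Qlt.
  apply: (coprime_embedding_dim hn _ dn emb) => i1 i2 i12; apply: contraT => ncop.
  have g1 : (1 < gcdn (p i1) (p i2))%N.
    rewrite ltn_neqAle eq_sym ncop gcdn_gt0 sig_gt0 //.
  (* Two further indices: both serve to build a point with zeros exactly at [i1] and [i2], and [i3]
     also absorbs the balance of degrees in invariant monomials. *)
  have /card_gt1P [i3 [i4 [i3D i4D i34]]] : (1 < #|~: [set i1; i2]|)%N.
    have := cardsC [set i1; i2]; rewrite cards2 i12 card_ord => E.
    by rewrite -(ltn_add2l 2) E.
  have [x [fx xE]] := @fermat_point K[i] n p [set i1; i2] i3 i4
    (etrans (esym (in_setC _ _)) i3D) (etrans (esym (in_setC _ _)) i4D)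
    (etrans (congr1 negb (eq_sym _ _)) i34).
  have [P PE] := point_prime fx.
  have x0 j : (x j == 0) = (j == i1) || (j == i2) by rewrite xE !inE.
  move: i3D; rewrite !inE negb_or => /andP [i31 i32].
  case: (noncoprime_not_regular fx x0 i12 i31 i32 g1 PE).
  (* A power of X_i3 lies in the ideal of the origin but does not vanish at [x], so [x] is not over
     the origin. *)
  apply: reg => Pm; have [N N0 NM] := in_canonical_var p i3.
  have [y yE] := canonical_elt (canonical_polyX NM : canonical_poly p ('X_[_] : {mpoly K[i][n]})).
  have : y \in canonical_max K[i] p.
    apply/canonical_maxP; exists 'X_[U_(i3) *+ N]; split=> //; first exact: canonical_polyX.
    rewrite mcoeffX; case: eqP => // /mnmP /(_ i3); rewrite mulmnE mnm1E eqxx mul1n mnm0E.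
    by move=> E; rewrite E in N0.
  rewrite -Pm => /(PE y _ yE); rewrite -mpolyXn rmorphXn /= mevalXU => /eqP.
  by rewrite expf_eq0 N0 x0 (negPf i31) (negPf i32).
pose j0 : 'I_n := Ordinal n0; pose j1 : 'I_n := Ordinal (leq_trans (isT : 1 < 4)%N hn).
(* A point with no zero coordinate is smooth, which gives the Krull dimension n - 1. *)
have [|||x [fx xE]] := @fermat_point K[i] n p set0 j0 j1; rewrite ?inE //.
have smooth : ((fermat_poly K[i] p)^`M(j0)).@[x] != 0.
  rewrite fermat_mderiv_meval mulf_neq0 ?expf_neq0 ?xE ?inE //.
  by rewrite pnatr_eq0 -lt0n sig_gt0.
have dimR := quotient_krull_dim (to_canonical_surj w1) (to_canonical_eq0 w1)
  (fermat_neq0 K[i] p n0) fx smooth.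
split.
  by exists n.-1 => //; rewrite prednK //; apply: embedding_dim_weight1.
have [o oE] := point_prime (fermat_origin K[i] p).
exists o; first exact: point_prime_origin.
split=> [|P]; first by apply: (singular_origin w1 n0 oE).
exact: regular_away.
Qed.
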